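(* Let $T$ be a triangulation of a convex $(n+3)$-gon, $\gamma$ a diagonal not in $T$ crossing the diagonals $\tau_{i_1},\dots,\tau_{i_d}$ of $T$ in order. Then the Newton polytope $N(T,\gamma)\subset\mathbb{R}^{2n+3}$ is described as follows. Its affine hull is the solution set of the equations: (i) for each edge $e$ of $T$ that is not an edge of $T'$: $x_e=0$; (ii) for each vertex $w$ of $T'$: $\sum_{e\ni w}x_e=1$ if $w$ is an endpoint of $\gamma$, and $\sum_{e\ni w}x_e=0$ if $w$ is not an endpoint of $\gamma$ (the sum over edges $e$ of $T'$ incident to $w$). Its facets are exactly those defined by the following inequalities: (iii) for every boundary segment $e$ of $T'$ not incident to $\gamma$: $x_e\ge 0$; (iv) for every pair $\{b,c\}$ of boundary segments of $T'$ that are opposite sides of $Q_{\tau_a}$ for a balanced diagonal $a\in D(\gamma)$, let $\{e,f\}$ be the other pair of opposite sides of $Q_{\tau_a}$. Then exactly one of the following holds, and one writes the indicated inequality: - if $\{e,f\}\subset\{\tau_{i_2},\dots,\tau_{i_{d-1}}\}$: $x_a+x_b+x_c\le 1$; - if one of $e,f$ (say $e$) is a boundary segment of $T'$: $x_e\ge 0$; - otherwise (where $e$ is the diagonal $\tau_{i_1}$ or $\tau_{i_d}$): $x_e\ge -1$.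
   Context: $T$ is a triangulation of a convex $(n+3)$-gon with diagonals $\tau_1,\dots,\tau_n$ and boundary segments $\tau_{n+1},\dots,\tau_{2n+3}$; coordinate $x_i$ of $\mathbb{R}^{2n+3}$ is indexed by $\tau_i$, and one writes $x_e$ for the coordinate of the edge $e$. Let $\mathcal{A}$ be the type $A$ cluster algebra with initial cluster variables $x_1,\dots,x_n$, frozen variables $x_{n+1},\dots,x_{2n+3}$, and initial quiver $Q_T$ (vertices at midpoints of the $\tau_i$, boundary ones frozen; in each triangle of $T$ inscribe a clockwise oriented triangle on the midpoints of its sides). Each diagonal $\gamma$ gives a cluster variable $x_\gamma$, a Laurent polynomial in $x_1,\dots,x_{2n+3}$; $N(T,\gamma)$ is its Newton polytope (convex hull of the exponent vectors of its monomials). $D(\gamma)=\{\tau_{i_1},\dots,\tau_{i_d}\}$ is the set of diagonals of $T$ crossed by $\gamma$ (ordered along $\gamma$). $T'$ is the part of $T$ consisting of all polygon vertices incident to $\gamma$ or to a diagonal in $D(\gamma)$, together with all edges (diagonals and boundary segments) of $T$ joining two such vertices; $T'$ is a triangulated subpolygon, and its boundary segments are the edges on the boundary of this subpolygon. For a diagonal $\tau_k$ of $T$, $Q_{\tau_k}$ is the quadrilateral formed by the two triangles of $T$ containing $\tau_k$. A diagonal $a\in D(\gamma)$ is balanced if some pair of opposite sides of $Q_{\tau_a}$ consists of boundary segments of $T'$, and imbalanced otherwise. *)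

(* Defs.v *)
From Stdlib Require ClassicalEpsilon.
From HB Require Import structures.
From mathcomp Require Import all_boot all_order all_algebra.
From mathcomp Require Import fraction mpoly.

Set Implicit Arguments.
Unset Strict Implicit.
Unset Printing Implicit Defensive.

Import GRing.Theory Num.Theory.
Local Open Scope ring_scope.

(** * Polytopes *)

Definition convex_hull (R : realFieldType) (m : nat)
    (S : 'rV[R]_m -> Prop) (x : 'rV[R]_m) : Prop :=
  exists (k : nat) (w : 'I_k -> R) (y : 'I_k -> 'rV[R]_m),
    [/\ forall j, S (y j), forall j, 0 <= w j, \sum_j w j = 1 &
        x = \sum_j w j *: y j].

Definition affine_hull (R : realFieldType) (m : nat)
    (S : 'rV[R]_m -> Prop) (x : 'rV[R]_m) : Prop :=
  exists (k : nat) (w : 'I_k -> R) (y : 'I_k -> 'rV[R]_m),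
    [/\ forall j, S (y j), \sum_j w j = 1 & x = \sum_j w j *: y j].

(* The affine hull of S is a translate of a k-dimensional linear subspace; in
   particular the empty set has no dimension in this sense. *)
Definition has_dim (R : realFieldType) (m : nat)
    (S : 'rV[R]_m -> Prop) (k : nat) : Prop :=
  exists (x0 : 'rV[R]_m) (U : {vspace 'rV[R]_m}),
    \dim U = k /\ forall x, affine_hull S x <-> x - x0 \in U.

Definition face (R : realFieldType) (m : nat)
    (P F : 'rV[R]_m -> Prop) : Prop :=
  exists (c : 'rV[R]_m) (b : R),
    (forall x, P x -> \sum_j c 0 j * x 0 j <= b) /\
    (forall x, F x <-> P x /\ \sum_j c 0 j * x 0 j = b).

Definition facet (R : realFieldType) (m : nat)
    (P F : 'rV[R]_m -> Prop) : Prop :=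
  face P F /\ exists k, has_dim F k /\ has_dim P k.+1.

(** * Newton polytopes of Laurent polynomials *)

Notation ratfun m := {fraction {mpoly rat[m]}}.

(* Exponent vectors of the monomials of the Laurent polynomial p / X^a; they do
   not depend on the choice of p and a representing f. *)
Definition exponent_vector (R : realFieldType) (m : nat) (f : ratfun m)
    (x : 'rV[R]_m) : Prop :=
  exists (p : {mpoly rat[m]}) (a mon : 'X_{1..m}),
    [/\ f = tofrac p / tofrac 'X_[a], mon \in msupp p &
        x = \row_j ((mon j)%:R - (a j)%:R)].

Definition newton_polytope (R : realFieldType) (m : nat) (f : ratfun m) :
    'rV[R]_m -> Prop :=
  convex_hull (exponent_vector (R := R) f).

(** * Seeds and mutation *)

(* A quiver on m vertices without loops and 2-cycles is encoded by the
   skew-symmetric matrix of entries #(arrows i -> j) - #(arrows j -> i). *)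
Record seed (m : nat) := Seed {
  seed_var : 'I_m -> ratfun m;
  seed_mx : 'M[int]_m
}.

Definition pos_part (z : int) : nat := if z is Posz k then k else 0%N.

Definition mutate_mx (m : nat) (k : 'I_m) (B : 'M[int]_m) : 'M[int]_m :=
  \matrix_(i, j)
    if (i == k) || (j == k) then - B i j
    else B i j + (pos_part (B i k) * pos_part (B k j))%N%:Z
               - (pos_part (- B i k)%R * pos_part (- B k j)%R)%N%:Z.

Definition mutate (m : nat) (k : 'I_m) (S : seed m) : seed m :=
  let X := seed_var S in let B := seed_mx S in
  Seed (fun j => if j == k then
                   (\prod_i X i ^+ pos_part (B i k)
                    + \prod_i X i ^+ pos_part (- B i k)) / X k
                 else X j)
       (mutate_mx k B).

(** * Triangulations of a convex polygon *)

(* The vertices of the (n+3)-gon are the elements of 'I_(n+3), numbered in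
   clockwise order; segments are two-element sets of vertices.
   cyc u v w: u, v, w are distinct and met in this order going clockwise. *)
Definition cyc (N : nat) (u v w : 'I_N) : bool :=
  [|| (u < v < w)%N, (v < w < u)%N | (w < u < v)%N].

Definition crosses (N : nat) (e f : {set 'I_N}) : bool :=
  [exists a, exists b, exists c, exists d,
    [&& e == [set a; b], f == [set c; d], cyc a c b & cyc b d a]].

(* e is a side of the convex polygon with vertex set V. *)
Definition side (N : nat) (V : {set 'I_N}) (e : {set 'I_N}) : bool :=
  [exists u in V, exists v in V,
    [&& u != v, e == [set u; v] & [forall w in V, ~~ cyc u w v]]].

Definition diagonal (N : nat) (e : {set 'I_N}) : bool :=
  (#|e| == 2%N) && ~~ side [set: 'I_N] e.

(* Labelled edges tau_1, ..., tau_(2n+3), with labels shifted to start at 0: the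
   labels below n are those of the diagonals. *)
Notation edges n := ('I_(2 * n + 3) -> {set 'I_(n + 3)}).

Definition triangulation (n : nat) (T : edges n) : Prop :=
  [/\ injective T,
      forall k : 'I_(2 * n + 3), (k < n)%N -> diagonal (T k),
      forall k : 'I_(2 * n + 3), (n <= k)%N -> side [set: 'I_(n + 3)] (T k),
      forall k l, ~~ crosses (T k) (T l) &
      forall e, diagonal e -> (forall k, ~~ crosses e (T k)) ->
        exists k, T k = e].

(* In a triangulation, three pairwise adjacent vertices always bound one of its
   triangles. *)
Definition triangle (n : nat) (T : edges n) (u v w : 'I_(n + 3)) : bool :=
  [&& [set u; v] \in codom T, [set v; w] \in codom T & [set u; w] \in codom T].

(* The quadrilateral around T k has vertices p, r, q, s in cyclic order. *)
Definition quad (n : nat) (T : edges n) (k : 'I_(2 * n + 3))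
    (p q r s : 'I_(n + 3)) : Prop :=
  [/\ T k = [set p; q], r != s, triangle T p q r & triangle T p q s].

(* {b, c} and {e, f} are the two pairs of opposite sides of the quadrilateral
   around T a. *)
Definition opposite_sides (n : nat) (T : edges n)
    (a b c e f : 'I_(2 * n + 3)) : Prop :=
  exists p q r s, quad T a p q r s /\
    [/\ T b = [set p; r], T c = [set q; s], T e = [set q; r]
      & T f = [set p; s]].

Definition flip (n : nat) (T : edges n) (k : 'I_(2 * n + 3)) (T1 : edges n) :
    Prop :=
  exists p q r s, [/\ quad T k p q r s, T1 k = [set r; s] &
    forall j, j != k -> T1 j = T j].

(** * The cluster algebra of a triangulation *)

(* In the triangle u, v, w (clockwise), the inscribed clockwise triangle has an
   arrow from the midpoint of uv to the midpoint of vw. *)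
Definition arrows (n : nat) (T : edges n) (i j : 'I_(2 * n + 3)) : nat :=
  #|[set t : 'I_(n + 3) * 'I_(n + 3) * 'I_(n + 3) |
      let: (u, v, w) := t in
      [&& cyc u v w, triangle T u v w, T i == [set u; v]
        & T j == [set v; w]]]|.

Definition initial_seed (n : nat) (T : edges n) : seed (2 * n + 3)%N :=
  Seed (fun k => tofrac 'X_k)
       (\matrix_(i, j) ((arrows T i j)%:Z - (arrows T j i)%:Z)).

(* Seeds of the cluster algebra with the labelled triangulations they
   correspond to: mutation at k corresponds to flipping the k-th diagonal (only
   labels of diagonals can be flipped, so frozen variables are not mutated). *)
Inductive seed_of (n : nat) (T : edges n) :
    edges n -> seed (2 * n + 3)%N -> Prop :=
| seed_of_initial : seed_of T T (initial_seed T)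
| seed_of_mutate T1 S k T2 :
    seed_of T T1 S -> flip T1 k T2 -> seed_of T T2 (mutate k S).

Definition is_cluster_variable (n : nat) (T : edges n)
    (g : {set 'I_(n + 3)}) (f : ratfun (2 * n + 3)%N) : Prop :=
  exists T1 S k, [/\ seed_of T T1 S, T1 k = g & f = seed_var S k].

(* The cluster variable x_g of the diagonal g: the unique rational function
   satisfying is_cluster_variable T g. *)
Definition cluster_variable (n : nat) (T : edges n) (g : {set 'I_(n + 3)}) :
    ratfun (2 * n + 3)%N :=
  ClassicalEpsilon.epsilon (inhabits 0) (is_cluster_variable T g).

(** * The part of the triangulation met by a diagonal g *)

Definition crossed (n : nat) (T : edges n) (g : {set 'I_(n + 3)}) :
    {set 'I_(2 * n + 3)} :=
  [set k | crosses (T k) g].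

(* Along a segment issued from p that crosses e and f, e is crossed before f:
   every endpoint of f is on e or is separated from p by e. *)
Definition precedes (N : nat) (p : 'I_N) (e f : {set 'I_N}) : Prop :=
  e != f /\ forall v, v \in f -> v \in e \/ crosses [set p; v] e.

(* T (i 0), ..., T (i (d-1)) are the diagonals of T crossed by the segment from
   p to q, in order from p to q. *)
Definition crossed_in_order (n : nat) (T : edges n) (p q : 'I_(n + 3))
    (d : nat) (i : 'I_d -> 'I_(2 * n + 3)) : Prop :=
  (forall k, k \in crossed T [set p; q] <-> exists j, i j = k) /\
  (forall j l : 'I_d, (j < l)%N -> precedes p (T (i j)) (T (i l))).

Definition sub_vertices (n : nat) (T : edges n) (g : {set 'I_(n + 3)}) :
    {set 'I_(n + 3)} :=
  g :|: \bigcup_(k in crossed T g) T k.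

Definition sub_edges (n : nat) (T : edges n) (g : {set 'I_(n + 3)}) :
    {set 'I_(2 * n + 3)} :=
  [set k | T k \subset sub_vertices T g].

Definition sub_boundary (n : nat) (T : edges n) (g : {set 'I_(n + 3)}) :
    {set 'I_(2 * n + 3)} :=
  [set k in sub_edges T g | side (sub_vertices T g) (T k)].

Definition balanced (n : nat) (T : edges n) (g : {set 'I_(n + 3)})
    (a : 'I_(2 * n + 3)) : Prop :=
  a \in crossed T g /\
  exists b c e f, [/\ opposite_sides T a b c e f,
    b \in sub_boundary T g & c \in sub_boundary T g].

(** * The equations and inequalities *)

Definition sub_equations (R : realFieldType) (n : nat) (T : edges n)
    (g : {set 'I_(n + 3)}) (x : 'rV[R]_(2 * n + 3)) : Prop :=
  (forall e, e \notin sub_edges T g -> x 0 e = 0) /\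
  (forall w, w \in sub_vertices T g ->
     \sum_(e in sub_edges T g | w \in T e) x 0 e =
       if w \in g then 1 else 0).

Definition balanced_config (n : nat) (T : edges n) (g : {set 'I_(n + 3)})
    (a b c e f : 'I_(2 * n + 3)) : Prop :=
  [/\ balanced T g a, opposite_sides T a b c e f,
      b \in sub_boundary T g & c \in sub_boundary T g].

Definition inner_crossed (m d : nat) (i : 'I_d -> 'I_m) (e : 'I_m) : Prop :=
  exists j : 'I_d, [/\ (0 < j)%N, (j.+1 < d)%N & e = i j].

Definition outer_crossed (m d : nat) (i : 'I_d -> 'I_m) (e : 'I_m) : Prop :=
  exists j : 'I_d, (j = 0%N :> nat \/ j.+1 = d) /\ e = i j.

Definition case_inner (m d : nat) (i : 'I_d -> 'I_m) (e f : 'I_m) : Prop :=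
  inner_crossed i e /\ inner_crossed i f.

Definition case_boundary (n : nat) (T : edges n) (g : {set 'I_(n + 3)})
    (e f : 'I_(2 * n + 3)) : Prop :=
  e \in sub_boundary T g \/ f \in sub_boundary T g.

Definition case_outer (n : nat) (T : edges n) (g : {set 'I_(n + 3)})
    (d : nat) (i : 'I_d -> 'I_(2 * n + 3)) (e f : 'I_(2 * n + 3)) : Prop :=
  [/\ ~ case_inner i e f, ~ case_boundary T g e f &
      outer_crossed i e \/ outer_crossed i f].

Definition exactly_one (A B C : Prop) : Prop :=
  [\/ [/\ A, ~ B & ~ C], [/\ ~ A, B & ~ C] | [/\ ~ A, ~ B & C]].

(* facet_ineq T g i lhs rhs: the inequality lhs x <= rhs x is one of those
   listed. As opposite_sides T a b c e f is equivalent to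
   opposite_sides T a c b f e, the last two rules also apply with f in place
   of e. *)
Inductive facet_ineq (R : realFieldType) (n : nat) (T : edges n)
    (g : {set 'I_(n + 3)}) (d : nat) (i : 'I_d -> 'I_(2 * n + 3)) :
    ('rV[R]_(2 * n + 3) -> R) -> ('rV[R]_(2 * n + 3) -> R) -> Prop :=
| ineq_boundary e :
    e \in sub_boundary T g -> [disjoint T e & g] ->
    facet_ineq T g i (fun=> 0) (fun x => x 0 e)
| ineq_case_inner a b c e f :
    balanced_config T g a b c e f -> case_inner i e f ->
    facet_ineq T g i (fun x => x 0 a + x 0 b + x 0 c) (fun=> 1)
| ineq_case_boundary a b c e f :
    balanced_config T g a b c e f -> case_boundary T g e f ->
    e \in sub_boundary T g ->
    facet_ineq T g i (fun=> 0) (fun x => x 0 e)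
| ineq_case_outer a b c e f :
    balanced_config T g a b c e f -> case_outer T g i e f ->
    outer_crossed i e ->
    facet_ineq T g i (fun=> -1) (fun x => x 0 e).

(* Main.v *)
(** By the Ptolemy relations, the cluster variable of the diagonal [u, v] is the
    determinant of two vectors attached to u and v, so it does not depend on the
    sequence of flips used to reach [u, v]. Applying Ptolemy's relation along the
    triangles crossed by the segment from p to q expands the cluster variable of
    [p, q] as a sum of Laurent monomials with coefficient 1, indexed by the order
    ideals of a fence (zigzag poset) with one element for each crossed diagonal.
    The exponent vector is an injective affine function of the indicator function of
    the ideal, so the Newton polytope is affinely isomorphic to the order polytope of
    the fence. Its facets are given by the covering relations, which correspond to
    the boundary segments not incident to [p, q], and by the lower and upper bounds
    at the minimal and maximal elements, which are the balanced diagonals. *)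

From Stdlib Require Classical_Prop ClassicalEpsilon.
From Stdlib Require FunctionalExtensionality PropExtensionality.
Require Import Defs.
From mathcomp Require Import all_boot all_order all_algebra.
From mathcomp Require Import fraction mpoly zify ring lra.

Set Implicit Arguments.
Unset Strict Implicit.
Unset Printing Implicit Defensive.

Import Order.TTheory GRing.Theory Num.Theory.
Local Open Scope ring_scope.

(** [cluster_variable] is an epsilon choice, so evaluating it needs a flip sequence that reaches the
    diagonal as well as a value common to all such sequences. The latter is an invariant of seeds:
    the exchange matrix stays the quiver matrix of the current triangulation, which turns mutation
    into Ptolemy's relation, and positivity at (1, ..., 1) keeps the denominators nonzero. The
    equations (i), (ii) cut out exactly the image of the affine map from fence coordinates z_0, ...,
    z_D to exponents: a solution is determined by the D + 1 coordinates at [kpb] and the [cc l], and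
    these are the ones that recover z. Facets come from one criterion: if a system of inequalities
    has a strictly feasible point and, for each inequality, a point where it alone is tight, its
    facets are exactly the tight sets. This is why bounds are kept only at extremal elements. What
    remains is to compute the slack of each listed inequality as a positive multiple of one fence
    slack; the multiple is 2 for the inequality with three terms and 1 otherwise. *)

Ltac cyclia := clear; rewrite ?/cyc -?val_eqE /=; lia.

(** * Convex polygons and triangulations *)

Lemma set2_eq (X : finType) (a b c d : X) :
  [set a; b] = [set c; d] -> (a = c /\ b = d) \/ (a = d /\ b = c).
Proof.
move=> E.
have: a \in [set c; d] by rewrite -E set21.
have: b \in [set c; d] by rewrite -E set22.
have: c \in [set a; b] by rewrite E set21.
have: d \in [set a; b] by rewrite E set22.
rewrite !inE => /orP[]/eqP ? /orP[]/eqP ? /orP[]/eqP ? /orP[]/eqP ?; subst; tauto.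
Qed.

Lemma crossesE N (a b c d : 'I_N) : crosses [set a; b] [set c; d] =
  (cyc a c b && cyc b d a) || (cyc a d b && cyc b c a).
Proof.
apply/idP/idP.
  case/existsP=> a' /existsP[b' /existsP[c' /existsP[d' /and4P[/eqP e1 /eqP e2]]]].
  by case: (set2_eq e1) => [[-> ->]|[-> ->]]; case: (set2_eq e2) => [[-> ->]|[-> ->]] h1 h2;
     move: h1 h2; rewrite /cyc; lia.
case/orP=> /andP[h1 h2]; apply/existsP; exists a; apply/existsP; exists b.
  by apply/existsP; exists c; apply/existsP; exists d; rewrite !eqxx h1 h2.
apply/existsP; exists d; apply/existsP; exists c.
by rewrite eqxx [_ == [set d; c]](_ : _ = true) ?h1 ?h2 // setUC eqxx.
Qed.

Lemma side_ends N (V : {set 'I_N}) e : side V e ->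
  exists u v, [/\ u \in V, v \in V, u != v, e = [set u; v] &
    forall w, w \in V -> ~~ cyc u w v].
Proof.
case/existsP=> u /andP[uV /existsP[v /andP[vV /and3P[uv /eqP -> /forallP h]]]].
by exists u, v; split => // w wV; move: (h w); rewrite wV.
Qed.

Lemma side_ordS N (u v : 'I_N) : u != v -> (forall w, ~~ cyc u w v) -> v = ordS u.
Proof.
move=> uv h; apply: val_inj => /=.
move: (h (ordS u)) uv; rewrite /cyc -val_eqE /=.
move: (ltn_ord u) (ltn_ord v); have [E|] := eqVneq u.+1 N.
  rewrite E modnn; lia.
move=> *; move: (modn_small (m := u.+1) (d := N)); lia.
Qed.

Section Triangulation.
Variables (n : nat) (T : edges n).

Definition adj (u v : 'I_(n + 3)) : bool := [set u; v] \in codom T.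

Lemma adjC u v : adj u v = adj v u. Proof. by rewrite /adj setUC. Qed.

Lemma adjP u v : reflect (exists k, T k = [set u; v]) (adj u v).
Proof.
by apply: (iffP codomP) => [[k ->]|[k <-]]; exists k.
Qed.

Hypothesis triT : triangulation T.

Lemma tri_inj : injective T. Proof. by case: triT. Qed.

Lemma label_ends k : exists u v, u != v /\ T k = [set u; v].
Proof.
case: triT => _ hd hs _ _; have [kn|kn] := ltnP k n.
  by case/andP: (hd k kn) => /cards2P[u [v [uv ->]]] _; exists u, v.
by have [u [v [_ _ uv -> _]]] := side_ends (hs k kn); exists u, v.
Qed.

Lemma adj_neq u v : adj u v -> u != v.
Proof.
case/adjP=> k E; have [u' [v' [uv E']]] := label_ends k.
by case: (set2_eq (etrans (esym E) E')) => [[-> ->]|[-> ->]] //; rewrite eq_sym.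
Qed.

Lemma adj_noncross a b c d : adj a b -> adj c d -> cyc a c b -> cyc b d a -> False.
Proof.
case/adjP=> k Ek /adjP[l El] h1 h2; case: triT => _ _ _ /(_ k l) + _.
by rewrite Ek El crossesE h1 h2.
Qed.

(** Counting: [triangulation] only says that boundary labels are sides, but these n + 3 labels are
    injective and there are at most n + 3 pairs of consecutive vertices, so none is missed. *)
Lemma adj_ordS u : adj u (ordS u).
Proof.
case: triT => inj _ hs _ _.
pose A := [set k : 'I_(2 * n + 3) | (n <= k)%N].
pose S := [set [set v; ordS v] | v : 'I_(n + 3)].
have sub : T @: A \subset S.
  apply/subsetP=> e /imsetP[k]; rewrite inE => kn ->.
  have [x [y [_ _ xy -> h]]] := side_ends (hs k kn).
  by apply/imsetP; exists x => //; rewrite {1}(side_ordS xy (fun w => h w (in_setT w))).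
have cA : (n + 3 <= #|A|)%N.
  have lt j : (j < n + 3 -> n + j < 2 * n + 3)%N by lia.
  pose f (j : 'I_(n + 3)) := Ordinal (lt _ (ltn_ord j)).
  have finj : injective f by move=> j l [] /addnI /val_inj.
  rewrite -[X in (X <= _)%N]card_ord -(card_imset _ finj); apply: subset_leq_card.
  by apply/subsetP=> k /imsetP[j _ ->]; rewrite inE /= leq_addr.
have E : T @: A = S.
  apply/eqP; rewrite eqEcard sub card_imset //; apply: leq_trans cA.
  by apply: leq_trans (leq_imset_card _ _) _; rewrite card_ord.
have: [set u; ordS u] \in S by apply/imsetP; exists u.
by rewrite -E => /imsetP[k _ Ek]; apply/adjP; exists k.
Qed.

Lemma adj_max u v : u != v ->
  (forall a b, adj a b -> ~~ (cyc u a v && cyc v b u)) -> adj u v.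
Proof.
move=> uv h; have [|ns] := boolP (side setT [set u; v]).
  case/side_ends=> x [y [_ _ xy E h']].
  rewrite /adj E (side_ordS xy (fun w => h' w (in_setT w))); exact: adj_ordS.
case: triT => _ _ _ _ /(_ [set u; v]) H; have [|k|k Ek] := H.
- by rewrite /diagonal cards2 uv ns.
- have [a [b [_ Ek]]] := label_ends k; rewrite Ek crossesE negb_or.
  have ab : adj a b by apply/adjP; exists k.
  by rewrite (h a b ab) (h b a) // adjC.
- by apply/adjP; exists k.
Qed.

(** Take [c] to be the neighbour of [a] farthest along the arc from [a] to [b]. An edge crossing
    [[c; b]] would have to start at [a], since it crosses neither [[a; b]] nor [[a; c]]; its other
    end would be a neighbour of [a] beyond [c]. *)
Lemma third_vertex a b x : adj a b -> cyc a x b ->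
  exists c, [/\ cyc a c b, adj a c & adj c b].
Proof.
move=> ab axb.
have c0 : cyc a (ordS a) b && adj a (ordS a).
  rewrite adj_ordS andbT.
  have h := @side_ordS _ a b (adj_neq ab); apply/negPn/negP => h1.
  have E : b = ordS a.
    have [//|ne] := eqVneq b (ordS a); case/negP: h1.
    move: ne axb; rewrite /cyc -val_eqE /=.
    move: (ltn_ord a) (ltn_ord b) (ltn_ord x); have [e|] := eqVneq a.+1 (n + 3)%N.
      rewrite e modnn; lia.
    by move=> *; move: (modn_small (m := a.+1) (d := n + 3)); lia.
  move: axb; rewrite E /cyc /=.
  move: (ltn_ord a) (ltn_ord x); have [e|] := eqVneq a.+1 (n + 3)%N.
    rewrite e modnn; lia.
  by move=> *; move: (modn_small (m := a.+1) (d := n + 3)); lia.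
pose P c := cyc a c b && adj a c.
have [c /andP[acb ac] cmax] :=
  @arg_maxnP _ (ordS a) P (fun c => #|[set y | cyc a y c]|) c0.
exists c; split => //; apply: adj_max => [|u w uw].
  by move: acb; cyclia.
apply/negP => /andP[cub bwc].
have aub : cyc a u b by move: acb cub; cyclia.
have nbwa : ~~ cyc b w a by apply/negP => bwa; apply: (adj_noncross ab uw).
have nawc : ~~ cyc a w c.
  apply/negP => awc; apply: (@adj_noncross a c w u ac) => //; first by rewrite adjC.
  by move: acb cub; cyclia.
have wa : w = a.
  by apply: val_inj; move: acb bwc nbwa nawc; cyclia.
have := cmax u; rewrite /P aub adjC -{1}wa uw => /(_ isT); apply/negP; rewrite -ltnNge.
apply: proper_card; apply/properP; split.
  by apply/subsetP=> y; rewrite !inE; move: acb cub; cyclia.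
by exists c; rewrite !inE; move: acb cub; cyclia.
Qed.

Lemma third_unique a b c c' : cyc a c b -> cyc a c' b ->
  adj a c -> adj c b -> adj a c' -> adj c' b -> c = c'.
Proof.
move=> h h' ac cb ac' c'b; apply: val_inj.
have n1 : ~~ cyc a c c'.
  apply/negP => acc'; apply: (adj_noncross ac' cb) => //; move: h h' acc'; cyclia.
have n2 : ~~ cyc a c' c.
  apply/negP => acc'; apply: (adj_noncross ac c'b) => //; move: h h' acc'; cyclia.
by move: h h' n1 n2; cyclia.
Qed.

End Triangulation.

(** * Oriented quadrilaterals and flips *)

Definition oquad n (T : edges n) k (p r q s : 'I_(n + 3)) : Prop :=
  [/\ T k = [set p; q], cyc p r q, cyc q s p &
      [/\ adj T p r, adj T r q, adj T q s & adj T s p]].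

Lemma cyc_total N (u v w : 'I_N) : u != v -> v != w -> u != w ->
  cyc u v w || cyc w v u.
Proof. by cyclia. Qed.

(** [quad] only asks the two apexes to be distinct. Uniqueness of the third vertex on each side of
    [[p; q]] puts them on opposite sides, and exchanging [p] and [q] if necessary gives clockwise
    order. *)
Lemma quad_oquad n (T : edges n) k p q r s : triangulation T ->
  quad T k p q r s -> oquad T k p r q s \/ oquad T k q r p s.
Proof.
move=> tT [Ek rs /and3P[pq qr pr] /and3P[_ qs ps]].
have u1 : cyc p r q -> cyc p s q -> False.
  move=> h1 h2; case/eqP: rs; apply: (third_unique tT h1 h2) => //.
    by rewrite adjC.
  by rewrite adjC.
have u2 : cyc q r p -> cyc q s p -> False.
  move=> h1 h2; case/eqP: rs; apply: (third_unique tT h1 h2) => //.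
    by rewrite adjC.
  by rewrite adjC.
have [npq nqr npr] : [/\ p != q, q != r & p != r] by split; apply: (adj_neq tT).
have [nqs nps] : [/\ q != s & p != s] by split; apply: (adj_neq tT).
have /orP h1 : cyc p r q || cyc q r p by apply: cyc_total => //; rewrite eq_sym.
have /orP h2 : cyc p s q || cyc q s p by apply: cyc_total => //; rewrite eq_sym.
case: h1 => h1; case: h2 => h2; try tauto; [left|right]; split => //.
- by split => //; rewrite adjC.
- by rewrite Ek setUC.
- by split => //; rewrite adjC.
Qed.

Lemma oquad_cross N (p r q s : 'I_N) : cyc p r q -> cyc q s p ->
  cyc r q s /\ cyc s p r.
Proof. by move=> h1 h2; split; move: h1 h2; cyclia. Qed.

Lemma adj_label n (T : edges n) k u v : T k = [set u; v] -> adj T u v.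
Proof. by move=> Ek; apply/adjP; exists k. Qed.

Section Flip.
Variables (n : nat) (T T1 : edges n) (k : 'I_(2 * n + 3)) (p r q s : 'I_(n + 3)).
Hypotheses (triT : triangulation T) (oq : oquad T k p r q s).
Hypotheses (T1k : T1 k = [set r; s]) (T1E : forall j, j != k -> T1 j = T j).

Lemma adj_flipW u v : adj T1 u v -> adj T u v \/ [set u; v] = [set r; s].
Proof.
case/adjP=> j; have [->|jk] := eqVneq j k; first by rewrite T1k => <-; right.
by rewrite T1E // => Ej; left; apply: adj_label Ej.
Qed.

Lemma adj_flip u v : adj T u v -> [set u; v] <> [set p; q] -> adj T1 u v.
Proof.
case: oq => Ek _ _ _ /adjP[j Ej] ne; apply/adjP; exists j; rewrite T1E //.
by apply/eqP => jk; case: ne; rewrite -Ej -Ek jk.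
Qed.

Lemma crosses_flipped : crosses (T k) [set r; s].
Proof. by case: oq => -> h1 h2 _; rewrite crossesE h1 h2. Qed.

(** An edge crossing [[r; s]] cannot leave the quadrilateral through any of its four sides, so it
    must be the old diagonal. *)
Lemma noncross_flipped x y :
  adj T x y -> cyc r x s -> cyc s y r -> x = q /\ y = p.
Proof.
case: oq => _ prq qsp [pr rq qs sp] xy h1 h2; have [rqs spr] := oquad_cross prq qsp.
have yx : adj T y x by rewrite adjC.
have n1 : ~~ cyc r x q.
  by apply/negP => h; apply: (adj_noncross triT rq xy) => //; move: h1 h2 h rqs; cyclia.
have n2 : ~~ cyc q x s.
  by apply/negP => h; apply: (adj_noncross triT qs xy) => //; move: h1 h2 h rqs; cyclia.
have n3 : ~~ cyc p y r.
  by apply/negP => h; apply: (adj_noncross triT pr yx) => //; move: h1 h2 h spr; cyclia.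
have n4 : ~~ cyc s y p.
  by apply/negP => h; apply: (adj_noncross triT sp yx) => //; move: h1 h2 h spr; cyclia.
split; apply: val_inj.
  by move: h1 n1 n2 rqs; cyclia.
by move: h2 n3 n4 spr; cyclia.
Qed.

Lemma flip_triangulation : triangulation T1.
Proof.
case: (oq) => Ek prq qsp [pr rq qs sp]; have [rqs spr] := oquad_cross prq qsp.
have [injT hd hs nc mx] := triT.
have rs : r != s by move: rqs; cyclia.
have nrs j : j != k -> ~~ crosses (T j) [set r; s].
  move=> jk; apply/negP; have [x [y [_ Ej]]] := label_ends triT j.
  have xy := adj_label Ej; have yx : adj T y x by rewrite adjC.
  rewrite Ej crossesE => /orP[]/andP[h1 h2]; case/eqP: jk; apply: injT; rewrite Ek Ej.
    by have [|| -> ->] := @noncross_flipped y x yx; [move: h1 h2; cyclia.. | ].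
  by have [|| -> ->] := @noncross_flipped x y xy; [move: h1 h2; cyclia.. | rewrite setUC].
have kn : (k < n)%N.
  rewrite ltnNge; apply/negP => /hs; rewrite Ek => /side_ends[u [v [_ _ _ E h]]].
  by case: (set2_eq E) => [[? ?]|[? ?]]; subst u v;
    move: (h r (in_setT _)) (h s (in_setT _)); rewrite ?prq ?qsp.
have drs : diagonal [set r; s].
  rewrite /diagonal cards2 rs /=; apply/negP => /side_ends[u [v [_ _ _ E h]]].
  by case: (set2_eq E) => [[? ?]|[? ?]]; subst u v;
    move: (h p (in_setT _)) (h q (in_setT _)); rewrite ?rqs ?spr.
have crC (e f : {set 'I_(n + 3)}) : crosses e f -> crosses f e.
  case/existsP=> a /existsP[b /existsP[c /existsP[d /and4P[/eqP -> /eqP ->]]]] h1 h2.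
  by rewrite crossesE; move: h1 h2; cyclia.
have nself : ~~ crosses [set r; s] [set r; s] by rewrite crossesE; cyclia.
split.
- have h j : j != k -> T1 j = T1 k -> False.
    move=> jk; rewrite T1E // T1k => E.
    by have := nc k j; rewrite E crosses_flipped.
  move=> j l; have [->|jk] := eqVneq j k; have [->|lk] := eqVneq l k => //.
  + by move/esym/(h l lk).
  + by move/(h j jk).
  + by rewrite !T1E //; apply: injT.
- by move=> j jn; have [->|jk] := eqVneq j k; rewrite ?T1k // T1E //; apply: hd.
- move=> j jn; have jk : j != k by apply: contraTneq jn => ->; rewrite -ltnNge.
  by rewrite T1E //; apply: hs.
- move=> j l; have [->|jk] := eqVneq j k; have [->|lk] := eqVneq l k.
  + rewrite T1k; exact: nself.
  + rewrite T1k (T1E lk); exact: contra (crC _ _) (nrs l lk).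
  + rewrite T1k (T1E jk); exact: nrs.
  + rewrite (T1E jk) (T1E lk); exact: nc.
(* Maximality: a diagonal that does not cross [T k] was already in [T]; one that does is confined by
   the four sides of the quadrilateral and can only be [[r; s]]. *)
- move=> e de nce; have [ce|ce] := boolP (crosses e (T k)); last first.
    have [|j Ej] := mx e de.
      move=> j; have [->|jk] := eqVneq j k; [exact: ce | rewrite -(T1E jk); exact: nce].
    have jk : j != k.
      by apply/eqP => jk; have := nce k; rewrite T1k -Ej jk crosses_flipped.
    by exists j; rewrite T1E.
  exists k; rewrite T1k; have [x [y [xy E]]] : exists x y, x != y /\ e = [set x; y].
    by case/andP: de => /cards2P[x [y [xy ->]]] _; exists x, y.
  have nadj a b : adj T a b -> [set a; b] <> [set p; q] ->
      ~~ (cyc x a y && cyc y b x).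
    move=> ab ne; have /adjP[j Ej] := adj_flip ab ne.
    by apply/negP => h; have := nce j; rewrite Ej E crossesE h.
  have ne1 a b : a != p -> a != q -> [set a; b] <> [set p; q].
    by move=> ap aq E1; have := set21 a b; rewrite E1 !inE (negbTE ap) (negbTE aq).
  have [rp rq' sp' sq] : [/\ r != p, r != q, s != p & s != q].
    by move: prq qsp; clear; rewrite /cyc -?val_eqE /=; split; lia.
  have npr := nadj r p (etrans (adjC _ _ _) pr) (ne1 _ _ rp rq').
  have nrq := nadj r q rq (ne1 _ _ rp rq').
  have nsp := nadj s p sp (ne1 _ _ sp' sq).
  have nsq := nadj s q (etrans (adjC _ _ _) qs) (ne1 _ _ sp' sq).
  have nswap a b : [set a; b] <> [set p; q] -> [set b; a] <> [set p; q].
    by rewrite setUC.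
  have npr' := nadj p r pr (nswap _ _ (ne1 _ _ rp rq')).
  have nrq' := nadj q r (etrans (adjC _ _ _) rq) (nswap _ _ (ne1 _ _ rp rq')).
  have nsp' := nadj p s (etrans (adjC _ _ _) sp) (nswap _ _ (ne1 _ _ sp' sq)).
  have nsq' := nadj q s qs (nswap _ _ (ne1 _ _ sp' sq)).
  rewrite E; move: ce; rewrite E Ek crossesE => ce.
  case/orP: ce => /andP[h1 h2].
  + have -> : x = s by apply: val_inj; move: h1 h2 qsp nsq nsp'; cyclia.
    have -> : y = r by apply: val_inj; move: h1 h2 prq npr' nrq; cyclia.
    by rewrite setUC.
  + have -> : x = r by apply: val_inj; move: h1 h2 prq npr nrq'; cyclia.
    by have -> : y = s by apply: val_inj; move: h1 h2 qsp nsq' nsp; cyclia.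
Qed.

Lemma flip_oquad : oquad T1 k r q s p.
Proof.
case: oq => _ prq qsp [pr rq qs sp]; have [rqs spr] := oquad_cross prq qsp.
have nes a b : a = r \/ a = s \/ b = r \/ b = s -> [set a; b] <> [set p; q].
  move=> h E; have : [/\ r != p, r != q, s != p & s != q].
    by move: prq qsp; clear; rewrite /cyc -?val_eqE /=; split; lia.
  case=> n1 n2 n3 n4.
  have : (a \in [set p; q]) && (b \in [set p; q]) by rewrite -E set21 set22.
  rewrite !inE.
  by case: h => [->|[->|[->|->]]];
    rewrite ?(negbTE n1) ?(negbTE n2) ?(negbTE n3) ?(negbTE n4) ?andbF.
split => //; split; apply: adj_flip => //; apply: nes; tauto.
Qed.

End Flip.

Lemma cyc_neq N (u v w : 'I_N) : cyc u v w -> [/\ u != v, v != w & u != w].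
Proof. by rewrite /cyc -?val_eqE /= => h; split; lia. Qed.

(** * Quivers of triangulations *)

(** Boolean form of [arrows]: the two edges determine the triple of vertices, so the count is at
    most 1, and the adjacencies along [T i] and [T j] are automatic. *)
Definition arr n (T : edges n) (i j : 'I_(2 * n + 3)) : bool :=
  [exists t : 'I_(n + 3) * 'I_(n + 3) * 'I_(n + 3),
    let: (u, v, w) := t in
    [&& cyc u v w, adj T u w, T i == [set u; v] & T j == [set v; w]]].

Lemma arrP n (T : edges n) i j :
  reflect (exists u v w, [/\ cyc u v w, adj T u w, T i = [set u; v] &
                             T j = [set v; w]]) (arr T i j).
Proof.
apply: (iffP existsP) => [[[[u v] w] /and4P[h1 h2 /eqP h3 /eqP h4]]|[u [v [w [h1 h2 h3 h4]]]]].
  by exists u, v, w.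
by exists (u, v, w); rewrite h1 h2 h3 h4 !eqxx.
Qed.

Lemma set2_chain (X : finType) (u v w u' v' w' : X) :
  u != v -> v != w -> u != w ->
  [set u; v] = [set u'; v'] -> [set v; w] = [set v'; w'] -> [/\ u' = u, v' = v & w' = w].
Proof.
move=> /eqP n1 /eqP n2 /eqP n3 /set2_eq[[? ?]|[? ?]] /set2_eq[[? ?]|[? ?]];
  by split; congruence.
Qed.

Lemma arr_at n (T : edges n) i j u v w :
  T i = [set u; v] -> T j = [set v; w] -> cyc u v w -> arr T i j = adj T u w.
Proof.
move=> Ei Ej h; apply/arrP/idP => [[u' [v' [w' [h' uw' Ei' Ej']]]]|uw].
  have [n1 n2 n3] := cyc_neq h.
  by have [<- _ <-] := set2_chain n1 n2 n3 (etrans (esym Ei) Ei') (etrans (esym Ej) Ej').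
by exists u, v, w.
Qed.

Lemma arr_asym n (T : edges n) i j : arr T i j -> arr T j i = false.
Proof.
case/arrP=> u [v [w [h _ Ei Ej]]]; apply/negbTE/negP => /arrP[u' [v' [w' [h' _ Ej' Ei']]]].
have [n1 n2 n3] := cyc_neq h.
have E1 : [set u; v] = [set w'; v'] by rewrite -Ei Ei' setUC.
have E2 : [set v; w] = [set v'; u'] by rewrite -Ej Ej' setUC.
have [? ? ?] := set2_chain n1 n2 n3 E1 E2.
by subst; move: h h'; cyclia.
Qed.

Lemma arrowsE n (T : edges n) i j : arrows T i j = arr T i j.
Proof.
have triE u v w : cyc u v w -> T i = [set u; v] -> T j = [set v; w] ->
    triangle T u v w = adj T u w.
  move=> h Ei Ej; rewrite /triangle -/(adj T u w) -/(adj T u v) -/(adj T v w).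
  by rewrite (adj_label Ei) (adj_label Ej).
rewrite /arrows; set S := [set _ | _]; case: arrP => [[u [v [w [h uw Ei Ej]]]]|h].
  suff -> : S = [set (u, v, w)] by rewrite cards1.
  apply/setP=> -[[u' v'] w']; rewrite !inE.
  apply/and4P/eqP => [[h' _ /eqP Ei' /eqP Ej']|[-> -> ->]]; last first.
    by rewrite Ei Ej !eqxx; split => //; rewrite triE.
  have [n1 n2 n3] := cyc_neq h.
  by have [-> -> ->] := set2_chain n1 n2 n3 (etrans (esym Ei) Ei') (etrans (esym Ej) Ej').
apply/eqP; rewrite cards_eq0; apply/eqP/setP => -[[u v] w]; rewrite !inE.
apply/negP => /and4P[h1 h2 /eqP h3 /eqP h4]; apply: h; exists u, v, w.
by split => //; rewrite -(triE u v w).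
Qed.

Definition qmx n (T : edges n) : 'M[int]_(2 * n + 3) :=
  \matrix_(i, j) ((arrows T i j)%:Z - (arrows T j i)%:Z).

Lemma qmxE n (T : edges n) i j : qmx T i j = (arr T i j)%:Z - (arr T j i)%:Z.
Proof. by rewrite mxE !arrowsE. Qed.

(** As [arr] is antisymmetric, nothing cancels in the difference: the exponents of the exchange
    relation are the arrows themselves. *)
Lemma pos_part_qmx n (T : edges n) i j : pos_part (qmx T i j) = arr T i j.
Proof.
rewrite qmxE; have [/arr_asym ->|_] := boolP (arr T i j); first by rewrite subr0.
by case: arr.
Qed.

Lemma pos_part_qmxN n (T : edges n) i j : pos_part (- qmx T i j) = arr T j i.
Proof.
by rewrite -pos_part_qmx !qmxE opprB.
Qed.

Section QuadArrows.
Variables (n : nat) (T : edges n) (k kpr krq kqs ksp : 'I_(2 * n + 3)).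
Variables (p r q s : 'I_(n + 3)).
Hypotheses (triT : triangulation T) (oq : oquad T k p r q s).
Hypotheses (Epr : T kpr = [set p; r]) (Erq : T krq = [set r; q]).
Hypotheses (Eqs : T kqs = [set q; s]) (Esp : T ksp = [set s; p]).

Lemma arr_to_quad i : arr T i k = (i == krq) || (i == ksp).
Proof.
case: oq => Ek prq qsp [pr rq qs sp].
apply/idP/idP => [/arrP[u [v [w [h uw Ei]]]]|/orP[]/eqP->].
- rewrite Ek => /set2_eq[[? ?]|[? ?]]; subst v w; apply/orP; [right|left];
    apply/eqP/(tri_inj triT); rewrite Ei ?Esp ?Erq.
  + suff -> : u = s by [].
    apply: (third_unique triT _ qsp) => //; first by move: h; cyclia.
      by rewrite adjC.
    exact: adj_label Ei.
  + suff -> : u = r by [].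
    apply: (third_unique triT _ prq) => //; first by move: h; cyclia.
      by rewrite adjC.
    exact: adj_label Ei.
- rewrite (arr_at Erq (etrans Ek (setUC _ _))); first by rewrite adjC.
  by move: prq; cyclia.
- by rewrite (arr_at Esp Ek); [rewrite adjC | move: qsp; cyclia].
Qed.

Lemma arr_from_quad i : arr T k i = (i == kpr) || (i == kqs).
Proof.
case: oq => Ek prq qsp [pr rq qs sp].
apply/idP/idP => [/arrP[u [v [w [h uw + Ei]]]]|/orP[]/eqP->].
- rewrite Ek => /set2_eq[[? ?]|[? ?]]; subst v u; apply/orP; [right|left];
    apply/eqP/(tri_inj triT); rewrite Ei ?Eqs ?Epr.
  + suff -> : w = s by [].
    apply: (third_unique triT _ qsp) => //; first by move: h; cyclia.
      exact: adj_label Ei.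
    by rewrite adjC.
  + suff -> : w = r by [].
    apply: (third_unique triT _ prq) => //; first by move: h; cyclia.
      exact: adj_label Ei.
    by rewrite adjC.
- rewrite (arr_at (etrans Ek (setUC _ _)) Epr); first by rewrite adjC.
  by move: prq; cyclia.
- by rewrite (arr_at Ek Eqs); [rewrite adjC | move: qsp; cyclia].
Qed.

End QuadArrows.

Section FlipArrows.
Variables (n : nat) (T T1 : edges n) (k kpr krq kqs ksp : 'I_(2 * n + 3)).
Variables (p r q s : 'I_(n + 3)).
Hypotheses (triT : triangulation T) (oq : oquad T k p r q s).
Hypotheses (T1k : T1 k = [set r; s]) (T1E : forall j, j != k -> T1 j = T j).
Hypotheses (Epr : T kpr = [set p; r]) (Erq : T krq = [set r; q]).
Hypotheses (Eqs : T kqs = [set q; s]) (Esp : T ksp = [set s; p]).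

Let triT1 : triangulation T1 := flip_triangulation triT oq T1k T1E.
Let oq1 : oquad T1 k r q s p := flip_oquad oq T1k T1E.

Lemma quad_labels_neq :
  [/\ kpr != k, krq != k, kqs != k & ksp != k] /\
  [/\ kpr != krq, kpr != kqs, kpr != ksp, krq != kqs & krq != ksp] /\ kqs != ksp.
Proof.
case: oq => Ek prq qsp _.
have [pr rq pq] := cyc_neq prq; have [qs sp _] := cyc_neq qsp.
have [rqs spr] := oquad_cross prq qsp; have [_ _ rs] := cyc_neq rqs.
by repeat split; apply/eqP => E; move: (congr1 T E); rewrite ?Ek ?Epr ?Erq ?Eqs ?Esp;
  move/eqP: pr => pr; move/eqP: rq => rq; move/eqP: pq => pq; move/eqP: qs => qs;
  move/eqP: sp => sp; move/eqP: rs => rs;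
  move/set2_eq => [[? ?]|[? ?]]; congruence.
Qed.

(** The triangles [prq], [qsp] give way to [rqs], [spr]: the arrows [pr -> rq] and [qs -> sp]
    disappear, [rq -> qs] and [sp -> pr] appear. Writing this additively keeps it in the natural
    numbers. *)
Lemma arr_flip i j : i != k -> j != k ->
  (arr T1 i j + ((i == kpr) && (j == krq)) + ((i == kqs) && (j == ksp)) =
   arr T i j + ((i == krq) && (j == kqs)) + ((i == ksp) && (j == kpr)))%N.
Proof.
move=> ik jk; case: (oq) => Ek prq qsp [pr rq qs sp].
have [rqs spr] := oquad_cross prq qsp.
have [[n1 n2 n3 n4] [[n5 n6 n7 n8 n9] n10]] := quad_labels_neq.
have T1' l u v : l != k -> T l = [set u; v] -> T1 l = [set u; v] by move=> lk <-; exact: T1E.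
have npq1 : adj T1 p q = false.
  apply/negbTE/negP => h; case/adjP: h => l; have [->|lk] := eqVneq l k.
    rewrite T1k => E; have := crosses_flipped oq; rewrite Ek E crossesE; cyclia.
  by rewrite T1E // -Ek => /(tri_inj triT)/eqP; rewrite (negbTE lk).
have nrs : adj T r s = false.
  by apply/negbTE/negP => h; apply: (adj_noncross triT (adj_label Ek) h).
have [/andP[/eqP-> /eqP->]|c1] := boolP ((i == kpr) && (j == krq)).
  rewrite (negbTE n5) (negbTE n6) (negbTE n7) /=.
  rewrite (arr_at (T1' _ _ _ n1 Epr) (T1' _ _ _ n2 Erq) prq) npq1.
  by rewrite (arr_at Epr Erq prq) (adj_label Ek).
have [/andP[/eqP-> /eqP->]|c2] := boolP ((i == kqs) && (j == ksp)).
  rewrite [kqs == krq]eq_sym (negbTE n8) (negbTE n10) /=.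
  rewrite (arr_at (T1' _ _ _ n3 Eqs) (T1' _ _ _ n4 Esp) qsp) adjC npq1.
  by rewrite (arr_at Eqs Esp qsp) adjC (adj_label Ek).
have [/andP[/eqP-> /eqP->]|c3] := boolP ((i == krq) && (j == kqs)).
  rewrite (negbTE n9) /=.
  rewrite (arr_at (T1' _ _ _ n2 Erq) (T1' _ _ _ n3 Eqs) rqs) (adj_label T1k).
  by rewrite (arr_at Erq Eqs rqs) nrs.
have [/andP[/eqP-> /eqP->]|c4] := boolP ((i == ksp) && (j == kpr)).
  rewrite (arr_at (T1' _ _ _ n4 Esp) (T1' _ _ _ n1 Epr) spr) adjC (adj_label T1k).
  by rewrite (arr_at Esp Epr spr) adjC nrs.
rewrite !addn0; congr nat_of_bool; apply/arrP/arrP => -[u [v [w [h uw Ei Ej]]]].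
- exists u, v, w; rewrite -(T1E ik) -(T1E jk); split => //.
  have uv1 := adj_label Ei; have vw1 := adj_label Ej.
  move: Ei Ej; rewrite (T1E ik) (T1E jk) => Ei Ej.
  have [//|/set2_eq[[? ?]|[? ?]]] := adj_flipW T1k T1E uw; subst u w.
    have E : v = q by case: oq1 => _ _ _ [? ? ? ?]; apply: (third_unique triT1 h rqs).
    by case/andP: c3; split; apply/eqP/(tri_inj triT); rewrite ?Ei ?Ej E ?Erq ?Eqs.
  have E : v = p by case: oq1 => _ _ _ [? ? ? ?]; apply: (third_unique triT1 h spr).
  by case/andP: c4; split; apply/eqP/(tri_inj triT); rewrite ?Ei ?Ej E ?Esp ?Epr.
- exists u, v, w; rewrite (T1E ik) (T1E jk); split => //.
  have uv1 := adj_label Ei; have vw1 := adj_label Ej.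
  apply: (adj_flip oq T1E uw) => /set2_eq[[? ?]|[? ?]]; subst u w.
    have E : v = r by apply: (third_unique triT h prq).
    by case/andP: c1; split; apply/eqP/(tri_inj triT); rewrite ?Ei ?Ej E ?Epr ?Erq.
  have E : v = s by apply: (third_unique triT h qsp).
  by case/andP: c2; split; apply/eqP/(tri_inj triT); rewrite ?Ei ?Ej E ?Eqs ?Esp.
Qed.

(** Paths through [k] run from [rq], [sp] to [pr], [qs]. Of the four composites, two are the new
    arrows and two cancel the arrows that disappear. *)
Lemma mutate_qmx : mutate_mx k (qmx T) = qmx T1.
Proof.
have [[n1 n2 n3 n4] _] := quad_labels_neq.
have E1 := arr_to_quad triT oq Erq Esp; have E2 := arr_from_quad triT oq Epr Eqs.
have T1' l u v : l != k -> T l = [set u; v] -> T1 l = [set u; v] by move=> lk <-; exact: T1E.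
have F1 := arr_to_quad triT1 oq1 (T1' _ _ _ n3 Eqs) (T1' _ _ _ n1 Epr).
have F2 := arr_from_quad triT1 oq1 (T1' _ _ _ n2 Erq) (T1' _ _ _ n4 Esp).
apply/matrixP=> i j; rewrite mxE !pos_part_qmx !pos_part_qmxN.
have [->|ik] := eqVneq i k.
  by rewrite /= !qmxE F1 F2 E1 E2 opprB; congr (_%:Z - _%:Z); rewrite orbC.
have [->|jk] := eqVneq j k.
  by rewrite /= !qmxE F1 F2 E1 E2 opprB; congr (_%:Z - _%:Z); rewrite orbC.
rewrite /= !qmxE !E1 !E2; move: (arr_flip ik jk) (arr_flip jk ik).
have [_ [[m1 m2 m3 m4 m5] m6]] := quad_labels_neq.
have dj (a b : 'I_(2 * n + 3)) l : a != b -> ((l == a) || (l == b) : nat) = ((l == a) + (l == b))%N.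
  by move=> ab; have [->|] := eqVneq l a; rewrite ?(negbTE ab).
rewrite !dj // -!mulnb.
move: (arr T1 i j) (arr T1 j i) (arr T i j) (arr T j i) => a1 a2 a3 a4.
move: (i == kpr) (i == krq) (i == kqs) (i == ksp) => i1 i2 i3 i4.
move: (j == kpr) (j == krq) (j == kqs) (j == ksp) => j1 j2 j3 j4.
move=> /(congr1 Posz) + /(congr1 Posz).
rewrite !(PoszD, PoszM) => h1 h2.
have -> : a1%:Z = a3%:Z + i2%:Z * j3%:Z + i4%:Z * j1%:Z - i1%:Z * j2%:Z - i3%:Z * j4%:Z.
  by rewrite -h1; ring.
have -> : a2%:Z = a4%:Z + j2%:Z * i3%:Z + j4%:Z * i1%:Z - j1%:Z * i2%:Z - j3%:Z * i4%:Z.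
  by rewrite -h2; ring.
ring.
Qed.

End FlipArrows.

(** * Lambda lengths *)

Section LambdaLengths.
Variables (n : nat) (T : edges n) (K : fieldType) (x : 'I_(2 * n + 3) -> K).
Hypotheses (triT : triangulation T) (x_neq0 : forall k, x k != 0).

Definition det2 (u v : K * K) : K := u.1 * v.2 - u.2 * v.1.

(** Working on intervals of the linear order, not on cyclic arcs, keeps the sign of [det2] uniform.
    Given the vectors at the ends of an edge, the triangle on it forces the vector of its third
    vertex, and the induction splits the interval there. *)
Lemma det_interval m (a b : 'I_(n + 3)) k (va vb : K * K) :
  (b - a <= m)%N -> (a < b)%N -> T k = [set a; b] -> det2 va vb = x k ->
  exists v, [/\ v a = va, v b = vb &
    forall (u w : 'I_(n + 3)) l, (a <= u)%N -> (u < w)%N -> (w <= b)%N ->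
      T l = [set u; w] -> det2 (v u) (v w) = x l].
Proof.
elim: m a b k va vb => [|m IHm] a b k va vb; first lia.
move=> ltm ab Ek Dab; have ba : (b == a) = false by move: ab; clear; rewrite -val_eqE /=; lia.
have adjab := adj_label Ek.
have [y yP|none] := pickP [pred y : 'I_(n + 3) | (a < y < b)%N]; last first.
  exists (fun u => if u == a then va else vb).
  rewrite eqxx; split => //; first by rewrite ba.
  move=> u w l au uw wb El; move: (none u) (none w) => /= nu nw.
  have [eu ew] : u = a /\ w = b by split; apply: val_inj => /=; lia.
  by subst u w; rewrite eqxx ba Dab; congr x; apply: (tri_inj triT); rewrite Ek El.
have ayb : cyc a y b by move: yP; rewrite /cyc /=; lia.
have [c [acb ac cb]] := third_vertex triT adjab ayb.
have {acb} /andP[ltac ltcb] : (a < c < b)%N by move: acb ab; rewrite /cyc; clear; lia.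
have /adjP[k1 E1] := ac; have /adjP[k2 E2] := cb.
(* The only vector with determinant [x k1] against [va] and [x k2] against [vb], because
   [det2 va vb = x k]. *)
pose vc := ((x k2 * va.1 + x k1 * vb.1) / x k, (x k2 * va.2 + x k1 * vb.2) / x k).
have xk := x_neq0 k.
have Dac : det2 va vc = x k1.
  apply: (mulIf xk); rewrite -[in RHS]Dab /vc /det2 /=; field; exact: xk.
have Dcb : det2 vc vb = x k2.
  apply: (mulIf xk); rewrite -[in RHS]Dab /vc /det2 /=; field; exact: xk.
have [l1 l2] : (c - a <= m /\ b - c <= m)%N by move: ltm ltac ltcb; clear; lia.
have [v1 [v1a v1c h1]] := IHm a c k1 va vc l1 ltac E1 Dac.
have [v2 [v2c v2b h2]] := IHm c b k2 vc vb l2 ltcb E2 Dcb.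
exists (fun u : 'I_(n + 3) => if (u <= c)%N then v1 u else v2 u); split.
- by rewrite (ltnW ltac).
- by rewrite leqNgt ltcb.
move=> u w l au uw wb El; have uwT := adj_label El.
have [wc|cw] := leqP w c.
  by rewrite (leq_trans (ltnW uw) wc); apply: h1.
have [uc|cu] := leqP u c; last by apply: h2 => //; apply: ltnW.
have [E|cu] := eqVneq c u; first by subst u; rewrite v1c -v2c; apply: h2.
have {uc cu} uc : (u < c)%N by rewrite ltn_neqAle uc andbT eq_sym.
(* The remaining edges pass over [c]; crossing neither [[a; c]] nor [[c; b]], such an edge is
   [[a; b]]. *)
have [eu|nu] := eqVneq u a; last first.
  case: (adj_noncross triT ac uwT); move: nu au uc cw uw ltac; cyclia.
subst u; have [ew|nw] := eqVneq w b; last first.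
  by case: (adj_noncross triT cb (etrans (adjC _ _ _) uwT));
    move: nw wb uc cw uw ltac ltcb; cyclia.
subst w; have -> : l = k by apply: (tri_inj triT); rewrite El.
by rewrite v1a v2b.
Qed.

Lemma det_vectors : exists v : 'I_(n + 3) -> K * K,
  forall (u w : 'I_(n + 3)) l, (u < w)%N -> T l = [set u; w] -> det2 (v u) (v w) = x l.
Proof.
have h0 : (0 < n + 3)%N by lia.
have h1 : (n + 2 < n + 3)%N by lia.
(* The side joining the last vertex to the first spans an interval that is the whole polygon. *)
pose a := Ordinal h0; pose b := Ordinal h1.
have ba : ordS b = a.
  by apply: val_inj; rewrite /= -addnS modnn.
have /adjP[k Ek] := adj_ordS triT b; rewrite ba setUC in Ek.
have ab : (a < b)%N by rewrite /=; lia.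
have D : det2 (1, 0) (0, x k) = x k by rewrite /det2 /= mul1r mul0r subr0.
have [v [_ _ h]] := det_interval (leqnn _) ab Ek D.
exists v => u w l uw El; apply: h => //=.
by move: (ltn_ord w); lia.
Qed.

Lemma lambda_lengths : exists lam : 'I_(n + 3) -> 'I_(n + 3) -> K,
  [/\ forall u w, lam u w = lam w u,
      forall k u w, T k = [set u; w] -> lam u w = x k &
      forall p r q s, cyc p r q -> cyc q s p ->
        lam p q * lam r s = lam p r * lam q s + lam r q * lam s p].
Proof.
have [v hv] := det_vectors.
(* Putting the smaller vertex first makes [lam] symmetric. Ptolemy's relation is then the three-term
   Pluecker relation for four plane vectors, with signs depending on where the cyclic order is
   cut. *)
pose lam (u w : 'I_(n + 3)) := if (u < w)%N then det2 (v u) (v w) else det2 (v w) (v u).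
exists lam; split.
- move=> u w; rewrite /lam; by case: ltngtP => // /val_inj ->.
- move=> k u w Ek; rewrite /lam; case: ltngtP => [uw|wu|/val_inj E].
  + exact: hv.
  + by apply: hv => //; rewrite Ek setUC.
  + by have := adj_neq triT (adj_label Ek); rewrite E eqxx.
- move=> p r q s h1 h2; rewrite /lam /det2.
  move: (v p) (v q) (v r) (v s) => [p1 p2] [q1 q2] [r1 r2] [s1 s2] /=.
  by move: h1 h2; rewrite /cyc; case: (ltngtP p r) => ?; case: (ltngtP r q) => ?;
    case: (ltngtP q s) => ?; case: (ltngtP s p) => ?; case: (ltngtP p q) => ?;
    case: (ltngtP r s) => ? *; first [lia | ring].
Qed.

End LambdaLengths.

(** * Cluster variables *)

(* A subtraction-free rational function has a positive value at (1, ..., 1), hence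
   is nonzero. *)
Definition posf m (f : ratfun m) : Prop :=
  exists P Q : {mpoly rat[m]},
    [/\ f = tofrac P / tofrac Q, 0 < P.@[fun=> 1] & 0 < Q.@[fun=> 1]].

Lemma meval_gt0_neq0 m (P : {mpoly rat[m]}) : 0 < P.@[fun=> 1] -> tofrac P != 0.
Proof. by apply: contraTneq => /eqP; rewrite tofrac_eq0 => /eqP ->; rewrite meval0 ltxx. Qed.

Lemma posf_neq0 m (f : ratfun m) : posf f -> f != 0.
Proof.
by case=> P [Q [-> hP hQ]]; rewrite mulf_neq0 ?invr_neq0 //; apply: meval_gt0_neq0.
Qed.

Lemma posfD m (f g : ratfun m) : posf f -> posf g -> posf (f + g).
Proof.
case=> P [Q [-> hP hQ]] [P' [Q' [-> hP' hQ']]].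
exists (P * Q' + P' * Q), (Q * Q'); rewrite addf_div ?meval_gt0_neq0 //.
by rewrite !(mevalD, mevalM) tofracD !tofracM; split => //; rewrite ?addr_gt0 ?mulr_gt0.
Qed.

Lemma posfM m (f g : ratfun m) : posf f -> posf g -> posf (f * g).
Proof.
case=> P [Q [-> hP hQ]] [P' [Q' [-> hP' hQ']]].
by exists (P * P'), (Q * Q'); rewrite mulf_div !mevalM !tofracM; split => //; rewrite mulr_gt0.
Qed.

Lemma posfV m (f : ratfun m) : posf f -> posf f^-1.
Proof. by case=> P [Q [-> hP hQ]]; exists Q, P; rewrite invf_div. Qed.

Lemma posfX m (k : 'I_m) : posf (tofrac 'X_k).
Proof.
exists 'X_k, 1; rewrite tofrac1 divr1; split => //; last by rewrite meval1.
by rewrite mevalXU.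
Qed.

Lemma prod_expr_pred2 (K : comPzRingType) (I : finType) (F : I -> K) (a b : I) :
  a != b -> \prod_i F i ^+ ((i == a) || (i == b)) = F a * F b.
Proof.
move=> ab; rewrite (bigD1 a) //= eqxx expr1 (bigD1 b) 1?eq_sym //= eqxx orbT expr1.
by rewrite big1 ?mulr1 // => i /andP[/negbTE-> /negbTE->].
Qed.

Section ClusterVariable.
Variables (n : nat) (T : edges n) (lam : 'I_(n + 3) -> 'I_(n + 3) -> ratfun (2 * n + 3)).
Hypothesis triT : triangulation T.
Hypothesis lamC : forall u w, lam u w = lam w u.
Hypothesis lamT : forall k u w, T k = [set u; w] -> lam u w = tofrac 'X_k.
Hypothesis ptolemy : forall p r q s, cyc p r q -> cyc q s p ->
  lam p q * lam r s = lam p r * lam q s + lam r q * lam s p.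

Lemma flip_oriented (T1 T2 : edges n) k : triangulation T1 -> flip T1 k T2 ->
  exists p r q s, [/\ oquad T1 k p r q s, T2 k = [set r; s] &
    forall j, j != k -> T2 j = T1 j].
Proof.
move=> tT1 [p [q [r [s [qd E1 E2]]]]].
by case: (quad_oquad tT1 qd) => oq; [exists p, r, q, s | exists q, r, p, s].
Qed.

(** Knowing the matrix, the exchange relation involves only the four sides of the flipped
    quadrilateral and becomes an instance of [ptolemy]. Positivity is carried along because the
    exchange divides by the old variable. *)
Lemma seed_of_lambda T1 S : seed_of T T1 S ->
  [/\ triangulation T1, seed_mx S = qmx T1,
      forall k u w, T1 k = [set u; w] -> seed_var S k = lam u w &
      forall k, posf (seed_var S k)].
Proof.
elim=> {T1 S} [|T1 S k T2 _ [tT1 Emx Evar Epos] fl].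
  by split => //= [k u w /lamT -> //|k]; apply: posfX.
have [p [r [q [s [oq T2k T2E]]]]] := flip_oriented tT1 fl.
have tT2 := flip_triangulation tT1 oq T2k T2E.
case: (oq) => Ek prq qsp [/adjP[kpr Epr] /adjP[krq Erq] /adjP[kqs Eqs] /adjP[ksp Esp]].
have [[n1 n2 n3 n4] [[m1 m2 m3 m4 m5] m6]] := quad_labels_neq oq Epr Erq Eqs Esp.
split => //.
- by rewrite /= Emx (mutate_qmx tT1 oq T2k T2E Epr Erq Eqs Esp).
- move=> j u w Ej /=; rewrite Emx; have [jk|jk] := eqVneq j k; last first.
    by apply: Evar; rewrite -T2E.
  under eq_bigr do rewrite pos_part_qmx (arr_to_quad tT1 oq Erq Esp).
  under [X in _ + X]eq_bigr do rewrite pos_part_qmxN (arr_from_quad tT1 oq Epr Eqs).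
  rewrite !prod_expr_pred2 // (Evar _ _ _ Epr) (Evar _ _ _ Erq) (Evar _ _ _ Eqs).
  rewrite (Evar _ _ _ Esp) addrC -ptolemy // (Evar _ _ _ Ek) mulrAC mulfV ?mul1r.
    move: Ej; rewrite jk T2k => /set2_eq[[-> ->]|[-> ->]] //.
  by rewrite -(Evar _ _ _ Ek); apply: posf_neq0.
- move=> j /=; rewrite Emx; have [jk|jk] := eqVneq j k; last exact: Epos.
  under eq_bigr do rewrite pos_part_qmx (arr_to_quad tT1 oq Erq Esp).
  under [X in _ + X]eq_bigr do rewrite pos_part_qmxN (arr_from_quad tT1 oq Epr Eqs).
  rewrite !prod_expr_pred2 //.
  by apply: posfM; [apply: posfD; apply: posfM | apply: posfV].
Qed.

Lemma crossed_ends (T1 : edges n) p q k : k \in crossed T1 [set p; q] ->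
  exists a b, [/\ T1 k = [set a; b], cyc p a q & cyc q b p].
Proof.
rewrite inE => /existsP[a /existsP[b /existsP[c /existsP[d /and4P[/eqP Ek /eqP E]]]]].
move=> h1 h2; case: (set2_eq E) => [[? ?]|[? ?]]; subst c d.
  by exists b, a; rewrite Ek setUC; split => //; move: h1 h2; cyclia.
by exists a, b; split => //; move: h1 h2; cyclia.
Qed.

Lemma crossedE (T1 : edges n) p q k a b : T1 k = [set a; b] ->
  cyc p a q -> cyc q b p -> k \in crossed T1 [set p; q].
Proof. by move=> Ek h1 h2; rewrite inE Ek crossesE; move: h1 h2; cyclia. Qed.

(** Among the crossed edges, take the one cutting off the fewest vertices on the side of [p]. If its
    triangle on that side had an apex other than [p], one of the two other sides would also be
    crossed and would cut off fewer. *)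
Lemma first_crossed (T1 : edges n) p q : triangulation T1 ->
  crossed T1 [set p; q] != set0 ->
  exists k a b, [/\ T1 k = [set a; b], cyc p a q, cyc q b p, adj T1 b p & adj T1 p a].
Proof.
move=> tT1 /set0Pn[k0 k0P].
(* Quantifying over the ends makes the count a function of the label; [arcE] evaluates it for known
   ends. *)
pose arc k := #|[set x | [exists a, exists b,
  [&& T1 k == [set a; b], cyc p a q, cyc q b p & cyc b x a]]]|.
have [k kP kmin] := @arg_minnP _ k0 (mem (crossed T1 [set p; q])) arc k0P.
have [a [b [Ek paq qbp]]] := crossed_ends kP.
have bpa : cyc b p a by move: paq qbp; cyclia.
have ab := adj_label Ek.
have [c [bca bc ca]] := third_vertex tT1 (etrans (adjC _ _ _) ab) bpa.
have arcE l a' b' : T1 l = [set a'; b'] -> cyc p a' q -> cyc q b' p ->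
    arc l = #|[set x | cyc b' x a']|.
  move=> El h1 h2; congr #|pred_of_set _|; apply/setP=> x; rewrite !inE.
  apply/existsP/idP => [[a'' /existsP[b'' /and4P[/eqP E h1' h2']]]|h].
    case: (set2_eq (etrans (esym El) E)) => [[-> ->] //|[? ?]]; subst.
    by move: h1 h2 h1' h2'; cyclia.
  by exists a'; apply/existsP; exists b'; rewrite El eqxx h1 h2 h.
suff E : c = p by exists k, a, b; rewrite -E; split; rewrite // ?E.
have small l a' b' : T1 l = [set a'; b'] -> cyc p a' q -> cyc q b' p ->
    (forall x, cyc b' x a' -> cyc b x a) -> cyc b c a -> ~~ cyc b' c a' -> False.
  move=> El h1 h2 h3 h4 h5; have := kmin l (crossedE El h1 h2).
  rewrite (arcE _ _ _ Ek paq qbp) (arcE _ _ _ El h1 h2); apply/negP; rewrite -ltnNge.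
  apply: proper_card; apply/properP; split.
    by apply/subsetP=> x; rewrite !inE; apply: h3.
  by exists c; rewrite !inE.
have n1 : ~~ cyc p c a.
  apply/negP => pca; have /adjP[l El] := bc; rewrite setUC in El.
  apply: (small l c b El) => //; first by move: pca paq; cyclia.
    by move=> x; move: bca; cyclia.
  by cyclia.
have n2 : ~~ cyc b c p.
  apply/negP => bcp; have /adjP[l El] := ca; rewrite setUC in El.
  apply: (small l a c El) => //; first by move: bcp qbp; cyclia.
    by move=> x; move: bca; cyclia.
  by cyclia.
by apply: val_inj; move: n1 n2 bca bpa; cyclia.
Qed.

(** Flipping the first crossed diagonal replaces it by an edge ending at [p], which does not cross
    [[p; q]], so the number of crossings drops. *)
Lemma reach_diagonal T1 S p q : diagonal [set p; q] -> seed_of T T1 S ->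
  exists f, is_cluster_variable T [set p; q] f.
Proof.
move=> dg; have [m] := ubnP #|crossed T1 [set p; q]|; elim: m T1 S => // m IHm T1 S.
rewrite ltnS => lem sT1; have [tT1 _ _ _] := seed_of_lambda sT1.
have [c0|c0] := eqVneq (crossed T1 [set p; q]) set0.
  have [_ _ _ _ mx] := tT1; have [|k Ek] := mx _ dg.
    move=> k; apply/negP => h.
    have: k \in crossed T1 [set p; q]; last by rewrite c0 inE.
    rewrite inE; have [u [v [_ Ek]]] := label_ends tT1 k.
    by move: h; rewrite Ek !crossesE; cyclia.
  by exists (seed_var S k), T1, S, k.
have [k [a [b [Ek paq qbp bp pa]]]] := first_crossed tT1 c0.
have aqb : cyc a q b by move: paq qbp; cyclia.
have bpa : cyc b p a by move: paq qbp; cyclia.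
have ab := adj_label Ek.
have [w [awb aw wb]] := third_vertex tT1 ab aqb.
pose T2 : edges n := fun j => if j == k then [set w; p] else T1 j.
have fl : flip T1 k T2.
  exists a, b, w, p; split; first split.
  - exact: Ek.
  - by move: awb bpa; cyclia.
  - by apply/and3P; split; rewrite // -/(adj _ _ _) adjC.
  - by apply/and3P; split; rewrite // -/(adj _ _ _) adjC.
  - by rewrite /T2 eqxx.
  - by move=> j /negbTE jk; rewrite /T2 jk.
apply: (IHm T2 (mutate k S)); last exact: seed_of_mutate sT1 fl.
apply: leq_trans lem; apply: proper_card; apply/properP; split.
  apply/subsetP=> j; rewrite !inE /T2; case: eqP => // ->.
  rewrite crossesE => h; exfalso; move: h; cyclia.
exists k; first exact: crossedE Ek paq qbp.
rewrite inE /T2 eqxx crossesE; cyclia.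
Qed.

Lemma cluster_variable_lambda p q : diagonal [set p; q] ->
  cluster_variable T [set p; q] = lam p q.
Proof.
move=> dg; have [f fP] := reach_diagonal dg (seed_of_initial T).
have : is_cluster_variable T [set p; q] (cluster_variable T [set p; q]).
  exact: (ClassicalEpsilon.epsilon_spec (inhabits 0) _ (ex_intro _ f fP)).
case=> T1 [S [k [sT1 Ek ->]]].
by have [_ _ h _] := seed_of_lambda sT1; apply: h.
Qed.

End ClusterVariable.

(** * Facets of polyhedra *)

Section Polyhedra.
Variables (R : realFieldType) (m : nat).
Implicit Types (S P F : 'rV[R]_m -> Prop) (x y c : 'rV[R]_m) (U : {vspace 'rV[R]_m}).

Definition dot (c x : 'rV[R]_m) : R := \sum_j c 0 j * x 0 j.

Lemma dotD c x y : dot c (x + y) = dot c x + dot c y.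
Proof. by rewrite /dot -big_split; apply: eq_bigr => j _; rewrite mxE mulrDr. Qed.

Lemma dotZ c t x : dot c (t *: x) = t * dot c x.
Proof. by rewrite /dot mulr_sumr; apply: eq_bigr => j _; rewrite mxE mulrCA. Qed.

Lemma dotB c x y : dot c (x - y) = dot c x - dot c y.
Proof. by rewrite -scaleN1r dotD dotZ mulN1r. Qed.

Lemma dot_sum c (I : finType) (w : I -> R) (y : I -> 'rV[R]_m) :
  dot c (\sum_j w j *: y j) = \sum_j w j * dot c (y j).
Proof.
have dot0 : dot c 0 = 0 by rewrite /dot big1 // => j _; rewrite mxE mulr0.
elim/big_rec2: _ => [|j a x _ <-]; first exact: dot0.
by rewrite dotD dotZ.
Qed.

Lemma dotDl c c' x : dot (c + c') x = dot c x + dot c' x.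
Proof. by rewrite /dot -big_split; apply: eq_bigr => j _; rewrite mxE mulrDl. Qed.

Lemma dotZl t c x : dot (t *: c) x = t * dot c x.
Proof. by rewrite /dot mulr_sumr; apply: eq_bigr => j _; rewrite mxE mulrA. Qed.

Lemma dot_delta j x : dot (delta_mx 0 j) x = x 0 j.
Proof.
rewrite /dot (bigD1 j) //= mxE !eqxx mul1r big1 ?addr0 // => l lj.
by rewrite mxE eqxx (negbTE lj) mul0r.
Qed.

Lemma affine_hull_sub S x : S x -> affine_hull S x.
Proof.
by move=> Sx; exists 1%N, (fun=> 1), (fun=> x); rewrite !big_ord1 scale1r.
Qed.

Lemma affine_hull_mono S S' : (forall x, S x -> S' x) ->
  forall x, affine_hull S x -> affine_hull S' x.
Proof. by move=> h x [k [w [y [h1 h2 h3]]]]; exists k, w, y; split => // j; apply: h. Qed.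

Lemma affine_hull_line S x y t : S x -> S y -> affine_hull S (x + t *: (y - x)).
Proof.
move=> Sx Sy; exists 2%N, (fun j : 'I_2 => if j == 0 then 1 - t else t),
  (fun j : 'I_2 => if j == 0 then x else y).
rewrite !big_ord_recl !big_ord0 /= !addr0 subrK; split => //.
  by move=> j; case: ifP.
rewrite scalerBl scale1r scalerBr.
by rewrite -addrA [- _ + _]addrC.
Qed.

Lemma affine_hull_subspace S x0 U : (forall x, S x -> x - x0 \in U) ->
  forall x, affine_hull S x -> x - x0 \in U.
Proof.
move=> h x [k [w [y [h1 h2 ->]]]].
have -> : \sum_j w j *: y j - x0 = \sum_j w j *: (y j - x0).
  have -> : \sum_j w j *: (y j - x0) = \sum_j (w j *: y j - w j *: x0).
    by apply: eq_bigr => j _; rewrite scalerBr.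
  by rewrite sumrB -scaler_suml h2 scale1r.
by apply: memv_suml => j _; apply: memvZ; apply: h.
Qed.

Lemma affine_hull_dot S c (b : R) : (forall x, S x -> dot c x = b) ->
  forall x, affine_hull S x -> dot c x = b.
Proof.
move=> h x [k [w [y [h1 h2 ->]]]]; rewrite dot_sum.
under eq_bigr do rewrite h //.
by rewrite -mulr_suml h2 mul1r.
Qed.

Lemma affine_hull_ext S S' : (forall x, S x <-> S' x) ->
  forall x, affine_hull S x <-> affine_hull S' x.
Proof. by move=> h x; split; apply: affine_hull_mono => y /h. Qed.

Lemma facet_ext P F F' : (forall x, F x <-> F' x) -> facet P F -> facet P F'.
Proof.
move=> h [[c [b [h1 h2]]] [k [[x0 [U [dU hU]]] hP]]]; split.
  by exists c, b; split => // x; rewrite -h h2.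
exists k; split => //; exists x0, U; split => // x.
by rewrite -(hU x); split; apply: affine_hull_mono => y /h.
Qed.

(** Rank-nullity for the functional [c] on [U], whose image is a nonzero subspace of a line. *)
Lemma dim_hyperplane c U u : u \in U -> dot c u != 0 ->
  exists V : {vspace 'rV[R]_m}, \dim U = (\dim V).+1 /\
    forall x, (x \in V) = (x \in U) && (dot c x == 0).
Proof.
move=> uU cu.
pose f := linfun (mulmxr c^T : 'rV[R]_m -> 'rV[R]_1).
have fE x : f x = (dot c x)%:M.
  rewrite lfunE /=; apply/rowP=> j; rewrite !mxE !ord1 eqxx /dot.
  by apply: eq_bigr => l _; rewrite mxE mulrC.
have f0 x : (f x == 0) = (dot c x == 0).
  rewrite fE; apply/eqP/eqP => [/matrixP/(_ 0 0)|->]; last by rewrite raddf0.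
  by rewrite !mxE eqxx.
exists (U :&: lker f)%VS; split; last by move=> x; rewrite memv_cap memv_ker f0.
suff d1 : \dim (f @: U) = 1%N by rewrite -(limg_ker_dim f U) d1 addn1.
apply/eqP; rewrite eqn_leq; apply/andP; split.
  by apply: leq_trans (dimvS (subvf _)) _; rewrite dimvf /dim /= mul1n.
have : f u \in (f @: U)%VS by apply: memv_img.
by rewrite lt0n dimv_eq0; apply: contraTneq => ->; rewrite memv0 f0.
Qed.

Lemma has_dim_uniq S k x0 U : (forall x, affine_hull S x <-> x - x0 \in U) ->
  has_dim S k -> \dim U = k.
Proof.
move=> hU [x1 [V [<- hV]]].
have E x : (x - x0 \in U) = (x - x1 \in V).
  by apply/idP/idP => [/hU/hV|/hV/hU].
have x01 : x0 - x1 \in V by rewrite -E subrr mem0v.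
congr (\dim _); apply/vspaceP=> u; have := E (u + x0); rewrite addrK => ->.
by rewrite -addrA rpredDr.
Qed.

Variables (P : 'rV[R]_m -> Prop) (x0 : 'rV[R]_m) (U : {vspace 'rV[R]_m}).
Variables (K : finType) (Q : pred K) (c : K -> 'rV[R]_m) (b : K -> R).
Let L k x := dot (c k) x + b k.
Hypothesis PE : forall x, P x <-> x - x0 \in U /\ forall k, Q k -> 0 <= L k x.
Hypothesis interior : exists y, y - x0 \in U /\ forall k, Q k -> 0 < L k y.
Hypothesis facet_interior : forall k, Q k -> exists y,
  [/\ y - x0 \in U, L k y = 0 & forall l, Q l -> l != k -> 0 < L l y].

Lemma L_line k x y t : L k (y + t *: (x - y)) = L k y + t * (L k x - L k y).
Proof. by rewrite /L dotD dotZ dotB; ring. Qed.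

Lemma mem_line x y t : x - x0 \in U -> y - x0 \in U -> y + t *: (x - y) - x0 \in U.
Proof.
move=> hx hy; have -> : y + t *: (x - y) - x0 = (y - x0) + t *: ((x - x0) - (y - x0)).
  by rewrite addrAC; congr (_ + _ *: _); rewrite opprB addrA subrK.
by rewrite memvD // memvZ // memvB.
Qed.

(** From a point where the constraints are strict, a short step towards any [x] keeps them. So a
    point [x] of the right affine space lies on a line through two feasible points, hence in the
    affine hull. *)
Lemma small_step (A : pred K) x y : (forall k, A k -> 0 < L k y) ->
  exists2 t, 0 < t & forall k, A k -> 0 <= L k (y + t *: (x - y)).
Proof.
(* [B] dominates, for every constraint, the ratio of its change to its value at [y], so one step
   length serves them all. *)
move=> h; pose B := \sum_(k | A k) `|L k x - L k y| / L k y.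
have B0 : 0 <= B by apply: sumr_ge0 => k Ak; rewrite divr_ge0 // ltW // h.
exists (1 + B)^-1; first by rewrite invr_gt0 ltr_wpDr.
move=> k Ak; have Lk := h k Ak; have B1 : 0 < 1 + B by rewrite ltr_wpDr.
have le : `|L k x - L k y| <= L k y * B.
  rewrite -ler_pdivrMl // mulrC /B (bigD1 k) //= lerDl.
  by apply: sumr_ge0 => l /andP[Al _]; rewrite divr_ge0 // ltW // h.
rewrite L_line -(pmulr_rge0 _ B1) mulrDr mulrA mulfV ?gt_eqF // mul1r.
by move: (ler_norm (- (L k x - L k y))); rewrite normrN; nra.
Qed.

Lemma affine_hull_polyhedron x : affine_hull P x <-> x - x0 \in U.
Proof.
split; first by apply: affine_hull_subspace => y /PE[].
move=> hx; have [y [hy hpos]] := interior.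
have [t t0 ht] := small_step x hpos.
have Py : P y by apply/PE; split => // k /hpos/ltW.
have Pyt : P (y + t *: (x - y)) by apply/PE; split => //; apply: mem_line.
have := affine_hull_line t^-1 Py Pyt.
by rewrite addrAC subrr add0r scalerA mulVf ?gt_eqF // scale1r addrC subrK.
Qed.

Let Fk k x := P x /\ L k x = 0.

Lemma affine_hull_hyperplane k x : Q k -> affine_hull (Fk k) x <-> x - x0 \in U /\ L k x = 0.
Proof.
move=> Qk; split.
  move=> h; split; first by apply: affine_hull_subspace h => y [/PE[]].
  suff -> : L k x = (- b k) + b k by rewrite addNr.
  congr (_ + _); apply: affine_hull_dot h => y [_ /eqP].
  by rewrite /L addr_eq0 => /eqP.
case=> hx Lx; have [y [hy Ly hpos]] := facet_interior Qk.
have hpos' l : Q l && (l != k) -> 0 < L l y by case/andP; apply: hpos.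
have [t t0 ht] := small_step x hpos'.
have Py : P y.
  apply/PE; split => // l Ql; have [->|lk] := eqVneq l k; first by rewrite Ly.
  by apply/ltW/hpos.
have Lyt : L k (y + t *: (x - y)) = 0 by rewrite L_line Lx Ly subrr mulr0 addr0.
have Pyt : P (y + t *: (x - y)).
  apply/PE; split; first exact: mem_line.
  move=> l Ql; have [->|lk] := eqVneq l k; first by rewrite Lyt.
  by apply: ht; rewrite Ql.
have := @affine_hull_line (Fk k) y _ t^-1 (conj Py Ly) (conj Pyt Lyt).
by rewrite addrAC subrr add0r scalerA mulVf ?gt_eqF // scale1r addrC subrK.
Qed.

Lemma hyperplane_dim k : Q k -> exists x1 (V : {vspace 'rV[R]_m}),
  \dim U = (\dim V).+1 /\ forall x, affine_hull (Fk k) x <-> x - x1 \in V.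
Proof.
move=> Qk; have [y [hy Ly _]] := facet_interior Qk; have [z [hz Lz]] := interior.
have hzy : z - y \in U by rewrite -[z](subrK x0) -addrA memvD // -opprB memvN.
have cz : dot (c k) (z - y) != 0.
  by rewrite dotB gt_eqF // subr_gt0; move: Ly (Lz k Qk); rewrite /L; lra.
have [V [dV hV]] := dim_hyperplane hzy cz.
exists y, V; split => // x; rewrite affine_hull_hyperplane // hV dotB.
have -> : (x - y \in U) = (x - x0 \in U).
  by rewrite -[x - y](subrKA x0) rpredDr // -opprB memvN.
have -> : (dot (c k) x - dot (c k) y == 0) = (L k x == 0).
  by rewrite subr_eq0 /L; move: Ly; rewrite /L => /eqP; rewrite addr_eq0 => /eqP ->; rewrite addr_eq0.
by split => [[-> ->]|/andP[-> /eqP ->]]; rewrite ?eqxx.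
Qed.

Lemma polyhedron_facet k : Q k -> facet P (fun x => P x /\ L k x = 0).
Proof.
move=> Qk; split.
  exists (- c k), (b k).
  have E x : \sum_j (- c k) 0 j * x 0 j = - dot (c k) x.
    by rewrite /dot -sumrN; apply: eq_bigr => j _; rewrite mxE mulNr.
  split=> x; rewrite E.
    by case/PE=> _ /(_ k Qk); rewrite /L; lra.
  by rewrite /L; split=> -[Px h]; split => //; move: h; lra.
have [x1 [V [dV hV]]] := hyperplane_dim Qk.
exists (\dim V); split; first by exists x1, V.
by exists x0, U; split => //; apply: affine_hull_polyhedron.
Qed.

(* The barycenter of points of the face F with L k > 0, one for each k, would be an
   interior point of P, so F would be all of P. *)
Lemma facet_polyhedron F : facet P F ->
  exists k, Q k /\ forall x, F x <-> P x /\ L k x = 0.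
Proof.
case=> -[c0 [b0 [Ple FE]]] [d [dimF dimP]].
have dU : \dim U = d.+1 by apply: has_dim_uniq dimP; apply: affine_hull_polyhedron.
have [xF [UF [dUF hUF]]] := dimF.
have [k Qk Fsub] : exists2 k, Q k & forall x, F x -> L k x = 0.
  apply: Classical_Prop.NNPP => none.
  have F0 : exists x, F x.
    have [|k [w [y [h1 h2 _]]]] := (hUF xF).2; first by rewrite subrr mem0v.
    case: k w y h1 h2 => [|k] w y h1 h2; last by exists (y 0).
    by move/eqP: h2; rewrite big_ord0 eq_sym oner_eq0.
  have ex k : Q k -> exists2 x, F x & 0 < L k x.
    move=> Qk; apply: Classical_Prop.NNPP => h; apply: none; exists k => // x Fx.
    have [Px _] := (FE x).1 Fx; have [_ /(_ k Qk)] := (PE x).1 Px.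
    by rewrite le_eqVlt => /orP[/eqP->//|Lx]; case: h; exists x.
  have [z Fz hz] : exists2 z, F z & forall k, k \in enum K -> Q k -> 0 < L k z.
    elim: (enum K) => [|k s [z Fz hz]]; first by case: F0 => z Fz; exists z.
    have [Qk|nQk] := boolP (Q k); last first.
      by exists z => // l; rewrite inE => /orP[/eqP->|/hz //]; rewrite (negbTE nQk).
    have [x Fx Lx] := ex k Qk.
    have [Px cx] := (FE x).1 Fx; have [Pz cz] := (FE z).1 Fz.
    have [Ux Lx0] := (PE x).1 Px; have [Uz Lz0] := (PE z).1 Pz.
    exists (z + 2^-1 *: (x - z)).
      apply/FE; split; last by rewrite -/(dot _ _) dotD dotZ dotB /dot cx cz subrr mulr0 addr0.
      apply/PE; split; first exact: mem_line.
      by move=> l Ql; rewrite L_line; move: (Lx0 l Ql) (Lz0 l Ql); lra.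
    move=> l; rewrite inE L_line => /orP[/eqP-> _|ls Ql].
      by move: (Lz0 k Qk); lra.
    by move: (hz l ls Ql) (Lx0 l Ql); lra.
  have [Pz cz] := (FE z).1 Fz.
  have FP x : P x -> F x.
    move=> Px; apply/FE; split => //; apply: le_anti; rewrite Ple //=.
    have [Ux _] := (PE x).1 Px; have [Uz _] := (PE z).1 Pz.
    have hz' k : Q k -> 0 < L k z by apply: hz; rewrite mem_enum.
    (* Stepping from [z] towards the reflection of [x] in [z] stays in [P]; the bound [Ple] there is
       the reverse inequality at [x]. *)
    have [t t0 ht] := small_step (z + (-1) *: (x - z)) hz'.
    have Pt : P (z + t *: (z + -1 *: (x - z) - z)).
      by apply/PE; split => //; apply/mem_line => //; apply: mem_line.
    have := Ple _ Pt; rewrite -!/(dot _ _) in cz *.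
    rewrite !(dotB, dotD, dotZ) cz => h.
    have : 0 <= t * (dot c0 x - b0) by move: h; lra.
    by rewrite pmulr_rge0 // subr_ge0.
  (* [F] would coincide with [P], whose hull has one dimension more. *)
  have := has_dim_uniq (x0 := x0) (U := U) _ dimF; rewrite dU => h.
  have : d.+1 = d.
    apply: h => x; rewrite -affine_hull_polyhedron; apply: affine_hull_ext => y.
    by split=> [/FE[]|/FP].
  by move/eqP; rewrite eqn_leq ltnn.
have [x1 [V [dV hV]]] := hyperplane_dim Qk.
exists k; split => // x; split=> [Fx|[Px Lx]]; first by split; [case/FE: Fx | apply: Fsub].
apply/FE; split => //.
apply: (@affine_hull_dot F c0 b0) => [y /FE[]//|].
have sub y : affine_hull F y -> affine_hull (Fk k) y.
  by apply: affine_hull_mono => z Fz; split; [case/FE: Fz | apply: Fsub].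
have hxF : affine_hull F xF by apply/hUF; rewrite subrr mem0v.
have hxF1 : xF - x1 \in V by apply/hV/sub.
(* [F] lies in the face cut out by [k] and both hulls have codimension one, so they agree; [c0] is
   then constant on that whole face. *)
have UV : UF = V.
  apply/eqP; rewrite eqEdim; apply/andP; split.
    apply/subvP=> u uU; have : u + xF - x1 \in V.
      by apply/hV/sub/hUF; rewrite addrK.
    by rewrite -addrA rpredDr.
  by rewrite dUF; move: dV; rewrite dU => -[->].
apply/hUF; rewrite UV.
have hx : x - x1 \in V by apply/hV/affine_hull_sub.
by rewrite -[x - xF](subrKA x1) rpredD // -opprB rpredN.
Qed.

End Polyhedra.

(** * Order polytopes of fences *)

Lemma convex_hull_conv (R : realFieldType) m (S : 'rV[R]_m -> Prop) x y t :
  0 <= t <= 1 -> convex_hull S x -> convex_hull S y ->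
  convex_hull S ((1 - t) *: x + t *: y).
Proof.
case/andP=> t0 t1 [k1 [w1 [y1 [S1 w10 w11 ->]]]] [k2 [w2 [y2 [S2 w20 w21 ->]]]].
exists (k1 + k2)%N,
  (fun j => match split j with inl a => (1 - t) * w1 a | inr a => t * w2 a end),
  (fun j => match split j with inl a => y1 a | inr a => y2 a end).
have El a : split (lshift k2 a) = inl a := unsplitK (inl a).
have Er a : split (rshift k1 a) = inr a := unsplitK (inr a).
split.
- by move=> j; case: (split j).
- by move=> j; case: (split j) => a; rewrite mulr_ge0 ?subr_ge0.
- rewrite big_split_ord /=; under eq_bigr do rewrite El.
  under [X in _ + X]eq_bigr do rewrite Er.
  by rewrite -!mulr_sumr w11 w21 !mulr1 subrK.
- rewrite big_split_ord /=; under [X in _ = X + _]eq_bigr do rewrite El -scalerA.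
  under [X in _ = _ + X]eq_bigr do rewrite Er -scalerA.
  by rewrite -!scaler_sumr.
Qed.

Lemma convex_hull_sub (R : realFieldType) m (S : 'rV[R]_m -> Prop) x :
  S x -> convex_hull S x.
Proof.
by move=> Sx; exists 1%N, (fun=> 1), (fun=> x); rewrite !big_ord1 scale1r.
Qed.

(* Shifting all the fractional coordinates down, or up, until one of them becomes
   integral exhibits z as a convex combination of two points with fewer fractional
   coordinates. *)
Lemma order_polytope (R : realFieldType) d (r : rel 'I_d) (z : 'rV[R]_d) :
  (forall j, 0 <= z 0 j <= 1) -> (forall i j, r i j -> z 0 i <= z 0 j) ->
  convex_hull (fun y => (forall j, (y 0 j == 0) || (y 0 j == 1)) /\
                        (forall i j, r i j -> y 0 i <= y 0 j)) z.
Proof.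
pose fr (z : 'rV[R]_d) := [set j | 0 < z 0 j < 1].
have [m] := ubnP #|fr z|; elim: m z => // m IHm z; rewrite ltnS => lem z01 zr.
have [fr0|/set0Pn[j0 j0P]] := eqVneq (fr z) set0.
  apply: convex_hull_sub; split => // j; have := in_set0 j; rewrite -fr0 inE.
  by move: (z01 j); case: (ltgtP (z 0 j) 0) => //=; case: (ltgtP (z 0 j) 1).
have [jm jmP hm] := @Order.TotalTheory.arg_minP _ _ _ j0 (mem (fr z)) (fun j => z 0 j) j0P.
have [jM jMP hM] := @Order.TotalTheory.arg_maxP _ _ _ j0 (mem (fr z)) (fun j => z 0 j) j0P.
have {}jmP : jm \in fr z := jmP; have {}jMP : jM \in fr z := jMP.
set a := z 0 jm in hm; set b := 1 - z 0 jM.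
have a0 : 0 < a by move: jmP; rewrite inE => /andP[].
have b0 : 0 < b by move: jMP; rewrite inE subr_gt0 => /andP[].
pose sh (e : R) : 'rV[R]_d := \row_j (z 0 j + (j \in fr z)%:R * e).
have shE e j : sh e 0 j = z 0 j + (j \in fr z)%:R * e by rewrite mxE.
have frE j : j \notin fr z -> z 0 j = 0 \/ z 0 j = 1.
  rewrite inE; move: (z01 j).
  by case: (ltgtP (z 0 j) 0) => //=; case: (ltgtP (z 0 j) 1) => //=; tauto.
have sh_conv e : - a <= e <= b -> (exists2 j, j \in fr z & z 0 j + e = 0 \/ z 0 j + e = 1) ->
    convex_hull (fun y => (forall j, (y 0 j == 0) || (y 0 j == 1)) /\
                        (forall i j, r i j -> y 0 i <= y 0 j)) (sh e).
  case/andP=> ea eb [j1 j1P j1E].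
  have bnd j : j \in fr z -> a <= z 0 j <= 1 - b.
    by move=> jP; rewrite (hm j jP) /= /b opprB addrC subrK; apply: hM.
  apply: IHm.
  - apply: leq_trans lem; apply: proper_card; apply/properP; split.
      apply/subsetP=> j; rewrite inE shE; case: (boolP (j \in fr z)) => // jn.
      by case: (frE j jn) => ->; rewrite mul0r addr0 ltxx ?andbF.
    by exists j1 => //; rewrite inE shE j1P mul1r; case: j1E => ->; rewrite ltxx ?andbF.
  - move=> j; rewrite shE; case: (boolP (j \in fr z)) => [/bnd|jn].
      by rewrite mul1r; lra.
    by rewrite mul0r addr0.
  - move=> i j rij; rewrite !shE; move: (zr i j rij) (z01 i) (z01 j).
    case: (boolP (i \in fr z)) => [/bnd|/frE]; case: (boolP (j \in fr z)) => [/bnd|/frE];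
      rewrite ?mul1r ?mul0r; try lra.
have abp : 0 < a + b by rewrite addr_gt0.
(* The weight for which the shifts by [- a] and [b] average to zero. *)
pose t := a / (a + b).
have t01 : 0 <= t <= 1.
  by rewrite divr_ge0 ?(ltW a0) ?(ltW abp) //= ler_pdivrMr // mul1r lerDl ltW.
have -> : z = (1 - t) *: sh (- a) + t *: sh b.
  apply/rowP=> j; rewrite mxE [in RHS]mxE [in X in _ = _ + X]mxE !shE /t; field.
  by rewrite gt_eqF.
apply: convex_hull_conv => //; apply: sh_conv.
- by rewrite lexx /= -subr_ge0 opprK ltW // addrC.
- by exists jm => //; left; rewrite subrr.
- by rewrite lexx andbT; lra.
- by exists jM => //; right; rewrite addrC subrK.
Qed.

(** Oriented so that every covering relation reads [0 <= fence_step s z l], whichever way it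
    points. *)
Definition fence_step (R : realFieldType) (s : nat -> bool) (z : nat -> R) l : R :=
  if s l then z l - z l.+1 else z l.+1 - z l.

(** The fence has the elements 0, ..., D; the tests at [0] and [D] excuse the missing neighbour of
    an end, so for D = 0 the single element is both a minimum and a maximum. *)
Definition fence_min (D : nat) (s : nat -> bool) j : bool :=
  ((j == 0%N) || s j.-1) && ((j == D) || ~~ s j).

Definition fence_max (D : nat) (s : nat -> bool) j : bool :=
  ((j == 0%N) || ~~ s j.-1) && ((j == D) || s j).

(** Descending along covering relations follows one slope of the zigzag down to a local minimum:
    [left_] descends to smaller indices, [right_] to larger ones. *)
Lemma fence_minP (R : realFieldType) D s (z : nat -> R) j :
  (forall l, (l < D)%N -> 0 <= fence_step s z l) -> (j <= D)%N ->
  exists j', [/\ (j' <= D)%N, fence_min D s j' & z j' <= z j].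
Proof.
move=> hs.
have left_ : forall j, (j <= D)%N -> (j == D) || ~~ s j ->
    exists j', [/\ (j' <= D)%N, fence_min D s j' & z j' <= z j].
  elim=> [|i IHi] iD sj; first by exists 0%N; rewrite /fence_min sj.
  have [si|nsi] := boolP (s i).
    by exists i.+1; rewrite /fence_min /= si sj.
  have [|j' [h1 h2 h3]] := IHi (ltnW iD); first by rewrite nsi orbT.
  exists j'; split => //; apply: le_trans h3 _.
  by move: (hs i iD); rewrite /fence_step (negbTE nsi) subr_ge0.
have right_ : forall k j, (j + k = D)%N -> (j == 0%N) || s j.-1 ->
    exists j', [/\ (j' <= D)%N, fence_min D s j' & z j' <= z j].
  elim=> [|k IHk] i iD si.
    exists i; rewrite /fence_min si; move: iD; rewrite addn0 => ->; by rewrite eqxx.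
  have iD' : (i < D)%N by rewrite -iD -addSnnS leq_addr.
  have [si'|nsi] := boolP (s i); last first.
    by exists i; rewrite /fence_min si nsi orbT ltnW.
  have [||j' [h1 h2 h3]] := IHk i.+1; rewrite ?addSnnS //.
  exists j'; split => //; apply: le_trans h3 _.
  by move: (hs i iD'); rewrite /fence_step si' subr_ge0.
move=> jD; have [h|] := boolP ((j == 0%N) || s j.-1).
  by apply: (right_ (D - j)%N) => //; rewrite subnKC.
case: j jD => [|j] //= jD nsj.
have [|j' [h1 h2 h3]] := left_ j (ltnW jD); first by rewrite nsj orbT.
exists j'; split => //; apply: le_trans h3 _.
by move: (hs j jD); rewrite /fence_step (negbTE nsj) subr_ge0.
Qed.

Lemma fence_maxP (R : realFieldType) D s (z : nat -> R) j :
  (forall l, (l < D)%N -> 0 <= fence_step s z l) -> (j <= D)%N ->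
  exists j', [/\ (j' <= D)%N, fence_max D s j' & z j <= z j'].
Proof.
move=> hs jD.
have [|j' [h1 h2 h3]] := @fence_minP R D (negb \o s) (fun l => - z l) j _ jD.
  move=> l /hs; rewrite /fence_step /=; case: (s l) => /=; lra.
exists j'; split => //; last by rewrite -lerN2.
by move: h2; rewrite /fence_min /fence_max /= negbK.
Qed.

(* Strictly monotone along the fence, except at the steps where eps vanishes. *)
Definition fence_height (R : realFieldType) D (s eps : nat -> bool) l : R :=
  (\sum_(i < l) (if s i then - (eps i)%:R else (eps i)%:R) + D.+1%:R) / (2 * D.+1%:R).

Lemma fence_step_height (R : realFieldType) D s eps l :
  fence_step s (fence_height R D s eps) l = (eps l)%:R / (2 * D.+1%:R).
Proof.
rewrite /fence_step /fence_height big_ord_recr /=.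
by case: (s l); rewrite -mulrBl; congr (_ / _); ring.
Qed.

(** The partial sums lie between -D and D; adding D + 1 and dividing by 2 (D + 1) brings them
    strictly inside the unit interval. *)
Lemma fence_height_bound (R : realFieldType) D s eps l : (l <= D)%N ->
  0 < fence_height R D s eps l < 1.
Proof.
move=> lD; have D0 : 0 < D.+1%:R :> R by rewrite ltr0n.
have : `|\sum_(i < l) (if s i then - (eps i)%:R else (eps i)%:R : R)| <= l%:R.
  apply: le_trans (ler_norm_sum _ _ _) _.
  rewrite -[X in _ <= X%:R]card_ord -sumr_const; apply: ler_sum => i _.
  by case: (s i); case: (eps i); rewrite ?normrN ?normr1 ?normr0.
have : l%:R <= D%:R :> R by rewrite ler_nat.
rewrite /fence_height ltr_pdivlMr ?mulr_gt0 // ltr_pdivrMr ?mulr_gt0 // mul0r mul1r.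
rewrite ler_norml -natr1; lra.
Qed.

Section FencePolytope.
Variables (R : realFieldType) (m D : nat) (s : nat -> bool).
Variables (tau cc : nat -> 'I_m) (kpa kpb kqa kqb : 'I_m).
Hypothesis tau_inj : forall j l, (j <= D)%N -> (l <= D)%N -> tau j = tau l -> j = l.
Hypothesis cc_inj : forall j l, (j < D)%N -> (l < D)%N -> cc j = cc l -> j = l.
Hypothesis tau_cc : forall j l, (j <= D)%N -> (l < D)%N -> tau j != cc l.
Hypothesis k_tau : forall k j, k \in [:: kpa; kpb; kqa; kqb] -> (j <= D)%N -> k != tau j.
Hypothesis k_cc : forall k l, k \in [:: kpa; kpb; kqa; kqb] -> (l < D)%N -> k != cc l.
Hypothesis k_uniq : uniq [:: kpa; kpb; kqa; kqb].

(** For 0/1 sequences respecting the fence, [z j] tells from which end of the j-th crossed diagonal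
    a term comes. The step from [l] to [l.+1] then multiplies it by [tau l.+1] to the power
    [fence_up] and divides it by [tau l] to the power [fence_dn]. *)
Definition fence_up (z : nat -> R) l : R := if s l then 1 - z l else z l.
Definition fence_dn (z : nat -> R) l : R := if s l then 1 - z l.+1 else z l.+1.

Definition fence_vec (z : nat -> R) l : 'rV[R]_m :=
  fence_step s z l *: delta_mx 0 (cc l) + fence_up z l *: delta_mx 0 (tau l.+1)
  - fence_dn z l *: delta_mx 0 (tau l).

(** Exponent of a term in the expansion of the length from [p] to the end of the j-th crossed
    diagonal selected by [z j]. *)
Definition partial_vec (z : nat -> R) j : 'rV[R]_m :=
  (1 - z 0%N) *: delta_mx 0 kpa + z 0%N *: delta_mx 0 kpb + \sum_(l < j) fence_vec z l.

(* The exponent vector of the term of the Laurent expansion selected by a 0/1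
   sequence z, extended affinely to all z. *)
Definition strip_vec (z : nat -> R) : 'rV[R]_m :=
  partial_vec z D + (1 - z D) *: delta_mx 0 kqb + z D *: delta_mx 0 kqa
  - delta_mx 0 (tau D).

Lemma strip_vecE z k : strip_vec z 0 k =
  (1 - z 0%N) * (k == kpa)%:R + z 0%N * (k == kpb)%:R
  + \sum_(l < D) (fence_step s z l * (k == cc l)%:R + fence_up z l * (k == tau l.+1)%:R
                  - fence_dn z l * (k == tau l)%:R)
  + (1 - z D) * (k == kqb)%:R + z D * (k == kqa)%:R - (k == tau D)%:R.
Proof.
rewrite /strip_vec /partial_vec !(mxE, summxE, eqxx, andTb) /=.
do 3!congr (_ + _); congr (_ + _); apply: eq_bigr => l _.
by rewrite /fence_vec !(mxE, eqxx, andTb).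
Qed.

Lemma strip_vec_end z k : k \in [:: kpa; kpb; kqa; kqb] -> strip_vec z 0 k =
  (1 - z 0%N) * (k == kpa)%:R + z 0%N * (k == kpb)%:R
  + (1 - z D) * (k == kqb)%:R + z D * (k == kqa)%:R.
Proof.
move=> kP; rewrite strip_vecE (negbTE (k_tau kP (leqnn D))) subr0 big1 ?addr0 // => l _.
rewrite (negbTE (k_cc kP (ltn_ord l))) (negbTE (k_tau kP (ltnW (ltn_ord l)))).
by rewrite (negbTE (k_tau kP (ltn_ord l))); rewrite /=; ring.
Qed.

Lemma strip_vec_kpa z : strip_vec z 0 kpa = 1 - z 0%N.
Proof.
move: k_uniq; rewrite /= !inE !negb_or => /and4P[/and3P[n1 n2 n3] _ _ _].
rewrite strip_vec_end ?inE ?eqxx // (negbTE n1) (negbTE n2) (negbTE n3); rewrite /=; ring.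
Qed.

Lemma strip_vec_kpb z : strip_vec z 0 kpb = z 0%N.
Proof.
move: k_uniq; rewrite /= !inE !negb_or => /and4P[/and3P[n1 n2 n3] /andP[n4 n5] _ _].
rewrite strip_vec_end ?inE ?eqxx ?orbT // eq_sym (negbTE n1) (negbTE n4) (negbTE n5); rewrite /=; ring.
Qed.

Lemma strip_vec_kqa z : strip_vec z 0 kqa = z D.
Proof.
move: k_uniq; rewrite /= !inE !negb_or => /and4P[/and3P[n1 n2 n3] /andP[n4 n5] n6 _].
rewrite strip_vec_end ?inE ?eqxx ?orbT // ![kqa == kpa]eq_sym [kqa == kpb]eq_sym.
rewrite (negbTE n2) (negbTE n4) (negbTE n6); rewrite /=; ring.
Qed.

Lemma strip_vec_kqb z : strip_vec z 0 kqb = 1 - z D.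
Proof.
move: k_uniq; rewrite /= !inE !negb_or => /and4P[/and3P[n1 n2 n3] /andP[n4 n5] n6 _].
rewrite strip_vec_end ?inE ?eqxx ?orbT // ![kqb == _]eq_sym.
rewrite (negbTE n3) (negbTE n5) (negbTE n6); rewrite /=; ring.
Qed.

Lemma strip_vec_cc z j : (j < D)%N -> strip_vec z 0 (cc j) = fence_step s z j.
Proof.
move=> jD; rewrite strip_vecE.
have kc k : k \in [:: kpa; kpb; kqa; kqb] -> (cc j == k) = false.
  by move=> kP; rewrite eq_sym (negbTE (k_cc kP jD)).
have tc l : (l <= D)%N -> (cc j == tau l) = false.
  by move=> lD; rewrite eq_sym (negbTE (tau_cc lD jD)).
rewrite (kc kpa) ?(kc kpb) ?(kc kqa) ?(kc kqb) ?inE ?eqxx ?orbT // (tc D) //.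
rewrite (bigD1 (Ordinal jD)) //= eqxx big1 => [|l].
  by rewrite !tc ?(ltnW jD) //; rewrite /=; ring.
rewrite -val_eqE /= => lj; rewrite !tc ?(ltnW (ltn_ord l)) //.
case: eqP => [/cc_inj h|_]; last by rewrite /=; ring.
by move: lj; rewrite -h // eqxx.
Qed.

Lemma strip_vec_tau z j : (j <= D)%N -> strip_vec z 0 (tau j) =
  (if (0 < j)%N then fence_up z j.-1 else 0)
  - (if (j < D)%N then fence_dn z j else 1).
Proof.
move=> jD; rewrite strip_vecE.
have kt k : k \in [:: kpa; kpb; kqa; kqb] -> (tau j == k) = false.
  by move=> kP; rewrite eq_sym (negbTE (k_tau kP jD)).
have tt l : (l <= D)%N -> (tau j == tau l) = (j == l).
  by move=> lD; apply/eqP/eqP => [/tau_inj ->|->].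
rewrite (kt kpa) ?(kt kpb) ?(kt kqa) ?(kt kqb) ?inE ?eqxx ?orbT // (tt D) //.
rewrite (eq_bigr (fun l : 'I_D => fence_up z l * (j == l.+1)%:R - fence_dn z l * (j == l)%:R));
  last first.
  by move=> l _; rewrite !tt ?(ltnW (ltn_ord l)) // (negbTE (tau_cc jD (ltn_ord l))); rewrite /=; ring.
rewrite big_split /= sumrN.
have -> : \sum_(l < D) fence_up z l * (j == l.+1)%:R = if (0 < j)%N then fence_up z j.-1 else 0.
  case: j jD {kt tt} => [|j] jD; first by rewrite big1 // => l _; rewrite mulr0.
  rewrite (bigD1 (Ordinal jD)) //= eqxx mulr1 big1 ?addr0 // => l.
  by rewrite -val_eqE /= eqSS eq_sym => /negbTE ->; rewrite mulr0.
have -> : \sum_(l < D) fence_dn z l * (j == l)%:R = if (j < D)%N then fence_dn z j else 0.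
  case: ltnP => [jD'|Dj]; last first.
    rewrite big1 // => l _; rewrite gtn_eqF ?mulr0 //; exact: leq_trans (ltn_ord l) Dj.
  rewrite (bigD1 (Ordinal jD')) //= eqxx mulr1 big1 ?addr0 // => l.
  by rewrite -val_eqE /= eq_sym => /negbTE ->; rewrite mulr0.
have -> : (j == D) = ~~ (j < D)%N by rewrite -leqNgt eqn_leq jD.
by case: (j < D)%N; rewrite /=; ring.
Qed.

Lemma strip_vec_out z k : (forall j, (j <= D)%N -> k != tau j) ->
  (forall l, (l < D)%N -> k != cc l) -> k \notin [:: kpa; kpb; kqa; kqb] ->
  strip_vec z 0 k = 0.
Proof.
move=> ht hc; rewrite !inE !negb_or => /and4P[/negbTE n1 /negbTE n2 /negbTE n3 /negbTE n4].
rewrite strip_vecE n1 n2 n3 n4 (negbTE (ht _ (leqnn D))) big1 => [|l _]; first by rewrite /=; ring.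
rewrite (negbTE (ht _ (ltn_ord l))) (negbTE (ht _ (ltnW (ltn_ord l)))).
by rewrite (negbTE (hc _ (ltn_ord l))); rewrite /=; ring.
Qed.

(* Linear functional recovering z j from strip_vec z. *)
Fixpoint zrow (j : nat) : 'rV[R]_m :=
  if j is l.+1 then zrow l + (if s l then -1 else 1) *: delta_mx 0 (cc l)
  else delta_mx 0 kpb.

Lemma dot_zrowS l x :
  dot (zrow l.+1) x = dot (zrow l) x + (if s l then -1 else 1) * x 0 (cc l).
Proof. by rewrite /= dotDl dotZl dot_delta. Qed.

Lemma fence_step_zrow l x : fence_step s (fun j => dot (zrow j) x) l = x 0 (cc l).
Proof. by rewrite /fence_step dot_zrowS; case: (s l); rewrite /=; ring. Qed.

Lemma dot_zrow z j : (j <= D)%N -> dot (zrow j) (strip_vec z) = z j.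
Proof.
elim: j => [|j IHj] jD; first by rewrite /= dot_delta strip_vec_kpb.
rewrite dot_zrowS IHj ?(ltnW jD) // strip_vec_cc // /fence_step.
by case: (s j); rewrite /=; ring.
Qed.

Variables (A : 'rV[R]_m -> Prop) (x0 : 'rV[R]_m) (U : {vspace 'rV[R]_m}).
Hypothesis AU : forall x, A x <-> x - x0 \in U.
Hypothesis A_strip : forall z, A (strip_vec z).
Hypothesis A_inj : forall x y, A x -> A y -> x 0 kpb = y 0 kpb ->
  (forall l, (l < D)%N -> x 0 (cc l) = y 0 (cc l)) -> x = y.

Lemma strip_vec_zrow x : A x -> x = strip_vec (fun j => dot (zrow j) x).
Proof.
move=> Ax; apply: A_inj => //; first by rewrite strip_vec_kpb /= dot_delta.
by move=> l lD; rewrite strip_vec_cc // fence_step_zrow.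
Qed.

Definition fence_point (x : 'rV[R]_m) : Prop :=
  exists2 v : nat -> bool,
    forall l, (l < D)%N -> 0 <= fence_step s (fun j => (v j)%:R : R) l &
    x = strip_vec (fun j => (v j)%:R).

(* The covering relations of the fence, then the bounds 0 <= z j (true) and
   z j <= 1 (false). *)
Definition fence_ineq : finType := ('I_D + 'I_D.+1 * bool)%type.

Definition fence_irr (k : fence_ineq) : bool :=
  match k with
  | inl _ => true
  | inr (j, true) => fence_min D s j
  | inr (j, false) => fence_max D s j
  end.

Definition ineq_vec (k : fence_ineq) : 'rV[R]_m :=
  match k with
  | inl l => delta_mx 0 (cc l)
  | inr (j, true) => zrow j
  | inr (j, false) => - zrow j
  end.

Definition ineq_cst (k : fence_ineq) : R := if k is inr (_, false) then 1 else 0.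

Definition fence_slack (z : nat -> R) (k : fence_ineq) : R :=
  match k with
  | inl l => fence_step s z l
  | inr (j, true) => z j
  | inr (j, false) => 1 - z j
  end.

Lemma ineq_slack k z : dot (ineq_vec k) (strip_vec z) + ineq_cst k = fence_slack z k.
Proof.
case: k => [l|[j []]] /=; rewrite ?addr0.
- by rewrite dot_delta strip_vec_cc.
- by rewrite dot_zrow // -ltnS.
- by rewrite -scaleN1r dotZl dot_zrow ?mulN1r 1?addrC // -ltnS.
Qed.

Let N := convex_hull fence_point.

(** For the converse, the bounds at local extrema imply all bounds, so [order_polytope] writes [z]
    as a convex combination of 0/1 sequences. [A_inj] carries it back to [x]: both sides lie in [A]
    and agree on the coordinates that determine a point of [A]. *)
Lemma fence_polytopeE x :
  N x <-> x - x0 \in U /\ forall k, fence_irr k -> 0 <= dot (ineq_vec k) x + ineq_cst k.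
Proof.
split.
  case=> k [w [y [hy w0 w1 ->]]]; split.
    apply: (@affine_hull_subspace _ _ fence_point); last by exists k, w, y.
    by move=> x' [v _ ->]; apply/AU.
  move=> i _; rewrite dot_sum -[ineq_cst i]mul1r -w1 mulr_suml -big_split /=.
  apply: sumr_ge0 => j _; rewrite -mulrDr mulr_ge0 //.
  have [v hv ->] := hy j; rewrite ineq_slack.
  case: i => [l|[l []]] /=; [exact: hv | exact: ler0n | ].
  by case: (v l); rewrite ?subrr ?subr0.
case=> /AU Ax hL; pose z j := dot (zrow j) x.
have xE : x = strip_vec z by apply: strip_vec_zrow.
have hs l : (l < D)%N -> 0 <= fence_step s z l.
  by move=> lD; have := hL (inl (Ordinal lD)) isT; rewrite xE ineq_slack.
have z0 j : (j <= D)%N -> 0 <= z j.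
  move=> jD; have [j' [j'D mn le]] := fence_minP hs jD; apply: le_trans le.
  have := hL (inr (Ordinal (j'D : (j' < D.+1)%N), true)) mn.
  by rewrite xE ineq_slack.
have z1 j : (j <= D)%N -> z j <= 1.
  move=> jD; have [j' [j'D mn le]] := fence_maxP hs jD; apply: le_trans le _.
  have := hL (inr (Ordinal (j'D : (j' < D.+1)%N), false)) mn.
  by rewrite xE ineq_slack /= subr_ge0.
pose r (i j : 'I_D.+1) := ((j == i.+1 :> nat) && ~~ s i) || ((i == j.+1 :> nat) && s j).
pose zr : 'rV[R]_D.+1 := \row_j z j.
have [||k [w [y [hy w0 w1 zE]]]] := @order_polytope R D.+1 r zr.
- by move=> j; rewrite mxE z0 ?z1 // -ltnS.
- move=> i j; rewrite /r !mxE => /orP[] /andP[/eqP E sE].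
    have iD : (i < D)%N by rewrite -ltnS -E.
    by move: (hs i iD); rewrite /fence_step (negbTE sE) subr_ge0 E.
  have jD : (j < D)%N by rewrite -ltnS -E.
  by move: (hs j jD); rewrite /fence_step sE subr_ge0 E.
pose v (i : 'I_k) j : bool := y i 0 (inord j) == 1.
have vE i j : (v i j)%:R = y i 0 (inord j).
  by rewrite /v; case: (hy i) => /(_ (inord j)) /orP[]/eqP -> _; rewrite ?eqxx // eq_sym oner_eq0.
exists k, w, (fun i => strip_vec (fun j => (v i j)%:R)); split => //.
  move=> i; exists (v i) => // l lD; rewrite /fence_step !vE.
  have [_ hr] := hy i.
  have [E1 E2] : @inord D l = l :> nat /\ @inord D l.+1 = l.+1 :> nat.
    by rewrite !inordK // ltnS // ltnW.
  case: ifP => sl; rewrite subr_ge0; apply: hr; rewrite /r E1 E2 eqxx sl ?orbT //.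
apply: A_inj => //.
- apply/AU; apply: (@affine_hull_subspace _ _ A); first by move=> ? /AU.
  by exists k, w, (fun i => strip_vec (fun j => (v i j)%:R)).
- rewrite -!dot_delta dot_sum; under eq_bigr do rewrite dot_delta strip_vec_kpb vE.
  have := congr1 (fun u : 'rV[R]_D.+1 => u 0 (inord 0)) zE.
  rewrite mxE inordK // /z /= => ->; rewrite summxE.
  by apply: eq_bigr => i _; rewrite mxE.
- move=> l lD; rewrite -(dot_delta (cc l) (\sum_i _)) dot_sum -fence_step_zrow.
  under eq_bigr do rewrite dot_delta strip_vec_cc // /fence_step !vE.
  have ez j : (j <= D)%N -> dot (zrow j) x = \sum_i w i * y i 0 (inord j).
    move=> jD; have := congr1 (fun u : 'rV[R]_D.+1 => u 0 (inord j)) zE.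
    rewrite mxE inordK // /z => ->; rewrite summxE.
    by apply: eq_bigr => i _; rewrite mxE.
  rewrite /fence_step !ez ?(ltnW lD) //.
  by case: (s l); rewrite -sumrB; apply: eq_bigr => i _; rewrite mulrBr.
Qed.

Lemma fence_interior : exists y, y - x0 \in U /\
  forall k, fence_irr k -> 0 < dot (ineq_vec k) y + ineq_cst k.
Proof.
exists (strip_vec (fence_height R D s xpredT)); split; first exact/AU.
move=> k _; rewrite ineq_slack; case: k => [l|[j b]] /=.
  by rewrite fence_step_height divr_gt0 ?mulr_gt0 ?ltr0n.
have /andP[h1 h2] := @fence_height_bound R D s xpredT j (ltn_ord j).
by case: b; rewrite // subr_gt0.
Qed.

(** A covering relation becomes tight when the height stays level at that step only. A bound becomes
    tight when the value at [j] alone is moved to 0 or 1; at a local extremum this only widens the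
    adjacent steps. *)
Lemma fence_facet_interior k : fence_irr k -> exists y,
  [/\ y - x0 \in U, dot (ineq_vec k) y + ineq_cst k = 0 &
      forall l, fence_irr l -> l != k -> 0 < dot (ineq_vec l) y + ineq_cst l].
Proof.
have D0 : 0 < 2 * D.+1%:R :> R by rewrite mulr_gt0 ?ltr0n.
case: k => [l|[j b]].
  move=> _; pose eps (i : nat) := i != l.
  exists (strip_vec (fence_height R D s eps)); split; first exact/AU.
    by rewrite ineq_slack /= fence_step_height /eps eqxx mul0r.
  move=> k _ kl; rewrite ineq_slack; case: k kl => [i|[j b]] kl /=.
    have il : eps i by apply: contra kl => /eqP/val_inj ->.
    by rewrite fence_step_height il divr_gt0.
  have /andP[h1 h2] := @fence_height_bound R D s eps j (ltn_ord j).
  by case: b {kl}; rewrite // subr_gt0.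
move=> irr; pose h := fence_height R D s xpredT.
have hb i : (i <= D)%N -> 0 < h i < 1 by apply: fence_height_bound.
have hs i : (i < D)%N -> 0 < fence_step s h i.
  by move=> iD; rewrite fence_step_height divr_gt0.
(* [b] true stands for the lower bound, hence the value 0; the upper bound gives 1. *)
pose z (i : nat) := if i == j :> nat then (~~ b)%:R else h i.
exists (strip_vec z); split; first exact/AU.
  by rewrite ineq_slack /= /z eqxx; case: b {irr z} => //=; rewrite subrr.
move=> k _ kj; rewrite ineq_slack; case: k kj => [i|[i b']] kj /=.
  move: (hs i (ltn_ord i)) (hb i (ltnW (ltn_ord i))) (hb i.+1 (ltn_ord i)).
  rewrite /fence_step /z; have [ij|_] := eqVneq (i : nat) j.
    rewrite gtn_eqF ?ij //; move: irr (ltn_ord i); rewrite /= /fence_min /fence_max ij.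
    by case: b {z kj}; case: (s j) => /andP[_ /orP[/eqP->|//]]; rewrite ?ltnn //=; lra.
  have [ij|_] := eqVneq i.+1 (j : nat); last by [].
  move: irr; rewrite /= /fence_min /fence_max -ij /=.
  by case: b {z kj}; case: (s i) => /andP[] //=; lra.
have := hb i (ltn_ord i); rewrite /z.
have [/val_inj ij|_] := eqVneq (i : nat) j; last by case: b' {kj}; lra.
have : b' != b by apply: contraNneq kj => ->; rewrite ij.
by case: b {z irr kj}; case: b' => //= _ _; rewrite ?subr0.
Qed.

Lemma affine_hull_fence x : affine_hull N x <-> A x.
Proof.
by rewrite AU; apply: (affine_hull_polyhedron fence_polytopeE fence_interior).
Qed.

Lemma fence_polytope_slack z : N (strip_vec z) <->
  forall k, fence_irr k -> 0 <= fence_slack z k.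
Proof.
rewrite fence_polytopeE; split=> [[_ h] k /h|h]; first by rewrite ineq_slack.
by split=> [|k /h]; [apply/AU | rewrite ineq_slack].
Qed.

(** The positive factor [t] is allowed because the inequality with three terms has twice the slack
    of the bound it represents. *)
Lemma fence_facet lhs rhs t k : fence_irr k -> 0 < t ->
  (forall z, rhs (strip_vec z) - lhs (strip_vec z) = t * fence_slack z k) ->
  (forall x, N x -> lhs x <= rhs x) /\ facet N (fun x => N x /\ lhs x = rhs x).
Proof.
move=> irr t0 hE.
have NE x : N x -> exists z, x = strip_vec z.
  by case/fence_polytopeE=> /AU/strip_vec_zrow -> _; eexists.
split=> [x Nx|].
  have [z E] := NE x Nx; move: Nx; rewrite E => /fence_polytope_slack/(_ k irr).
  by move=> h; rewrite -subr_ge0 hE mulr_ge0 // ltW.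
have := polyhedron_facet fence_polytopeE fence_interior fence_facet_interior irr.
apply: facet_ext => x.
by split=> -[Nx h]; split => //; move: h; have [z ->] := NE x Nx; rewrite ineq_slack;
  move=> h; apply/eqP; move: (hE z); rewrite ?h;
  [rewrite mulr0 => /eqP; rewrite subr_eq0 eq_sym|
   rewrite subrr => /esym/eqP; rewrite mulf_eq0 (gt_eqF t0)].
Qed.

Lemma facet_fence F : facet N F -> exists2 k, fence_irr k &
  forall lhs rhs t, 0 < t ->
    (forall z, rhs (strip_vec z) - lhs (strip_vec z) = t * fence_slack z k) ->
    forall x, F x <-> N x /\ lhs x = rhs x.
Proof.
move=> fF; have [k [irr FE]] := facet_polyhedron fence_polytopeE fence_interior fence_facet_interior fF.
exists k => // lhs rhs t t0 hE x; rewrite FE.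
have NE y : N y -> exists z, y = strip_vec z.
  by case/fence_polytopeE=> /AU/strip_vec_zrow -> _; eexists.
by split=> -[Nx h]; split => //; move: h; have [z ->] := NE x Nx; rewrite ineq_slack;
  move=> h; apply/eqP; move: (hE z); rewrite ?h;
  [rewrite mulr0 => /eqP; rewrite subr_eq0 eq_sym|
   rewrite subrr => /esym/eqP; rewrite mulf_eq0 (gt_eqF t0)].
Qed.

End FencePolytope.

(** * Laurent expansions *)

Section Laurent.
Variables (R : realFieldType) (m : nat).
Implicit Types (f g : ratfun m) (S : 'rV[R]_m -> Prop) (x : 'rV[R]_m).

Definition expo (mon a : 'X_{1..m}) : 'rV[R]_m := \row_j ((mon j)%:R - (a j)%:R).

(** The sign condition rules out cancellation, so that supports simply unite under addition. *)
Definition lsupp f S : Prop :=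
  exists (p : {mpoly rat[m]}) (a : 'X_{1..m}),
    [/\ f = tofrac p / tofrac 'X_[a], forall mon, 0 <= p@_mon &
        forall x, S x <-> exists2 mon, mon \in msupp p & x = expo mon a].

Lemma tofracX_neq0 (a : 'X_{1..m}) : tofrac ('X_[a] : {mpoly rat[m]}) != 0.
Proof.
rewrite tofrac_eq0; apply/eqP => E.
have := congr1 (fun p => p@_a) E; rewrite mcoeffX eqxx mcoeff0 => /eqP.
by rewrite oner_eq0.
Qed.

Lemma mem_msuppMX (p : {mpoly rat[m]}) a mon :
  reflect (exists2 mon', mon' \in msupp p & mon = (a + mon')%MM)
          (mon \in msupp (p * 'X_[a])).
Proof. by rewrite (perm_mem (msuppMX p a)); apply: (iffP mapP). Qed.

Lemma mcoeffMX_ge0 (p : {mpoly rat[m]}) a mon :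
  (forall mon, 0 <= p@_mon) -> 0 <= (p * 'X_[a])@_mon.
Proof.
move=> p0; have [/mem_msuppMX[mon' _ ->]|] := boolP (mon \in msupp (p * 'X_[a])).
  by rewrite mcoeffMX.
by move/memN_msupp_eq0 ->.
Qed.

Lemma expo_cancel (mon a mon' a' : 'X_{1..m}) :
  (mon + a')%MM = (mon' + a)%MM -> expo mon a = expo mon' a'.
Proof.
move=> E; apply/rowP=> j; rewrite !mxE.
have := congr1 (fun u : 'X_{1..m} => (u j)%:R : R) E; rewrite !mnmDE !natrD; lra.
Qed.

(** Cross-multiplying two representations of [f] shifts both supports by monomials, and the shifts
    are undone on subtracting the denominators. *)
Lemma lsupp_exponent f S : lsupp f S -> forall x, exponent_vector f x <-> S x.
Proof.
case=> p0 [a0 [E0 _ hS]] x; rewrite hS; split=> [[p [a [mon [E mp ->]]]]|[mon mp ->]]; last first.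
  by exists p0, a0, mon.
have Ep : p * 'X_[a0] = p0 * 'X_[a].
  apply/eqP; rewrite -tofrac_eq !tofracM; apply/eqP.
  have := E; rewrite E0 => /(congr1 (fun u => u * tofrac 'X_[a] * tofrac 'X_[a0])).
  by rewrite divfK ?tofracX_neq0 // mulrAC divfK ?tofracX_neq0 // => ->.
have : (a0 + mon)%MM \in msupp (p * 'X_[a0]) by apply/mem_msuppMX; exists mon.
rewrite Ep => /mem_msuppMX[mon' mp' E']; exists mon' => //.
by apply: expo_cancel; rewrite addmC E' addmC.
Qed.

Lemma lsupp_ext f S S' : (forall x, S x <-> S' x) -> lsupp f S -> lsupp f S'.
Proof. by move=> h [p [a [h1 h2 h3]]]; exists p, a; split => // x; rewrite -h. Qed.

Lemma lsuppX k : lsupp (tofrac 'X_k) (fun x => x = delta_mx 0 k).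
Proof.
exists 'X_k, 0%MM; rewrite mpolyX0 tofrac1 divr1; split => //.
  by move=> mon; rewrite mcoeffX; case: eqP.
have E : delta_mx 0 k = expo U_(k) 0%MM.
  by apply/rowP=> j; rewrite !mxE mnm1E mnm0E subr0 eq_sym.
move=> x; rewrite msuppX; split=> [->|[mon]]; first by exists U_(k)%MM; rewrite ?inE.
by rewrite inE => /eqP -> ->.
Qed.

Lemma lsupp_shift f S k l : lsupp f S ->
  lsupp (f * tofrac 'X_k / tofrac 'X_l) (fun x => S (x - delta_mx 0 k + delta_mx 0 l)).
Proof.
case=> p [a [-> p0 hS]]; exists (p * 'X_k), (a + U_(l))%MM; split.
- rewrite tofracM mpolyXD tofracM invfM; rewrite -!mulrA; congr (_ * _).
  by rewrite mulrCA.
- by move=> mon; apply: mcoeffMX_ge0.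
have E mon : expo (U_(k) + mon)%MM (a + U_(l))%MM
    = expo mon a + delta_mx 0 k - delta_mx 0 l.
  apply/rowP=> j; rewrite !mxE !mnmDE !mnm1E !natrD ![j == _]eq_sym /=; lra.
move=> x; rewrite hS; split=> [[mon mp E1]|[mon /mem_msuppMX[mon' mp ->] ->]].
  exists (U_(k) + mon)%MM; first by apply/mem_msuppMX; exists mon.
  by rewrite E -E1 addrAC addrK subrK.
by exists mon' => //; rewrite E addrAC subrK addrK.
Qed.

Lemma lsuppD f g S S' : lsupp f S -> lsupp g S' -> lsupp (f + g) (fun x => S x \/ S' x).
Proof.
case=> p [a [-> p0 hS]] [p' [a' [-> p0' hS']]].
exists (p * 'X_[a'] + p' * 'X_[a]), (a + a')%MM.
have c0 mon := mcoeffMX_ge0 a' mon p0; have c0' mon := mcoeffMX_ge0 a mon p0'.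
split.
- by rewrite addf_div ?tofracX_neq0 // tofracD mpolyXD !tofracM.
- by move=> mon; rewrite mcoeffD addr_ge0.
have memD mon : mon \in msupp (p * 'X_[a'] + p' * 'X_[a]) =
    (mon \in msupp (p * 'X_[a'])) || (mon \in msupp (p' * 'X_[a])).
  by rewrite !mcoeff_msupp mcoeffD paddr_eq0 // negb_and.
move=> x; rewrite hS hS'; split.
  case=> -[mon mp ->].
    exists (a' + mon)%MM; last by apply: expo_cancel; apply/mnmP => j; rewrite !mnmDE; lia.
    by rewrite memD; apply/orP; left; apply/mem_msuppMX; exists mon.
  exists (a + mon)%MM; last by apply: expo_cancel; apply/mnmP => j; rewrite !mnmDE; lia.
  by rewrite memD; apply/orP; right; apply/mem_msuppMX; exists mon.
case=> mon; rewrite memD => /orP[]/mem_msuppMX[mon' mp ->] ->.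
  left; exists mon' => //; apply: expo_cancel; apply/mnmP => j; rewrite !mnmDE; lia.
right; exists mon' => //; apply: expo_cancel; apply/mnmP => j; rewrite !mnmDE; lia.
Qed.

End Laurent.

(** * Exponents of the expansion along a strip *)

Section StripExpansion.
Variables (R : realFieldType) (m D : nat) (s : nat -> bool).
Variables (tau cc : nat -> 'I_m) (kpa kpb kqa kqb : 'I_m).
Variables (fa fb : nat -> ratfun m) (f : ratfun m).
Local Notation X k := (tofrac 'X_k).
Hypothesis fa0 : fa 0%N = X kpa.
Hypothesis fb0 : fb 0%N = X kpb.
Hypothesis fstep : forall l, (l < D)%N ->
  if s l then fb l.+1 = fb l /\
    fa l.+1 = fa l * X (tau l.+1) / X (tau l) + fb l * X (cc l) / X (tau l)
  else fa l.+1 = fa l /\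
    fb l.+1 = fa l * X (cc l) / X (tau l) + fb l * X (tau l.+1) / X (tau l).
Hypothesis fend : f = fa D * X kqb / X (tau D) + fb D * X kqa / X (tau D).

Let pv := partial_vec (R := R) s tau cc kpa kpb.
Let zb (v : nat -> bool) : nat -> R := fun j => (v j)%:R.

Definition partial_point j (b : bool) (x : 'rV[R]_m) : Prop :=
  exists v, [/\ forall l, (l < j)%N -> 0 <= fence_step s (zb v) l, v j = b & x = pv (zb v) j].

Lemma partial_vec_ext z z' j : (forall i, (i <= j)%N -> z i = z' i) -> pv z j = pv z' j.
Proof.
move=> h; rewrite /pv /partial_vec !h //; congr (_ + _); apply: eq_bigr => l _.
have [h1 h2] : z l = z' l /\ z l.+1 = z' l.+1.
  by split; apply: h; rewrite // ltnW.
by rewrite /fence_vec /fence_step /fence_up /fence_dn h1 h2.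
Qed.

(** The last step sees the sequence only through its values at [j] and [j.+1]; the function equal to
    [b'] at [j] and to [b] elsewhere stands for that pair. *)
Lemma partial_pointS j b x : partial_point j.+1 b x <->
  exists2 b' : bool, 0 <= fence_step s (fun i => (if i == j then b' else b)%:R : R) j &
    partial_point j b' (x - fence_vec s tau cc (fun i => (if i == j then b' else b)%:R) j).
Proof.
have loc v : v j.+1 = b -> 
    fence_step s (zb v) j = fence_step s (fun i => (if i == j then v j else b)%:R : R) j /\
    fence_vec s tau cc (zb v) j = fence_vec s tau cc (fun i => (if i == j then v j else b)%:R) j.
  move=> vj; rewrite /fence_vec /fence_up /fence_dn /fence_step /zb eqxx.
  by rewrite gtn_eqF // vj.
have pvS z : pv z j.+1 = pv z j + fence_vec s tau cc z j.
  by rewrite /pv /partial_vec big_ord_recr addrA.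
split=> [[v [vs vj ->]]|[b' hb' [v [vs vj xE]]]].
  have [E1 E2] := loc v vj; exists (v j); first by rewrite -E1; apply: vs.
  exists v; split => //; first by move=> l lj; apply: vs; apply: ltnW.
  by rewrite pvS -E2 addrK.
(* Setting the value at [j.+1] leaves the earlier steps untouched. *)
pose v' i := if i == j.+1 then b else v i.
have v'v i : (i <= j)%N -> zb v' i = zb v i by move=> ij; rewrite /zb /v' ltn_eqF.
have v'j : v' j.+1 = b by rewrite /v' eqxx.
have v'j0 : v' j = b' by rewrite /v' ltn_eqF.
have [E1 E2] := loc v' v'j.
exists v'; split => //.
  move=> l; rewrite ltnS leq_eqVlt => /orP[/eqP ->|lj]; first by rewrite E1 v'j0.
  have := vs l lj; rewrite /fence_step !v'v // ltnW //.
by rewrite pvS E2 v'j0 (partial_vec_ext v'v) -xE subrK.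
Qed.

(** Origin of the fence: the two-term recurrence allows both values at [j], while the one that
    merely copies a length allows only the value already taken, and this is the condition
    [0 <= fence_step]. *)
Lemma partial_expansion j : (j <= D)%N ->
  lsupp (fa j) (partial_point j false) /\ lsupp (fb j) (partial_point j true).
Proof.
elim: j => [|j IHj] jD.
  rewrite fa0 fb0; split; (apply: lsupp_ext; last exact: lsuppX) => x.
    split=> [->|[v [_ v0 ->]]].
      exists xpred0; split => //.
      by rewrite /pv /partial_vec big_ord0 /zb subr0 scale1r scale0r !addr0.
    by rewrite /pv /partial_vec big_ord0 /zb v0 subr0 scale1r scale0r !addr0.
  split=> [->|[v [_ v0 ->]]].
    exists xpredT; split => //.
    by rewrite /pv /partial_vec big_ord0 /zb subrr scale1r scale0r add0r addr0.
  by rewrite /pv /partial_vec big_ord0 /zb v0 subrr scale1r scale0r add0r addr0.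
have [ha hb] := IHj (ltnW jD); have := fstep jD.
have jS : (j.+1 == j) = false by rewrite gtn_eqF.
have ext2 g b S : lsupp g S -> (forall x, S x <-> partial_point j.+1 b x) ->
    lsupp g (partial_point j.+1 b) by move=> hg hS; apply: lsupp_ext hg.
case sj: (s j) => -[-> ->]; split.
- apply: ext2 (lsuppD (lsupp_shift (tau j.+1) (tau j) ha) (lsupp_shift (cc j) (tau j) hb)) _.
  move=> x; rewrite partial_pointS /fence_step /fence_vec /fence_step /fence_up /fence_dn eqxx jS sj.
  split=> [[h|h]|[[] _ h]].
  + by exists false; rewrite /= ?subrr // ?subr0 scale0r !scale1r add0r opprB addrCA addrC in h *.
  + by exists true; rewrite /= ?subr0 // ?subrr scale0r !scale1r addr0 opprB addrCA addrC in h *.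
  + by right; rewrite /= ?subr0 ?subrr scale0r !scale1r addr0 opprB addrCA addrC in h *.
  + by left; rewrite /= ?subrr ?subr0 scale0r !scale1r add0r opprB addrCA addrC in h *.
- apply: ext2 hb _ => x.
  rewrite partial_pointS /fence_step /fence_vec /fence_step /fence_up /fence_dn eqxx jS sj.
  split=> [h|[[] + h]].
  + by exists true; rewrite /= !(subrr, scale0r, addr0, subr0).
  + by move=> _; rewrite /= !(subrr, scale0r, addr0, subr0) in h.
  + by rewrite sub0r oppr_ge0 ler10.
- apply: ext2 ha _ => x.
  rewrite partial_pointS /fence_step /fence_vec /fence_step /fence_up /fence_dn eqxx jS sj.
  split=> [h|[[] + h]].
  + by exists false; rewrite /= !(subrr, scale0r, addr0, subr0).
  + by rewrite sub0r oppr_ge0 ler10.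
  + by move=> _; rewrite /= !(subrr, scale0r, addr0, subr0) in h.
- apply: ext2 (lsuppD (lsupp_shift (cc j) (tau j) ha) (lsupp_shift (tau j.+1) (tau j) hb)) _.
  move=> x; rewrite partial_pointS /fence_step /fence_vec /fence_step /fence_up /fence_dn eqxx jS sj.
  split=> [[h|h]|[[] _ h]].
  + by exists false; rewrite /= ?subr0 // ?subrr scale0r !scale1r addr0 opprB addrCA addrC in h *.
  + by exists true; rewrite /= ?subrr // ?subr0 scale0r !scale1r add0r opprB addrCA addrC in h *.
  + by right; rewrite /= ?subrr ?subr0 scale0r !scale1r add0r opprB addrCA addrC in h *.
  + by left; rewrite /= ?subr0 ?subrr scale0r !scale1r addr0 opprB addrCA addrC in h *.
Qed.

Lemma strip_expansion (x : 'rV[R]_m) :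
  exponent_vector f x <-> fence_point D s tau cc kpa kpb kqa kqb x.
Proof.
have [ha hb] := partial_expansion (leqnn D); rewrite fend.
apply: iff_trans (lsupp_exponent
  (lsuppD (lsupp_shift kqb (tau D) ha) (lsupp_shift kqa (tau D) hb)) x) _.
have E v : strip_vec D s tau cc kpa kpb kqa kqb (zb v) =
    pv (zb v) D + (if v D then delta_mx 0 kqa else delta_mx 0 kqb) - delta_mx 0 (tau D).
  rewrite /strip_vec -/pv /zb; case: (v D) => /=.
    by rewrite subrr scale0r scale1r addr0.
  by rewrite subr0 scale0r scale1r addr0.
split=> [[[v [vs vD h]]|[v [vs vD h]]]|[v vs ->]].
- by exists v => //; rewrite E vD -h addrAC addrK subrK.
- by exists v => //; rewrite E vD -h addrAC addrK subrK.
- by rewrite E; case vD: (v D); [right|left]; exists v; rewrite addrAC subrK addrK.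
Qed.

End StripExpansion.

(** * The strip of triangles crossed by a diagonal *)

(* The segment from p to q crosses tau 0, ..., tau D in this order; tau j joins
   a j, clockwise between p and q, to b j, clockwise between q and p. The triangle
   between tau l and tau l.+1 has third side cc l, on the a side iff s l. *)
Record strip n (T : edges n) (p q : 'I_(n + 3)) (D : nat)
    (tau cc : nat -> 'I_(2 * n + 3)) (a b : nat -> 'I_(n + 3)) (s : nat -> bool)
    (kpa kpb kqa kqb : 'I_(2 * n + 3)) : Prop := Strip {
  strip_tau : forall j, (j <= D)%N ->
    [/\ T (tau j) = [set a j; b j], cyc p (a j) q & cyc q (b j) p];
  strip_mono : forall j l, (j < l)%N -> (l <= D)%N ->
    [/\ a l = a j \/ cyc p (a j) (a l), b l = b j \/ cyc q (b l) (b j) &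
        ~ (a l = a j /\ b l = b j)];
  strip_step : forall l, (l < D)%N ->
    if s l then [/\ b l.+1 = b l, T (cc l) = [set a l; a l.+1] & cyc p (a l) (a l.+1)]
    else [/\ a l.+1 = a l, T (cc l) = [set b l; b l.+1] & cyc q (b l.+1) (b l)];
  strip_kpa : T kpa = [set p; a 0%N];
  strip_kpb : T kpb = [set p; b 0%N];
  strip_kqa : T kqa = [set q; a D];
  strip_kqb : T kqb = [set q; b D];
  strip_crossed : forall k, k \in crossed T [set p; q] <-> exists2 j, (j <= D)%N & k = tau j
}.

Lemma fun_choice (X Y : Type) (P : X -> Y -> Prop) :
  (forall x, exists y, P x y) -> exists f, forall x, P x (f x).
Proof.
move=> h; exists (fun x => proj1_sig (ClassicalEpsilon.constructive_indefinite_description _ (h x))).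
by move=> x; case: ClassicalEpsilon.constructive_indefinite_description.
Qed.

Section StripExistence.
Variables (n : nat) (T : edges n) (p q : 'I_(n + 3)) (D : nat).
Variable i : 'I_D.+1 -> 'I_(2 * n + 3).
Hypotheses (triT : triangulation T) (ord_i : crossed_in_order T p q i).

Lemma crossed_i j : i j \in crossed T [set p; q].
Proof. by case: ord_i => h _; apply/h; exists j. Qed.

(** An end of the later diagonal is shared with the earlier one or separated by it from [p]; on
    either arc between [p] and [q] the latter means lying farther from [p]. *)
Lemma precedes_ends (j l : 'I_D.+1) a b a' b' : (j < l)%N ->
  T (i j) = [set a; b] -> cyc p a q -> cyc q b p ->
  T (i l) = [set a'; b'] -> cyc p a' q -> cyc q b' p ->
  [/\ a' = a \/ cyc p a a', b' = b \/ cyc q b' b & ~ (a' = a /\ b' = b)].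
Proof.
case: ord_i => _ pr jl Ej paq qbp El paq' qbp'; have [ne h] := pr j l jl.
split.
- have := h a'; rewrite El set21 Ej crossesE !inE => /(_ isT) [/orP[]/eqP E|h1].
  + by left.
  + by exfalso; subst b; move: paq' qbp; cyclia.
  + by right; move: h1 paq qbp paq' => /orP[]/andP[]; cyclia.
- have := h b'; rewrite El set22 Ej crossesE !inE => /(_ isT) [/orP[]/eqP E|h1].
  + by exfalso; subst a; move: paq qbp'; cyclia.
  + by left.
  + by right; move: h1 paq qbp qbp' => /orP[]/andP[]; cyclia.
- by case=> E1 E2; case/eqP: ne; rewrite Ej El E1 E2.
Qed.

(** The order alone does not say that consecutive diagonals share a triangle. The triangle beyond
    [tau l] has an apex [c]; the side joining [c] to one of the old ends is again crossed, hence
    listed, and monotonicity and non-crossing leave no room for a diagonal before it. *)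
Lemma strip_exists : exists (tau : nat -> 'I_(2 * n + 3)) cc a b s kpa kpb kqa kqb,
  (forall j : 'I_D.+1, tau j = i j) /\ strip T p q D tau cc a b s kpa kpb kqa kqb.
Proof.
(* Beyond [D] this falls back on the first crossed diagonal, so the ends [a j], [b j] exist for
   every [j]. *)
pose tau j := i (inord j).
have [ab habs] : exists ab : nat -> 'I_(n + 3) * 'I_(n + 3), forall j,
    [/\ T (tau j) = [set (ab j).1; (ab j).2], cyc p (ab j).1 q & cyc q (ab j).2 p].
  apply: (fun_choice (P := fun j (ab : 'I_(n + 3) * 'I_(n + 3)) =>
    [/\ T (tau j) = [set ab.1; ab.2], cyc p ab.1 q & cyc q ab.2 p])) => j.
  by have [x [y [h1 h2 h3]]] := crossed_ends (crossed_i (inord j)); exists (x, y).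
pose a j := (ab j).1; pose b j := (ab j).2.
have {habs} hab j : [/\ T (tau j) = [set a j; b j], cyc p (a j) q & cyc q (b j) p] by apply: habs.
have mono j l : (j < l)%N -> (l <= D)%N ->
    [/\ a l = a j \/ cyc p (a j) (a l), b l = b j \/ cyc q (b l) (b j) &
        ~ (a l = a j /\ b l = b j)].
  move=> jl lD; have [h1 h2 h3] := hab j; have [h4 h5 h6] := hab l.
  apply: precedes_ends h1 h2 h3 h4 h5 h6.
  by rewrite !inordK ?ltnS // (leq_trans (ltnW jl)).
have cr x y : adj T x y -> cyc p x q -> cyc q y p -> exists j, [/\ (j <= D)%N, a j = x & b j = y].
  case/adjP=> k Ek pxq qyp; have := crossedE Ek pxq qyp.
  case: (ord_i) => h _ /h[j Ej]; exists j; have [h1 h2 h3] := hab j.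
  have Ej' : tau j = k by rewrite /tau inord_val.
  move: h1; rewrite Ej' Ek => /set2_eq[[-> ->]|[E1 E2]]; first by rewrite -ltnS.
  by exfalso; move: h2 pxq qyp; rewrite -E2; cyclia.
have step l : (l < D)%N -> exists k : 'I_(2 * n + 3),
    if b l.+1 == b l then [/\ b l.+1 = b l, T k = [set a l; a l.+1] & cyc p (a l) (a l.+1)]
    else [/\ a l.+1 = a l, T k = [set b l; b l.+1] & cyc q (b l.+1) (b l)].
  move=> lD; have [El paq qbp] := hab l; have [El' paq' qbp'] := hab l.+1.
  have [ma mb mab] := mono l l.+1 (leqnn _) lD.
  have aqb : cyc (a l) q (b l) by move: paq qbp; cyclia.
  have [c [acb ac cb]] := third_vertex triT (adj_label El) aqb.
  have ab' := adj_label El'; have ba' : adj T (b l.+1) (a l.+1) by rewrite adjC.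
  (* The next diagonal moves at least one end, and would then cross a side of a triangle with apex
     [q]. *)
  have [cq|ncq] := eqVneq c q.
    exfalso; subst c; case: ma => ma; last first.
      by apply: (adj_noncross triT ac ab'); move: ma mb paq qbp paq' qbp'; cyclia.
    case: mb => mb; first by apply: mab.
    by apply: (adj_noncross triT cb ba'); move: mb paq qbp paq' qbp'; cyclia.
  have [pcq|qcp] : cyc p c q \/ cyc q c p.
    by apply/orP; move: ncq acb paq qbp; cyclia.
  - have [l' [l'D al' bl']] := cr c (b l) cb pcq qbp.
    have pac : cyc p (a l) c by move: paq pcq acb qbp; cyclia.
    have ll' : (l < l')%N.
      rewrite ltnNge leq_eqVlt; apply/negP => /orP[/eqP E|lt].
        by move: pac; rewrite -E al'; cyclia.
      have [[E|E] _ _] := mono l' l lt (ltnW lD).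
        by move: pac; rewrite E al'; cyclia.
      by move: pac E; rewrite al'; cyclia.
    (* The end [b] is squeezed between its equal values at [l] and [l'], and [a l.+1] strictly
       between [a l] and [c] would make [tau l.+1] cross [[a l; c]]. *)
    have [Ea Eb] : a l.+1 = c /\ b l.+1 = b l.
      move: ll'; rewrite leq_eqVlt => /orP[/eqP->|ll']; first by rewrite al' bl'.
      have [ma' mb' mab'] := mono l.+1 l' ll' l'D.
      have Eb : b l.+1 = b l.
        case: mb => // mb; case: mb' => [<-//|]; rewrite bl' => mb'.
        by exfalso; move: mb mb'; cyclia.
      split=> //; case: ma' => [<- //|ma']; exfalso; rewrite al' in ma'.
      have {}ma : cyc p (a l) (a l.+1) by case: ma => // ma; case: mab.
      by apply: (adj_noncross triT ac ab'); move: ma ma' pac pcq qbp'; cyclia.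
    have /adjP[k Ek] := ac; exists k; rewrite Eb eqxx Ea; split => //.
  - have [l' [l'D al' bl']] := cr (a l) c ac paq qcp.
    have qcb : cyc q c (b l) by move: paq qcp acb qbp; cyclia.
    have ll' : (l < l')%N.
      rewrite ltnNge leq_eqVlt; apply/negP => /orP[/eqP E|lt].
        by move: qcb; rewrite -E bl'; cyclia.
      have [_ [E|E] _] := mono l' l lt (ltnW lD).
        by move: qcb; rewrite E bl'; cyclia.
      by move: qcb E; rewrite bl'; cyclia.
    have [Ea Eb] : a l.+1 = a l /\ b l.+1 = c.
      move: ll'; rewrite leq_eqVlt => /orP[/eqP->|ll']; first by rewrite al' bl'.
      have [ma' mb' mab'] := mono l.+1 l' ll' l'D.
      have Ea : a l.+1 = a l.
        case: ma => // ma; case: ma' => [<-//|]; rewrite al' => ma'.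
        by exfalso; move: ma ma'; cyclia.
      split=> //; case: mb' => [<- //|mb']; exfalso; rewrite bl' in mb'.
      have {}mb : cyc q (b l.+1) (b l) by case: mb => // mb; case: mab.
      by apply: (adj_noncross triT cb ba'); move: mb mb' qcb qbp paq'; cyclia.
    have /adjP[k Ek] : adj T (b l) c by rewrite adjC.
    exists k; have /negbTE -> : b l.+1 != b l by rewrite Eb; move: qcb; cyclia.
    by rewrite Eb; split.
have [cc hcc] : exists cc : nat -> 'I_(2 * n + 3), forall l, (l < D)%N ->
    if b l.+1 == b l then [/\ b l.+1 = b l, T (cc l) = [set a l; a l.+1] & cyc p (a l) (a l.+1)]
    else [/\ a l.+1 = a l, T (cc l) = [set b l; b l.+1] & cyc q (b l.+1) (b l)].
  apply: (fun_choice (P := fun l k => (l < D)%N ->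
    if b l.+1 == b l then [/\ b l.+1 = b l, T k = [set a l; a l.+1] & cyc p (a l) (a l.+1)]
    else [/\ a l.+1 = a l, T k = [set b l; b l.+1] & cyc q (b l.+1) (b l)])) => l.
  by case: (ltnP l D) => [/step[k hk]|_]; [exists k | exists (i ord0)].
(* The triangle before [tau 0] has apex [p]; otherwise one of its sides would be a crossed diagonal
   preceding [tau 0]. *)
have [pa pb] : adj T p (a 0%N) /\ adj T p (b 0%N).
  have [E paq qbp] := hab 0%N.
  have bpa : cyc (b 0%N) p (a 0%N) by move: paq qbp; cyclia.
  have [c [bca bc ca]] := third_vertex triT (etrans (adjC _ _ _) (adj_label E)) bpa.
  suff <- : c = p by rewrite [adj _ c (b _)]adjC.
  have n1 : ~~ cyc p c (a 0%N).
    apply/negP => pca; have [j [jD aj bj]] := cr c (b 0%N) (etrans (adjC _ _ _) bc)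
      ltac:(move: pca paq; cyclia) qbp.
    case: j jD aj bj => [|j] jD aj bj; first by move: pca; rewrite aj; cyclia.
    have [[E'|E'] _ _] := mono 0%N j.+1 isT jD; first by move: pca; rewrite -aj E'; cyclia.
    by move: pca E'; rewrite aj; cyclia.
  have n2 : ~~ cyc (b 0%N) c p.
    apply/negP => bcp; have [j [jD aj bj]] := cr (a 0%N) c (etrans (adjC _ _ _) ca) paq
      ltac:(move: bcp qbp; cyclia).
    case: j jD aj bj => [|j] jD aj bj; first by move: bcp; rewrite bj; cyclia.
    have [_ [E'|E'] _] := mono 0%N j.+1 isT jD; first by move: bcp; rewrite -bj E'; cyclia.
    by move: bcp E' qbp; rewrite bj; cyclia.
  by apply: val_inj; move: n1 n2 bca bpa; cyclia.
have [qa qb] : adj T q (a D) /\ adj T q (b D).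
  have [E paq qbp] := hab D.
  have aqb : cyc (a D) q (b D) by move: paq qbp; cyclia.
  have [c [acb ac cb]] := third_vertex triT (adj_label E) aqb.
  suff <- : c = q by rewrite [adj _ c (a _)]adjC.
  have n1 : ~~ cyc (a D) c q.
    apply/negP => acq; have [j [jD aj bj]] := cr c (b D) cb
      ltac:(move: acq paq; cyclia) qbp.
    move: jD; rewrite leq_eqVlt => /orP[/eqP E'|jD]; first by move: acq; rewrite -aj E'; cyclia.
    have [[E'|E'] _ _] := mono j D jD (leqnn _); first by move: acq; rewrite -aj E'; cyclia.
    by move: acq E' paq; rewrite aj; cyclia.
  have n2 : ~~ cyc q c (b D).
    apply/negP => qcb; have [j [jD aj bj]] := cr (a D) c ac paq
      ltac:(move: qcb qbp; cyclia).
    move: jD; rewrite leq_eqVlt => /orP[/eqP E'|jD]; first by move: qcb; rewrite -bj E'; cyclia.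
    have [_ [E'|E'] _] := mono j D jD (leqnn _); first by move: qcb; rewrite -bj E'; cyclia.
    by move: qcb E' qbp; rewrite bj; cyclia.
  by apply: val_inj; move: n1 n2 acb aqb; cyclia.
have /adjP[kpa Epa] := pa; have /adjP[kpb Epb] := pb.
have /adjP[kqa Eqa] := qa; have /adjP[kqb Eqb] := qb.
exists tau, cc, a, b, (fun l => b l.+1 == b l), kpa, kpb, kqa, kqb.
split; first by move=> j; rewrite /tau inord_val.
split => //.
move=> k; case: (ord_i) => h _; rewrite h; split=> [[j <-]|[j _ ->]].
  by exists j; [rewrite -ltnS | rewrite /tau inord_val].
by exists (inord j).
Qed.

End StripExistence.

(** * Edges of the subpolygon and its boundary *)

Lemma in_side N (V : {set 'I_N}) u v : u \in V -> v \in V -> u != v ->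
  (forall w, w \in V -> ~~ cyc u w v) -> side V [set u; v].
Proof.
move=> uV vV uv h; apply/existsP; exists u; rewrite uV; apply/existsP; exists v.
by rewrite vV uv eqxx; apply/forallP=> w; apply/implyP; apply: h.
Qed.

Section StripCombinatorics.
Variables (n : nat) (T : edges n) (p q : 'I_(n + 3)) (D : nat).
Variables (tau cc : nat -> 'I_(2 * n + 3)) (a b : nat -> 'I_(n + 3)) (s : nat -> bool).
Variables (kpa kpb kqa kqb : 'I_(2 * n + 3)).
Hypotheses (triT : triangulation T) (gT : forall k, T k <> [set p; q]).
Hypothesis st : strip T p q D tau cc a b s kpa kpb kqa kqb.

Local Notation g := [set p; q].

Lemma a_arc j : (j <= D)%N -> cyc p (a j) q.
Proof. by case/(strip_tau st). Qed.

Lemma b_arc j : (j <= D)%N -> cyc q (b j) p.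
Proof. by case/(strip_tau st). Qed.

Lemma tau_ends j : (j <= D)%N -> T (tau j) = [set a j; b j].
Proof. by case/(strip_tau st). Qed.

Lemma a_le j l : (j <= l)%N -> (l <= D)%N -> a l = a j \/ cyc p (a j) (a l).
Proof.
rewrite leq_eqVlt => /orP[/eqP->|jl] lD; first by left.
by case: (strip_mono st jl lD).
Qed.

Lemma b_le j l : (j <= l)%N -> (l <= D)%N -> b l = b j \/ cyc q (b l) (b j).
Proof.
rewrite leq_eqVlt => /orP[/eqP->|jl] lD; first by left.
by case: (strip_mono st jl lD).
Qed.

Lemma step_a l : (l < D)%N -> s l ->
  [/\ b l.+1 = b l, T (cc l) = [set a l; a l.+1] & cyc p (a l) (a l.+1)].
Proof. by move=> lD sl; have := strip_step st lD; rewrite sl. Qed.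

Lemma step_b l : (l < D)%N -> s l = false ->
  [/\ a l.+1 = a l, T (cc l) = [set b l; b l.+1] & cyc q (b l.+1) (b l)].
Proof. by move=> lD sl; have := strip_step st lD; rewrite sl. Qed.

Lemma pq_neq : p != q.
Proof. by have [_ _] := cyc_neq (a_arc (leq0n D)). Qed.

Lemma a_neq j : (j <= D)%N -> [/\ p != a j, a j != q & q != a j].
Proof. by move=> jD; have [-> h _] := cyc_neq (a_arc jD); rewrite h eq_sym. Qed.

Lemma b_neq j : (j <= D)%N -> [/\ q != b j, b j != p & p != b j].
Proof. by move=> jD; have [-> h _] := cyc_neq (b_arc jD); rewrite h eq_sym. Qed.

Lemma ab_neq j l : (j <= D)%N -> (l <= D)%N -> a j != b l.
Proof. by move=> jD lD; move: (a_arc jD) (b_arc lD); cyclia. Qed.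

Lemma label_neq k k' u v u' v' : T k = [set u; v] -> T k' = [set u'; v'] ->
  u != u' -> u != v' -> k != k'.
Proof.
move=> E E' n1 n2; apply/eqP => kk; have := set21 u v.
by rewrite -E kk E' !inE (negbTE n1) (negbTE n2).
Qed.

Lemma strip_tau_inj j l : (j <= D)%N -> (l <= D)%N -> tau j = tau l -> j = l.
Proof.
wlog jl : j l / (j < l)%N.
  move=> W jD lD E; case: (ltngtP j l) => // h; first exact: W.
  by apply/esym; apply: W.
move=> jD lD E; have [_ _ []] := strip_mono st jl lD.
have := congr1 T E; rewrite !tau_ends // => /set2_eq[[-> ->]|[h _]] //.
by have := ab_neq jD lD; rewrite h eqxx.
Qed.

Lemma strip_cc_inj j l : (j < D)%N -> (l < D)%N -> cc j = cc l -> j = l.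
Proof.
wlog jl : j l / (j < l)%N.
  move=> W jD lD E; case: (ltngtP j l) => // h; first exact: W.
  by apply/esym; apply: W.
move=> jD lD E; exfalso; have := congr1 T E.
have n1 := ab_neq (ltnW jD) (ltnW lD); have n2 := ab_neq (ltnW jD) lD.
have n3 := ab_neq (ltnW lD) (ltnW jD); have n4 := ab_neq lD (ltnW jD).
case sj: (s j); case sl: (s l).
- have [_ -> h1] := step_a jD sj; have [_ -> h2] := step_a lD sl.
  by move=> /set2_eq[[/(congr1 val) E1 /(congr1 val) E2]|[/(congr1 val) E1 /(congr1 val) E2]];
    case: (a_le jl (ltnW lD)) => [/(congr1 val) h3|h3]; move: h1 h2 h3 E1 E2; cyclia.
- have [_ -> h1] := step_a jD sj; have [_ -> h2] := step_b lD sl.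
  by move=> /set2_eq[[/eqP E1 _]|[/eqP E1 _]]; rewrite E1 in n1 n2.
- have [_ -> h1] := step_b jD sj; have [_ -> h2] := step_a lD sl.
  by move=> /set2_eq[[/esym/eqP E1 _]|[/esym/eqP E1 _]]; rewrite E1 in n3 n4.
- have [_ -> h1] := step_b jD sj; have [_ -> h2] := step_b lD sl.
  by move=> /set2_eq[[/(congr1 val) E1 /(congr1 val) E2]|[/(congr1 val) E1 /(congr1 val) E2]];
    case: (b_le jl (ltnW lD)) => [/(congr1 val) h3|h3]; move: h1 h2 h3 E1 E2; cyclia.
Qed.

Lemma strip_tau_cc j l : (j <= D)%N -> (l < D)%N -> tau j != cc l.
Proof.
move=> jD lD; case sl: (s l).
  have [_ E _] := step_a lD sl.
  by apply: (label_neq (etrans (tau_ends jD) (setUC _ _)) E); rewrite eq_sym ab_neq // ltnW.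
have [_ E _] := step_b lD sl.
by apply: (label_neq (tau_ends jD) E); rewrite ab_neq // ltnW.
Qed.

Lemma end_vertex k : k \in [:: kpa; kpb; kqa; kqb] -> exists u v,
  [/\ T k = [set u; v], u \in g & exists2 j, (j <= D)%N & v = a j \/ v = b j].
Proof.
rewrite !inE => /or4P[]/eqP->.
- by exists p, (a 0%N); rewrite (strip_kpa st) !inE eqxx; split => //; exists 0%N; auto.
- by exists p, (b 0%N); rewrite (strip_kpb st) !inE eqxx; split => //; exists 0%N; auto.
- by exists q, (a D); rewrite (strip_kqa st) !inE eqxx orbT; split => //; exists D; auto.
- by exists q, (b D); rewrite (strip_kqb st) !inE eqxx orbT; split => //; exists D; auto.
Qed.

Lemma a_g j : (j <= D)%N -> a j \notin g.
Proof. by move=> jD; rewrite !inE; move: (a_arc jD); cyclia. Qed.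

Lemma b_g j : (j <= D)%N -> b j \notin g.
Proof. by move=> jD; rewrite !inE; move: (b_arc jD); cyclia. Qed.

Lemma tau_g w j : (j <= D)%N -> w \in T (tau j) -> w \notin g.
Proof.
by move=> jD; rewrite tau_ends // in_set2 => /orP[]/eqP->; rewrite ?a_g ?b_g.
Qed.

Lemma cc_ends l : (l < D)%N -> exists u v, [/\ T (cc l) = [set u; v] &
  (u = a l /\ v = a l.+1) \/ (u = b l /\ v = b l.+1)].
Proof.
move=> lD; case sl: (s l).
  by have [_ E _] := step_a lD sl; exists (a l), (a l.+1); auto.
by have [_ E _] := step_b lD sl; exists (b l), (b l.+1); auto.
Qed.

Lemma cc_g w l : (l < D)%N -> w \in T (cc l) -> w \notin g.
Proof.
move=> lD; have lD' := ltnW lD; have [u [v [-> h]]] := cc_ends lD.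
by rewrite in_set2; case: h => -[-> ->] /orP[]/eqP->; rewrite ?a_g ?b_g.
Qed.

Lemma strip_k_tau k j : k \in [:: kpa; kpb; kqa; kqb] -> (j <= D)%N -> k != tau j.
Proof.
move=> /end_vertex[u [v [E ug _]]] jD; apply/eqP => kE.
by have := @tau_g u j jD; rewrite -kE E set21 ug => /(_ isT).
Qed.

Lemma strip_k_cc k l : k \in [:: kpa; kpb; kqa; kqb] -> (l < D)%N -> k != cc l.
Proof.
move=> /end_vertex[u [v [E ug _]]] lD; apply/eqP => kE.
by have := @cc_g u l lD; rewrite -kE E set21 ug => /(_ isT).
Qed.

Lemma strip_k_uniq : uniq [:: kpa; kpb; kqa; kqb].
Proof.
have [n1 n2 n3] := a_neq (leq0n D); have [m1 m2 m3] := b_neq (leq0n D).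
have [n1' n2' n3'] := a_neq (leqnn D); have [m1' m2' m3'] := b_neq (leqnn D).
have Epa := strip_kpa st; have Epb := strip_kpb st.
have Eqa := strip_kqa st; have Eqb := strip_kqb st.
have pq := pq_neq.
rewrite /= !inE !negb_or andbT; apply/and3P; split; first (apply/and3P; split).
- by apply: (label_neq (etrans Epa (setUC _ _)) Epb); rewrite 1?eq_sym // eq_sym ab_neq.
- exact: label_neq Epa Eqa pq n1'.
- exact: label_neq Epa Eqb pq m3'.
- by rewrite (label_neq Epb Eqa pq n1') (label_neq Epb Eqb pq m3').
- by apply: (label_neq (etrans Eqa (setUC _ _)) Eqb); rewrite 1?eq_sym // eq_sym ab_neq.
Qed.

Lemma sub_verticesP w : w \in sub_vertices T g <->
  w \in g \/ exists2 j, (j <= D)%N & w = a j \/ w = b j.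
Proof.
rewrite inE; split=> [/orP[wg|/bigcupP[k /(strip_crossed st)[j jD ->]]]|[->//|[j jD h]]].
- by left.
- rewrite tau_ends // !inE => h; right; exists j => //.
  by case/orP: h => /eqP; auto.
- apply/orP; right; apply/bigcupP; exists (tau j); first by apply/(strip_crossed st); exists j.
  by rewrite tau_ends // !inE; case: h => ->; rewrite eqxx ?orbT.
Qed.

Lemma a_sub j : (j <= D)%N -> a j \in sub_vertices T g.
Proof. by move=> jD; apply/sub_verticesP; right; exists j; auto. Qed.

Lemma b_sub j : (j <= D)%N -> b j \in sub_vertices T g.
Proof. by move=> jD; apply/sub_verticesP; right; exists j; auto. Qed.

Lemma p_sub : p \in sub_vertices T g.
Proof. by apply/sub_verticesP; left; rewrite set21. Qed.

Lemma q_sub : q \in sub_vertices T g.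
Proof. by apply/sub_verticesP; left; rewrite set22. Qed.

Lemma tau_sub j : (j <= D)%N -> tau j \in sub_edges T g.
Proof.
move=> jD; rewrite inE tau_ends //; apply/subsetP=> w.
by rewrite in_set2 => /orP[]/eqP ->; rewrite ?a_sub ?b_sub.
Qed.

Lemma cc_sub l : (l < D)%N -> cc l \in sub_edges T g.
Proof.
move=> lD; rewrite inE; have [u [v [-> h]]] := cc_ends lD; apply/subsetP=> w.
have lD' := ltnW lD.
by rewrite in_set2; case: h => -[-> ->] /orP[]/eqP ->; rewrite ?a_sub ?b_sub.
Qed.

Lemma end_sub k : k \in [:: kpa; kpb; kqa; kqb] -> k \in sub_edges T g.
Proof.
move=> /end_vertex[u [v [E ug [j jD h]]]]; rewrite inE E; apply/subsetP=> w.
rewrite in_set2 => /orP[]/eqP ->; first by apply/sub_verticesP; left.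
by case: h => ->; rewrite ?a_sub ?b_sub.
Qed.

(** Locates a step at which one end of the crossed diagonals leaves its position. *)
Lemma change_index (c : nat -> 'I_(n + 3)) j k : c (j + k)%N <> c j ->
  exists l, [/\ (j <= l)%N, (l < j + k)%N, c l = c j & c l.+1 <> c j].
Proof.
elim: k => [|k IHk]; first by rewrite addn0.
have [E|/eqP ne] := eqVneq (c (j + k)%N) (c j).
  by move=> h; exists (j + k)%N; split => //; rewrite ?leq_addr ?addnS // -addnS.
move=> _; have [l [h1 h2 h3 h4]] := IHk ne; exists l; split => //.
by rewrite addnS ltnS ltnW.
Qed.

(** At the step [l'] where the end leaves [a j], an edge reaching past [a l'.+1] would cross
    [tau l'.+1]. *)
Lemma aa_edge k j l : (j <= D)%N -> (l <= D)%N -> T k = [set a j; a l] ->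
  exists2 l, (l < D)%N & k = cc l.
Proof.
move=> jD lD Ek; have := adj_neq triT (adj_label Ek).
wlog jl : j l jD lD Ek / (j <= l)%N.
  move=> W; case: (leqP j l) => [|/ltnW] jl ne; first exact: (W j l).
  by apply: (W l j) => //; [rewrite Ek setUC | rewrite eq_sym].
rewrite eq_sym => /eqP ne; have [|l' [h1 h2 h3 h4]] := @change_index a j (l - j)%N.
  by rewrite subnKC.
rewrite subnKC // in h2; have l'D : (l' < D)%N by apply: leq_trans h2 lD.
exists l' => //; apply: (tri_inj triT); rewrite Ek.
case sl: (s l'); last by have [E _ _] := step_b l'D sl; case: h4; rewrite E.
have [E -> c1] := step_a l'D sl; rewrite h3; congr [set _; _].
case: (a_le h2 lD) => // c2; exfalso.
apply: (adj_noncross triT (adj_label Ek) (adj_label (tau_ends l'D))).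
  by move: c1 c2; rewrite h3; cyclia.
by move: c1 c2 (a_arc l'D) (b_arc l'D) (a_arc lD) (a_arc jD); rewrite h3; cyclia.
Qed.

Lemma bb_edge k j l : (j <= D)%N -> (l <= D)%N -> T k = [set b j; b l] ->
  exists2 l, (l < D)%N & k = cc l.
Proof.
move=> jD lD Ek; have := adj_neq triT (adj_label Ek).
wlog jl : j l jD lD Ek / (j <= l)%N.
  move=> W; case: (leqP j l) => [|/ltnW] jl ne; first exact: (W j l).
  by apply: (W l j) => //; [rewrite Ek setUC | rewrite eq_sym].
rewrite eq_sym => /eqP ne; have [|l' [h1 h2 h3 h4]] := @change_index b j (l - j)%N.
  by rewrite subnKC.
rewrite subnKC // in h2; have l'D : (l' < D)%N by apply: leq_trans h2 lD.
exists l' => //; apply: (tri_inj triT); rewrite Ek.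
case sl: (s l'); first by have [E _ _] := step_a l'D sl; case: h4; rewrite E.
have [E -> c1] := step_b l'D sl; rewrite h3; congr [set _; _].
case: (b_le h2 lD) => // c2; exfalso.
apply: (adj_noncross triT (adj_label Ek) (adj_label (tau_ends l'D))).
  by move: c1 c2 (a_arc l'D) (b_arc l'D) (b_arc lD) (b_arc jD); rewrite h3; cyclia.
by move: c1 c2; rewrite h3; cyclia.
Qed.

(** Any other vertex of the subpolygon lies beyond [tau 0] as seen from [p], so an edge to it would
    cross [tau 0]. *)
Lemma p_edge k v : T k = [set p; v] -> v \in sub_vertices T g ->
  k \in [:: kpa; kpb; kqa; kqb].
Proof.
move=> Ek; have pv := adj_label Ek; have h0 := tau_ends (leq0n D).
have ab0 := adj_label h0.
have qbp := b_arc (leq0n D); have paq := a_arc (leq0n D).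
case/sub_verticesP=> [|[j jD [E|E]]].
- rewrite !inE => /orP[]/eqP E; last by case: (gT (k := k)); rewrite Ek E.
  by have := adj_neq triT pv; rewrite E eqxx.
- subst v; case: (a_le (leq0n j) jD) => [E|h].
    have -> : k = kpa by apply: (tri_inj triT); rewrite Ek (strip_kpa st) E.
    by rewrite inE eqxx.
  exfalso; apply: (adj_noncross triT pv ab0) => //.
  by move: h (a_arc jD) qbp; cyclia.
- subst v; case: (b_le (leq0n j) jD) => [E|h].
    have -> : k = kpb by apply: (tri_inj triT); rewrite Ek (strip_kpb st) E.
    by rewrite !inE eqxx orbT.
  exfalso; apply: (adj_noncross triT pv ab0); move: h (b_arc jD) qbp paq; cyclia.
Qed.

Lemma q_edge k v : T k = [set q; v] -> v \in sub_vertices T g ->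
  k \in [:: kpa; kpb; kqa; kqb].
Proof.
move=> Ek; have qv := adj_label Ek; have h0 := tau_ends (leqnn D).
have ab0 := adj_label h0; have ba0 := etrans (adjC T (b D) (a D)) ab0.
have qbp := b_arc (leqnn D); have paq := a_arc (leqnn D).
case/sub_verticesP=> [|[j jD [E|E]]].
- rewrite !inE => /orP[]/eqP E; first by case: (gT (k := k)); rewrite Ek E setUC.
  by have := adj_neq triT qv; rewrite E eqxx.
- subst v; case: (a_le jD (leqnn D)) => [E|h].
    have -> : k = kqa by apply: (tri_inj triT); rewrite Ek (strip_kqa st) E.
    by rewrite !inE eqxx !orbT.
  exfalso; apply: (adj_noncross triT qv ba0); move: h (a_arc jD) qbp paq; cyclia.
- subst v; case: (b_le jD (leqnn D)) => [E|h].
    have -> : k = kqb by apply: (tri_inj triT); rewrite Ek (strip_kqb st) E.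
    by rewrite !inE eqxx !orbT.
  exfalso; apply: (adj_noncross triT qv ba0); move: h (b_arc jD) qbp paq; cyclia.
Qed.

Lemma ab_edge k j l : (j <= D)%N -> (l <= D)%N -> T k = [set a j; b l] ->
  exists2 j, (j <= D)%N & k = tau j.
Proof.
move=> jD lD Ek; apply/(strip_crossed st).
exact: crossedE Ek (a_arc jD) (b_arc lD).
Qed.

(** [sub_edges] takes every edge of [T] between two vertices of the subpolygon, so one has to
    exclude edges other than those of the strip; [gT] excludes [[p; q]] itself. *)
Lemma sub_edgesP k : k \in sub_edges T g ->
  [\/ k \in [:: kpa; kpb; kqa; kqb], exists2 j, (j <= D)%N & k = tau j |
      exists2 l, (l < D)%N & k = cc l].
Proof.
rewrite inE; have [u [v [_ Ek]]] := label_ends triT k; rewrite Ek => /subsetP sub.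
have uV : u \in sub_vertices T g by apply: sub; rewrite set21.
have vV : v \in sub_vertices T g by apply: sub; rewrite set22.
have Ek' : T k = [set v; u] by rewrite Ek setUC.
case: (sub_verticesP u) => /(_ uV) + _.
case: (sub_verticesP v) => /(_ vV) + _.
case=> [|[l lD hv]].
  by rewrite in_set2 => /orP[]/eqP E _; apply: Or31; subst v;
    [apply: p_edge Ek' uV | apply: q_edge Ek' uV].
case=> [|[j jD hu]].
  by rewrite in_set2 => /orP[]/eqP E; apply: Or31; subst u;
    [apply: p_edge Ek vV | apply: q_edge Ek vV].
case: hu hv => hu [] hv; subst u v.
- by apply: Or33; apply: (aa_edge jD lD).
- by apply: Or32; apply: (ab_edge jD lD).
- by apply: Or32; apply: (ab_edge lD jD).
- by apply: Or33; apply: (bb_edge jD lD).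
Qed.

Lemma no_vertex u v : ~~ cyc u p v -> ~~ cyc u q v ->
  (forall j, (j <= D)%N -> ~~ cyc u (a j) v /\ ~~ cyc u (b j) v) ->
  forall w, w \in sub_vertices T g -> ~~ cyc u w v.
Proof.
move=> hp hq h w /sub_verticesP[|[j /h[h1 h2] [->|->]]] //.
by rewrite in_set2 => /orP[]/eqP->.
Qed.

Lemma boundary_end k : k \in [:: kpa; kpb; kqa; kqb] -> k \in sub_boundary T g.
Proof.
move=> kP; rewrite inE end_sub //=; move: kP; rewrite !inE => /or4P[]/eqP->.
- rewrite (strip_kpa st); apply: in_side; rewrite ?p_sub ?a_sub //.
    by case: (a_neq (leq0n D)).
  apply: no_vertex => [||j jD]; try by move: (a_arc (leq0n D)); cyclia.
  case: (a_le (leq0n j) jD) => [/(congr1 val) h|h]; split;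
    by move: h (a_arc (leq0n D)) (b_arc jD); cyclia.
- rewrite (strip_kpb st) (setUC [set p] [set b 0%N]); apply: in_side; rewrite ?p_sub ?b_sub //.
    by case: (b_neq (leq0n D)).
  apply: no_vertex => [||j jD]; try by move: (b_arc (leq0n D)); cyclia.
  case: (b_le (leq0n j) jD) => [/(congr1 val) h|h]; split;
    by move: h (b_arc (leq0n D)) (a_arc jD); cyclia.
- rewrite (strip_kqa st) (setUC [set q] [set a D]); apply: in_side; rewrite ?q_sub ?a_sub //.
    by case: (a_neq (leqnn D)).
  apply: no_vertex => [||j jD]; try by move: (a_arc (leqnn D)); cyclia.
  case: (a_le jD (leqnn D)) => [/(congr1 val) h|h]; split;
    by move: h (a_arc (leqnn D)) (b_arc jD) (a_arc jD); cyclia.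
- rewrite (strip_kqb st); apply: in_side; rewrite ?q_sub ?b_sub //.
    by case: (b_neq (leqnn D)).
  apply: no_vertex => [||j jD]; try by move: (b_arc (leqnn D)); cyclia.
  case: (b_le jD (leqnn D)) => [/(congr1 val) h|h]; split;
    by move: h (b_arc (leqnn D)) (a_arc jD) (b_arc jD); cyclia.
Qed.

Lemma boundary_cc l : (l < D)%N -> cc l \in sub_boundary T g.
Proof.
move=> lD; rewrite inE cc_sub //=; have lD' := ltnW lD.
case sl: (s l).
  have [_ -> c] := step_a lD sl; apply: in_side; rewrite ?a_sub //.
    by move: c; cyclia.
  apply: no_vertex => [||j jD]; try by move: c (a_arc lD'); move: (a_arc lD); cyclia.
  split; last by move: c (a_arc lD) (a_arc lD') (b_arc jD); cyclia.
  case: (leqP j l) => jl.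
    by case: (a_le jl lD') => [/(congr1 val) h|h]; move: h c; cyclia.
  by case: (a_le jl jD) => [/(congr1 val) h|h]; move: h c; cyclia.
have [_ -> c] := step_b lD sl; rewrite (setUC [set b l]); apply: in_side; rewrite ?b_sub //.
  by move: c; cyclia.
apply: no_vertex => [||j jD]; try by move: c (b_arc lD'); move: (b_arc lD); cyclia.
split; first by move: c (b_arc lD) (b_arc lD') (a_arc jD); cyclia.
case: (leqP j l) => jl.
  by case: (b_le jl lD') => [/(congr1 val) h|h]; move: h c; cyclia.
by case: (b_le jl jD) => [/(congr1 val) h|h]; move: h c; cyclia.
Qed.

(** [p] and [q] lie strictly on the two sides of a crossed diagonal. *)
Lemma boundary_tau j : (j <= D)%N -> tau j \notin sub_boundary T g.
Proof.
move=> jD; rewrite inE tau_sub //=; apply/negP; rewrite tau_ends //.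
case/side_ends=> u [v [_ _ _ E h]]; move: (h p p_sub) (h q q_sub) (a_arc jD) (b_arc jD).
by case: (set2_eq E) => [[<- <-]|[<- <-]]; cyclia.
Qed.

Lemma sub_boundaryP k : k \in sub_boundary T g <->
  (k \in [:: kpa; kpb; kqa; kqb]) \/ exists2 l, (l < D)%N & k = cc l.
Proof.
split=> [kb|[/boundary_end //|[l lD ->]]]; last exact: boundary_cc.
have : k \in sub_edges T g by move: kb; rewrite inE => /andP[].
case/sub_edgesP=> [h|[j jD E]|h]; [by left | | by right].
by have := boundary_tau jD; rewrite -E kb.
Qed.

Lemma boundary_disjoint k : k \in sub_boundary T g -> [disjoint T k & g] ->
  exists2 l, (l < D)%N & k = cc l.
Proof.
case/sub_boundaryP=> // /end_vertex[u [v [E ug _]]].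
by rewrite disjoint_subset E => /subsetP/(_ u (set21 u v)); rewrite inE ug.
Qed.

Lemma cc_disjoint l : (l < D)%N -> [disjoint T (cc l) & g].
Proof.
by move=> lD; rewrite disjoint_subset; apply/subsetP=> w wc; rewrite inE; apply: cc_g wc.
Qed.

(* The triangles adjacent to tau j have third vertices prev_v j, on the side of p,
   and next_v j, on the side of q. *)
Definition prev_v j := if j is l.+1 then if s l then a l else b l else p.
Definition next_v j := if j == D then q else if s j then a j.+1 else b j.+1.
Definition prev_a j := if j is l.+1 then if s l then cc l else tau l else kpa.
Definition prev_b j := if j is l.+1 then if s l then tau l else cc l else kpb.
Definition next_a j := if j == D then kqa else if s j then cc j else tau j.+1.
Definition next_b j := if j == D then kqb else if s j then tau j.+1 else cc j.

Lemma prev_triangle j : (j <= D)%N ->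
  [/\ T (prev_a j) = [set a j; prev_v j], T (prev_b j) = [set b j; prev_v j] &
      cyc (b j) (prev_v j) (a j)].
Proof.
case: j => [|l] lD /=.
  rewrite (strip_kpa st) (strip_kpb st); split; first exact: setUC; first exact: setUC.
  by move: (a_arc lD) (b_arc lD); cyclia.
case sl: (s l).
  have [E1 E2 c] := step_a lD sl; rewrite E2 (tau_ends (ltnW lD)) -E1; split; rewrite 1?setUC //.
  by move: c (a_arc lD) (b_arc lD); cyclia.
have [E1 E2 c] := step_b lD sl; rewrite E2 (tau_ends (ltnW lD)) -E1; split; rewrite // 1?setUC //.
by move: c (a_arc lD) (b_arc lD) (b_arc (ltnW lD)); cyclia.
Qed.

Lemma next_triangle j : (j <= D)%N ->
  [/\ T (next_a j) = [set a j; next_v j], T (next_b j) = [set b j; next_v j] &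
      cyc (a j) (next_v j) (b j)].
Proof.
move=> jD; rewrite /next_a /next_b /next_v; have [->|jD'] := eqVneq j D.
  rewrite (strip_kqa st) (strip_kqb st); split; first exact: setUC; first exact: setUC.
  by move: (a_arc (leqnn D)) (b_arc (leqnn D)); cyclia.
have {jD'} lD : (j < D)%N by rewrite ltn_neqAle jD' jD.
case sl: (s j).
  have [E1 E2 c] := step_a lD sl; rewrite E2 (tau_ends lD) E1; split; rewrite // 1?setUC //.
  by move: c (a_arc lD) (b_arc jD); cyclia.
have [E1 E2 c] := step_b lD sl; rewrite E2 (tau_ends lD) E1; split; rewrite // 1?setUC //.
by move: c (a_arc jD) (b_arc lD) (b_arc jD); cyclia.
Qed.

(** [opposite_sides] fixes neither the direction of the diagonal nor which apex comes first, whence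
    four labellings of one quadrilateral. *)
Lemma opposite_tauP j k1 k2 k3 k4 : (j <= D)%N ->
  opposite_sides T (tau j) k1 k2 k3 k4 <->
  [\/ [/\ k1 = prev_a j, k2 = next_b j, k3 = prev_b j & k4 = next_a j],
      [/\ k1 = next_b j, k2 = prev_a j, k3 = next_a j & k4 = prev_b j],
      [/\ k1 = prev_b j, k2 = next_a j, k3 = prev_a j & k4 = next_b j] |
      [/\ k1 = next_a j, k2 = prev_b j, k3 = next_b j & k4 = prev_a j]].
Proof.
move=> jD; have [Ea Eb c1] := prev_triangle jD; have [Ea' Eb' c2] := next_triangle jD.
have Et := tau_ends jD; have yw : prev_v j != next_v j by move: c1 c2; cyclia.
have [ay by_ aw bw] : [/\ adj T (a j) (prev_v j), adj T (b j) (prev_v j),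
    adj T (a j) (next_v j) & adj T (b j) (next_v j)].
  by split; [apply: adj_label Ea|apply: adj_label Eb|apply: adj_label Ea'|apply: adj_label Eb'].
have ab := adj_label Et.
split; last first.
  have tr u v w : adj T u v -> adj T v w -> adj T u w -> triangle T u v w.
    by move=> h1 h2 h3; apply/and3P.
  have ba : adj T (b j) (a j) by rewrite adjC.
  case=> -[-> -> -> ->].
  - by exists (a j), (b j), (prev_v j), (next_v j); split; split; auto.
  - exists (b j), (a j), (next_v j), (prev_v j); split; split; auto.
      by rewrite Et setUC.
    by rewrite eq_sym.
  - exists (b j), (a j), (prev_v j), (next_v j); split; split; auto.
    by rewrite Et setUC.
  - exists (a j), (b j), (next_v j), (prev_v j); split; split; auto.
    by rewrite eq_sym.
case=> p' [q' [r' [s' [[Et' rs /and3P[_ qr pr] /and3P[_ qs ps]] [E1 E2 E3 E4]]]]].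
have third v : adj T (a j) v -> adj T (b j) v -> v = prev_v j \/ v = next_v j.
  move=> av bv; have /orP[h|h] : cyc (a j) v (b j) || cyc (b j) v (a j).
  + by apply: cyc_total; [apply: (adj_neq triT) | rewrite eq_sym; apply: (adj_neq triT) |
      apply: (adj_neq triT)].
  + by right; apply: (third_unique triT h c2) => //; rewrite adjC.
  + by left; apply: (third_unique triT h c1) => //; rewrite adjC.
have inj k k' : T k = T k' -> k = k' by apply: (tri_inj triT).
case: (set2_eq (etrans (esym Et') Et)) => [[? ?]|[? ?]]; subst p' q'.
- have [hr|hr] := third r' pr qr; have [hs|hs] := third s' ps qs; subst r' s';
    rewrite ?eqxx // in rs.
  + by apply: Or41; split; apply: inj; congruence.
  + by apply: Or44; split; apply: inj; congruence.
- have [hr|hr] := third r' qr pr; have [hs|hs] := third s' qs ps; subst r' s';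
    rewrite ?eqxx // in rs.
  + by apply: Or43; split; apply: inj; congruence.
  + by apply: Or42; split; apply: inj; congruence.
Qed.

End StripCombinatorics.

(** * The linear equations of the affine hull *)

Lemma solution_space (R : realFieldType) m (K : finType) (c : K -> 'rV[R]_m) :
  exists U : {vspace 'rV[R]_m}, forall x, x \in U <-> forall k, dot (c k) x = 0.
Proof.
pose C : 'M[R]_(m, #|K|) := \matrix_(i, j) c (enum_val j) 0 i.
have CE x j : (x *m C) 0 j = dot (c (enum_val j)) x.
  by rewrite !mxE; apply: eq_bigr => l _; rewrite mxE mulrC.
exists (lker (linfun (mulmxr C))) => x; rewrite memv_ker lfunE /=.
split=> [/eqP h k|h]; last by apply/eqP/rowP=> j; rewrite CE h mxE.
by rewrite -(enum_rankK k) -CE h mxE.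
Qed.

Lemma dot_deltar (R : realFieldType) m (c : 'rV[R]_m) k : dot c (delta_mx 0 k) = c 0 k.
Proof.
rewrite /dot (bigD1 k) //= mxE !eqxx mulr1 big1 ?addr0 // => l lk.
by rewrite mxE eqxx (negbTE lk) mulr0.
Qed.

Section StripEquations.
Variables (R : realFieldType) (n : nat) (T : edges n) (p q : 'I_(n + 3)) (D : nat).
Variables (tau cc : nat -> 'I_(2 * n + 3)) (a b : nat -> 'I_(n + 3)) (s : nat -> bool).
Variables (kpa kpb kqa kqb : 'I_(2 * n + 3)).
Hypotheses (triT : triangulation T) (gT : forall k, T k <> [set p; q]).
Hypothesis st : strip T p q D tau cc a b s kpa kpb kqa kqb.

Local Notation g := [set p; q].
Local Notation Phi := (strip_vec (R := R) D s tau cc kpa kpb kqa kqb).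

Definition star (w : 'I_(n + 3)) : 'rV[R]_(2 * n + 3) :=
  \row_e ((e \in sub_edges T g) && (w \in T e))%:R.

Lemma dot_star w x : dot (star w) x = \sum_(e in sub_edges T g | w \in T e) x 0 e.
Proof.
rewrite /dot [RHS]big_mkcond; apply: eq_bigr => e _; rewrite mxE.
by case: ifP => _; rewrite ?mul1r ?mul0r.
Qed.

Lemma star_delta w k u v : k \in sub_edges T g -> T k = [set u; v] ->
  dot (star w) (delta_mx 0 k) = (w == u)%:R + (w == v)%:R.
Proof.
move=> kS Ek; have uv := adj_neq triT (adj_label Ek).
rewrite dot_deltar mxE kS Ek in_set2 /=.
by have [->|] := eqVneq w u; rewrite ?(negbTE uv) ?addr0 ?add0r.
Qed.

(** Homogeneity: counting incident edges, each term of the length from [p] to [v] has degree 1 at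
    [p] and at [v] and 0 elsewhere. In each step the ends of the old diagonal cancel against those
    of the third side and of the new diagonal. *)
Lemma star_partial w z j : (j <= D)%N ->
  dot (star w) (partial_vec s tau cc kpa kpb z j) =
  (w == p)%:R + (1 - z j) * (w == a j)%:R + z j * (w == b j)%:R.
Proof.
elim: j => [|j IHj] jD.
  rewrite /partial_vec big_ord0 addr0 dotD !dotZ.
  rewrite (star_delta w (end_sub st _) (strip_kpa st)) ?inE ?eqxx //.
  by rewrite (star_delta w (end_sub st _) (strip_kpb st)) ?inE ?eqxx ?orbT //; ring.
have -> : partial_vec s tau cc kpa kpb z j.+1 =
    partial_vec s tau cc kpa kpb z j + fence_vec s tau cc z j.
  by rewrite /partial_vec big_ord_recr addrA.
rewrite dotD (IHj (ltnW jD)) /fence_vec dotB dotD !dotZ.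
rewrite (star_delta w (tau_sub st jD) (tau_ends st jD)).
rewrite (star_delta w (tau_sub st (ltnW jD)) (tau_ends st (ltnW jD))).
rewrite /fence_step /fence_up /fence_dn; case sj: (s j).
  have [-> Ec _] := step_a st jD sj; rewrite (star_delta w (cc_sub st jD) Ec); ring.
have [-> Ec _] := step_b st jD sj; rewrite (star_delta w (cc_sub st jD) Ec); ring.
Qed.

Lemma star_strip w z : dot (star w) (Phi z) = (w == p)%:R + (w == q)%:R.
Proof.
rewrite /strip_vec dotB 2!dotD star_partial // !dotZ.
rewrite (star_delta w (end_sub st _) (strip_kqa st)) ?inE ?eqxx ?orbT //.
rewrite (star_delta w (end_sub st _) (strip_kqb st)) ?inE ?eqxx ?orbT //.
by rewrite (star_delta w (tau_sub st (leqnn D)) (tau_ends st (leqnn D))); ring.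
Qed.

Lemma strip_equations z : sub_equations T g (Phi z).
Proof.
split=> [e eS|w _]; last first.
  rewrite -dot_star star_strip in_set2; have /negbTE pq := pq_neq st.
  have [->|_] /= := eqVneq w p; first by rewrite pq addr0.
  by rewrite add0r; case: eqP.
apply: strip_vec_out => [j jD|l lD|]; first by apply: contraNneq eS => ->; apply: tau_sub st _ jD.
  by apply: contraNneq eS => ->; apply: cc_sub st _ lD.
by apply: contra eS; apply: (end_sub st).
Qed.

Lemma sub_equations_space : exists x0 (U : {vspace 'rV[R]_(2 * n + 3)}),
  forall x, sub_equations T g x <-> x - x0 \in U.
Proof.
pose c (k : 'I_(2 * n + 3) + 'I_(n + 3)) : 'rV[R]_(2 * n + 3) :=
  match k with
  | inl e => if e \in sub_edges T g then 0 else delta_mx 0 e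
  | inr w => if w \in sub_vertices T g then star w else 0
  end.
(* Every [z] gives a solution; the zero sequence serves as base point. *)
have [U hU] := solution_space c; pose x0 := Phi (fun=> 0).
have [h1 h2] := strip_equations (fun=> 0); rewrite -/x0 in h1 h2.
have dot0 (y : 'rV[R]_(2 * n + 3)) : dot 0 y = 0.
  by rewrite /dot big1 // => j _; rewrite mxE mul0r.
exists x0, U => x; rewrite hU; split=> [[e1 e2] [e|w]|h] /=.
- case: ifP => [_|/negbT eS]; first exact: dot0.
  by rewrite dotB !dot_delta e1 ?h1 ?subrr.
- case: ifP => [wS|_]; last exact: dot0.
  by rewrite dotB !dot_star e2 ?h2 ?subrr.
- split=> [e eS|w wS].
    by have := h (inl e); rewrite /= (negbTE eS) dotB !dot_delta h1 // subr0.
  have := h (inr w); rewrite /= wS dotB !dot_star h2 // => /eqP.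
  by rewrite subr_eq0 => /eqP.
Qed.

Lemma star_sum1 w k (u : 'rV[R]_(2 * n + 3)) : k \in sub_edges T g -> w \in T k ->
  (forall e, e \in sub_edges T g -> w \in T e -> e != k -> u 0 e = 0) ->
  dot (star w) u = u 0 k.
Proof.
move=> kS wk h; rewrite dot_star (bigD1 k) ?kS ?wk //= big1 ?addr0 //.
by move=> e /andP[/andP[eS we] ek]; apply: h.
Qed.

Lemma star_sum2 w k k' (u : 'rV[R]_(2 * n + 3)) : k \in sub_edges T g -> w \in T k ->
  k' \in sub_edges T g -> w \in T k' -> k' != k ->
  (forall e, e \in sub_edges T g -> w \in T e -> e != k -> e != k' -> u 0 e = 0) ->
  dot (star w) u = u 0 k + u 0 k'.
Proof.
move=> kS wk kS' wk' kk h; rewrite dot_star (bigD1 k) ?kS ?wk //=; congr (_ + _).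
rewrite (bigD1 k') ?kS' ?wk' ?kk //= big1 ?addr0 //.
by move=> e /andP[/andP[/andP[eS we] ek] ek']; apply: h.
Qed.

(* The equation at a j if s j, at b j otherwise, determines the coordinate of tau j
   from the previous ones; the equations at a D, b D and q determine the last
   three coordinates. *)
Lemma sub_equations_inj (x y : 'rV[R]_(2 * n + 3)) :
  sub_equations T g x -> sub_equations T g y -> x 0 kpb = y 0 kpb ->
  (forall l, (l < D)%N -> x 0 (cc l) = y 0 (cc l)) -> x = y.
Proof.
move=> [x1 x2] [y1 y2] Epb Ecc; pose u := x - y.
have uE e : u 0 e = x 0 e - y 0 e by rewrite !mxE.
have u_star w : w \in sub_vertices T g -> dot (star w) u = 0.
  by move=> wS; rewrite /u dotB !dot_star x2 ?y2 ?subrr.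
have u_cc l : (l < D)%N -> u 0 (cc l) = 0 by move=> lD; rewrite uE Ecc // subrr.
have u_kpb : u 0 kpb = 0 by rewrite uE Epb subrr.
have endS k : k \in [:: kpa; kpb; kqa; kqb] -> k \in sub_edges T g by apply: (end_sub st).
have [pg qg] : p \in g /\ q \in g by rewrite set21 set22.
have pq := pq_neq st.
have notk w : w \notin g -> w != p /\ w != q by rewrite !inE negb_or => /andP[].
have u_kpa : u 0 kpa = 0.
  rewrite -(@star_sum1 p kpa u) ?u_star ?(p_sub st) ?endS ?inE ?eqxx //.
    by rewrite (strip_kpa st) set21.
  move=> e eS pe ne; case: (sub_edgesP triT gT st eS) => [|[j jD E]|[l lD E]].
  - rewrite !inE (negbTE ne) /= => /or3P[]/eqP E; subst e => //.
      move: pe; rewrite (strip_kqa st) in_set2 (negbTE pq) /= => /eqP E.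
      by have := a_g st (leqnn D); rewrite -E pg.
    move: pe; rewrite (strip_kqb st) in_set2 (negbTE pq) /= => /eqP E.
    by have := b_g st (leqnn D); rewrite -E pg.
  - by subst e; have := tau_g st jD pe; rewrite pg.
  - by rewrite E u_cc.
have u_tau j : (j < D)%N -> u 0 (tau j) = 0.
  have [m] := ubnP j; elim: m j => // m IHm j; rewrite ltnS => jm jD.
  have jD' := ltnW jD.
  have IH l : (l < j)%N -> u 0 (tau l) = 0.
    by move=> lj; apply: IHm; [apply: leq_trans lj jm | apply: ltn_trans lj jD].
  case sj: (s j).
    have [_ _ c] := step_a st jD sj.
    have aD l : (j < l)%N -> (l <= D)%N -> a j != a l.
      move=> jl lD; case: (a_le st jl lD) => [->|c']; first by move: c; cyclia.
      by move: c c'; cyclia.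
    rewrite -(@star_sum1 (a j) (tau j) u) ?u_star ?(a_sub st) ?(tau_sub st) //.
      by rewrite (tau_ends st) // set21.
    have [np nq] := notk _ (a_g st jD').
    move=> e eS we ne; case: (sub_edgesP triT gT st eS) => [|[l lD E]|[l lD E]].
    - rewrite !inE => /or4P[]/eqP E; subst e => //.
        by move: we; rewrite (strip_kqa st) in_set2 (negbTE nq) (negbTE (aD D jD (leqnn D))).
      by move: we; rewrite (strip_kqb st) in_set2 (negbTE nq) (negbTE (ab_neq st jD' (leqnn D))).
    - subst e; move: we; rewrite (tau_ends st) // in_set2 (negbTE (ab_neq st jD' lD)) orbF.
      case: (ltngtP l j) => [/IH ->//|jl|lj]; last by move: ne; rewrite lj eqxx.
      by rewrite (negbTE (aD l jl lD)).
    - by rewrite E u_cc.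
  have [_ _ c] := step_b st jD sj.
  have bD l : (j < l)%N -> (l <= D)%N -> b j != b l.
    move=> jl lD; case: (b_le st jl lD) => [->|c']; first by move: c; cyclia.
    by move: c c'; cyclia.
  rewrite -(@star_sum1 (b j) (tau j) u) ?u_star ?(b_sub st) ?(tau_sub st) //.
    by rewrite (tau_ends st) // set22.
  have [np nq] := notk _ (b_g st jD').
  move=> e eS we ne; case: (sub_edgesP triT gT st eS) => [|[l lD E]|[l lD E]].
  - rewrite !inE => /or4P[]/eqP E; subst e => //.
      move: we; rewrite (strip_kqa st) in_set2 (negbTE nq) eq_sym.
      by rewrite (negbTE (ab_neq st (leqnn D) jD')).
    by move: we; rewrite (strip_kqb st) in_set2 (negbTE nq) (negbTE (bD D jD (leqnn D))).
  - subst e; move: we; rewrite (tau_ends st) // in_set2 eq_sym (negbTE (ab_neq st lD jD')) /=.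
    case: (ltngtP l j) => [/IH ->//|jl|lj]; last by move: ne; rewrite lj eqxx.
    by rewrite (negbTE (bD l jl lD)).
  - by rewrite E u_cc.
have DD := leqnn D.
have [kqaP kqbP] : kqa \in [:: kpa; kpb; kqa; kqb] /\ kqb \in [:: kpa; kpb; kqa; kqb].
  by rewrite !inE !eqxx !orbT.
have k_tau := strip_k_tau st; have kuniq := strip_k_uniq st.
have nkab : kqb != kqa.
  by rewrite eq_sym; move: kuniq; rewrite /= !inE !negb_or => /and4P[_ _ -> _].
have [npa nqa] := notk _ (a_g st DD); have [npb nqb] := notk _ (b_g st DD).
have abD := ab_neq st DD DD.
have rest e w : e \in sub_edges T g -> w \in T e -> e != tau D -> e != kqa -> e != kqb -> u 0 e = 0.
  move=> eS we n1 n2 n3; case: (sub_edgesP triT gT st eS) => [|[l lD E]|[l lD E]].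
  - by rewrite !inE (negbTE n2) (negbTE n3) /= !orbF => /orP[]/eqP ->.
  - subst e; apply: u_tau; rewrite ltn_neqAle lD andbT.
    by apply: contra n1 => /eqP ->.
  - by rewrite E u_cc.
have Ea : u 0 (tau D) + u 0 kqa = 0.
  rewrite -(@star_sum2 (a D) (tau D) kqa u) ?u_star ?(a_sub st) ?(tau_sub st) ?endS //.
  - by rewrite (tau_ends st) // set21.
  - by rewrite (strip_kqa st) set22.
  - exact: k_tau.
  - move=> e eS we n1 n2; apply: (rest e (a D)) => //.
    by apply: contraTneq we => ->; rewrite (strip_kqb st) in_set2 negb_or nqa abD.
have Eb : u 0 (tau D) + u 0 kqb = 0.
  rewrite -(@star_sum2 (b D) (tau D) kqb u) ?u_star ?(b_sub st) ?(tau_sub st) ?endS //.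
  - by rewrite (tau_ends st) // set22.
  - by rewrite (strip_kqb st) set22.
  - exact: k_tau.
  - move=> e eS we n1 n2; apply: (rest e (b D)) => //.
    by apply: contraTneq we => ->; rewrite (strip_kqa st) in_set2 negb_or nqb eq_sym abD.
have Eq : u 0 kqa + u 0 kqb = 0.
  rewrite -(@star_sum2 q kqa kqb u) ?u_star ?(q_sub st) ?endS //.
  - by rewrite (strip_kqa st) set21.
  - by rewrite (strip_kqb st) set21.
  - move=> e eS we n1 n2; apply: (rest e q) => //.
    by apply: contraTneq we => ->; apply: (contraTN _ qg) => h; apply: (tau_g st DD h).
apply/rowP=> e; apply/eqP; rewrite -subr_eq0 -uE; apply/eqP.
have [eS|eS] := boolP (e \in sub_edges T g); last by rewrite uE x1 ?y1 ?subrr.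
(* [Ea], [Eb] and [Eq] say that the pairwise sums of the last three coordinates vanish; all three
   are then zero because 2 is invertible. *)
case: (sub_edgesP triT gT st eS) => [|[l lD E]|[l lD E]].
- by rewrite !inE => /or4P[]/eqP -> //; lra.
- subst e; move: lD; rewrite leq_eqVlt => /orP[/eqP->|/u_tau //]; lra.
- by rewrite E u_cc.
Qed.

End StripEquations.

(** * Balanced diagonals *)

Section StripInequalities.
Variables (R : realFieldType) (n : nat) (T : edges n) (p q : 'I_(n + 3)) (D : nat).
Variables (tau cc : nat -> 'I_(2 * n + 3)) (a b : nat -> 'I_(n + 3)) (s : nat -> bool).
Variables (kpa kpb kqa kqb : 'I_(2 * n + 3)) (i : 'I_D.+1 -> 'I_(2 * n + 3)).
Hypotheses (triT : triangulation T) (gT : forall k, T k <> [set p; q]).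
Hypothesis st : strip T p q D tau cc a b s kpa kpb kqa kqb.
Hypothesis tau_i : forall j : 'I_D.+1, tau j = i j.

Local Notation g := [set p; q].
Local Notation Phi := (strip_vec (R := R) D s tau cc kpa kpb kqa kqb).

(* The pair of boundary sides (side1, side2) and the other pair (other1, other2) of
   the quadrilateral of tau j, for a local minimum (m = true) or maximum j of the
   fence. *)
Definition extremal (m : bool) j := if m then fence_min D s j else fence_max D s j.
Definition side1 (m : bool) j := if m then prev_a tau cc s kpa j else prev_b tau cc s kpb j.
Definition side2 (m : bool) j := if m then next_b D tau cc s kqb j else next_a D tau cc s kqa j.
Definition other1 (m : bool) j := if m then prev_b tau cc s kpb j else prev_a tau cc s kpa j.
Definition other2 (m : bool) j := if m then next_a D tau cc s kqa j else next_b D tau cc s kqb j.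
Definition bound (m : bool) (z : nat -> R) j := if m then z j else 1 - z j.

Lemma end_bd k : k \in [:: kpa; kpb; kqa; kqb] -> k \in sub_boundary T g.
Proof. exact: (boundary_end st). Qed.

Lemma tau_nbd j : (j <= D)%N -> (tau j \in sub_boundary T g) = false.
Proof. by move=> jD; apply/negbTE/(boundary_tau st). Qed.

Lemma prev_bd j : (j <= D)%N ->
  (prev_a tau cc s kpa j \in sub_boundary T g) = ((j == 0%N) || s j.-1) /\
  (prev_b tau cc s kpb j \in sub_boundary T g) = ((j == 0%N) || ~~ s j.-1).
Proof.
case: j => [|j] jD /=; first by rewrite !end_bd // !inE eqxx ?orbT.
by case: (s j); rewrite (boundary_cc st jD) (tau_nbd (ltnW jD)).
Qed.

Lemma next_bd j : (j <= D)%N ->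
  (next_a D tau cc s kqa j \in sub_boundary T g) = ((j == D) || s j) /\
  (next_b D tau cc s kqb j \in sub_boundary T g) = ((j == D) || ~~ s j).
Proof.
move=> jD; rewrite /next_a /next_b; have [_|jD'] := eqVneq j D.
  by rewrite !end_bd // !inE eqxx !orbT.
have {jD'}jD : (j < D)%N by rewrite ltn_neqAle jD' jD.
by case: (s j); rewrite (boundary_cc st jD) (tau_nbd jD).
Qed.

(** Why balanced means extremal: on the side of a neighbour in the fence, the triangle has one
    crossed diagonal and one boundary segment, and the direction of the covering relation decides
    which end of [tau j] has which. Beyond the first or last diagonal both sides are boundary. *)
Lemma side_bd m j : (j <= D)%N ->
  (side1 m j \in sub_boundary T g) && (side2 m j \in sub_boundary T g) = extremal m j.
Proof.
move=> jD; have [h1 h2] := prev_bd jD; have [h3 h4] := next_bd jD.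
by case: m; rewrite /side1 /side2 /extremal /fence_min /fence_max ?h1 ?h2 ?h3 ?h4.
Qed.

(** The second alternative is the same quadrilateral read from the other end, which exchanges the
    members of both pairs at once. *)
Lemma balanced_configP k k1 k2 k3 k4 : balanced_config T g k k1 k2 k3 k4 <->
  exists j m, [/\ (j <= D)%N, extremal m j, k = tau j &
    [/\ k1 = side1 m j, k2 = side2 m j, k3 = other1 m j & k4 = other2 m j] \/
    [/\ k1 = side2 m j, k2 = side1 m j, k3 = other2 m j & k4 = other1 m j]].
Proof.
split.
  case=> -[kc _] op b1 b2; have [j jD E] := (strip_crossed st k).1 kc; subst k.
  exists j; case: ((opposite_tauP triT st k1 k2 k3 k4 jD).1 op) => -[E1 E2 E3 E4].
  - by exists true; split => //; [rewrite -side_bd // /side1 /side2 -E1 -E2 b1 b2 | left].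
  - by exists true; split => //; [rewrite -side_bd // /side1 /side2 -E1 -E2 b1 b2 | right].
  - by exists false; split => //; [rewrite -side_bd // /side1 /side2 -E1 -E2 b1 b2 | left].
  - by exists false; split => //; [rewrite -side_bd // /side1 /side2 -E1 -E2 b1 b2 | right].
case=> j [m [jD ext -> h]].
have op : opposite_sides T (tau j) k1 k2 k3 k4.
  apply/(opposite_tauP triT st) => //.
  by case: m h {ext} => -[]; [apply: Or41 | apply: Or42 | apply: Or43 | apply: Or44].
move: ext; rewrite -side_bd // => /andP[b1 b2].
have [b1' b2'] : k1 \in sub_boundary T g /\ k2 \in sub_boundary T g.
  by case: h => -[-> ->].
split => //; split; first by apply/(strip_crossed st); exists j.
by exists k1, k2, k3, k4.
Qed.

Lemma other1_0 m : other1 m 0 \in sub_boundary T g /\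
  forall z, Phi z 0 (other1 m 0) = bound m z 0%N.
Proof.
split; first by case: m; apply: end_bd; rewrite !inE eqxx ?orbT.
by move=> z; case: m; rewrite /= ?(strip_vec_kpb _ (strip_k_tau st) (strip_k_cc st) (strip_k_uniq st))
  ?(strip_vec_kpa _ (strip_k_tau st) (strip_k_cc st) (strip_k_uniq st)).
Qed.

Lemma other2_D m : other2 m D \in sub_boundary T g /\
  forall z, Phi z 0 (other2 m D) = bound m z D.
Proof.
rewrite /other2 /next_a /next_b eqxx.
split; first by case: m; apply: end_bd; rewrite !inE eqxx ?orbT.
by move=> z; case: m; rewrite /= ?(strip_vec_kqa _ (strip_k_tau st) (strip_k_cc st) (strip_k_uniq st))
  ?(strip_vec_kqb _ (strip_k_tau st) (strip_k_cc st) (strip_k_uniq st)).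
Qed.

Lemma extremal_prev m j : (j < D)%N -> extremal m j.+1 ->
  [/\ s j = m, other1 m j.+1 = tau j & side1 m j.+1 = cc j].
Proof.
rewrite /extremal /fence_min /fence_max /other1 /side1 /=.
by case: m => _ /andP[]; case: (s j).
Qed.

Lemma extremal_next m j : (j < D)%N -> extremal m j ->
  [/\ s j = ~~ m, other2 m j = tau j.+1 & side2 m j = cc j].
Proof.
rewrite /extremal /fence_min /fence_max /other2 /side2 /next_a /next_b.
by case: m => jD; rewrite (ltn_eqF jD) => /andP[_]; case: (s j).
Qed.

Lemma Phi_cc z l : (l < D)%N -> Phi z 0 (cc l) = fence_step s z l.
Proof. exact: (strip_vec_cc _ (strip_cc_inj st) (strip_tau_cc st) (strip_k_cc st)). Qed.

Lemma Phi_tau z j : (j <= D)%N -> Phi z 0 (tau j) =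
  (if (0 < j)%N then fence_up s z j.-1 else 0) - (if (j < D)%N then fence_dn s z j else 1).
Proof. exact: (strip_vec_tau _ (strip_tau_inj st) (strip_tau_cc st) (strip_k_tau st)). Qed.

(** For a minimum, the diagonal has coordinate [1 - z j - z j.+2] and the two sides have
    [z j - z j.+1] and [z j.+2 - z j.+1]: the neighbours cancel and the middle value counts twice. A
    maximum is the same with [1 - z]. *)
Lemma inner_slack m j z : (j.+1 < D)%N -> extremal m j.+1 ->
  1 - (Phi z 0 (tau j.+1) + Phi z 0 (side1 m j.+1) + Phi z 0 (side2 m j.+1)) =
  2 * bound m z j.+1.
Proof.
move=> jD ext; have [s1 _ ->] := extremal_prev (ltnW jD) ext.
have [s2 _ ->] := extremal_next jD ext.
rewrite Phi_tau ?(ltnW jD) // jD !Phi_cc ?(ltnW jD) //= /fence_up /fence_dn /fence_step s1 s2.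
by rewrite /bound; case: m {ext s1 s2} => /=; ring.
Qed.

(** Origin of the bound -1: no step precedes the first diagonal, so only its exponent as a
    denominator is left. *)
Lemma first_slack m z : (0 < D)%N -> extremal m 1 -> Phi z 0 (tau 0) + 1 = bound m z 1.
Proof.
move=> D0 ext; have [s1 _ _] := extremal_prev D0 ext.
by rewrite Phi_tau // D0 /= /fence_dn s1 /bound; case: m {ext s1}; ring.
Qed.

(** Here -1 comes from the final exchange, which divides every term by [tau D]. *)
Lemma last_slack m j z : j.+1 = D -> extremal m j -> Phi z 0 (tau D) + 1 = bound m z j.
Proof.
move=> E ext; have jD : (j < D)%N by rewrite -E.
have [s1 _ _] := extremal_next jD ext.
by rewrite Phi_tau // ltnn -E /= /fence_up s1 /bound; case: m {ext s1} => /=; ring.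
Qed.

Lemma inner_tau l : (l <= D)%N -> inner_crossed i (tau l) <-> (0 < l)%N /\ (l < D)%N.
Proof.
move=> lD; split=> [[j [j0 jD]]|[l0 l1]].
  have jD' : (j <= D)%N by rewrite -ltnS.
  by rewrite -tau_i => /(strip_tau_inj st lD jD') ->.
exists (Ordinal (lD : (l < D.+1)%N)); split => //.
by rewrite -tau_i.
Qed.

Lemma outer_tau l : (l <= D)%N -> outer_crossed i (tau l) <-> l = 0%N \/ l = D.
Proof.
move=> lD; split=> [[j [h]]|h].
  have jD' : (j <= D)%N by rewrite -ltnS.
  rewrite -tau_i => /(strip_tau_inj st lD jD') ->.
  by case: h => [->|[->]]; auto.
exists (Ordinal (lD : (l < D.+1)%N)); split; last by rewrite -tau_i.
by rewrite /=; case: h => E; [left | right; rewrite E].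
Qed.

Lemma boundary_not_crossed k (j : 'I_D.+1) : k \in sub_boundary T g -> k <> i j.
Proof. by move=> kb E; move: kb; rewrite E -tau_i tau_nbd // -ltnS. Qed.

Lemma case_boundaryC e f : case_boundary T g e f <-> case_boundary T g f e.
Proof. by rewrite /case_boundary; tauto. Qed.

Lemma case_boundaryE m j : (j <= D)%N -> extremal m j ->
  case_boundary T g (other1 m j) (other2 m j) <-> j = 0%N \/ j = D.
Proof.
move=> jD ext; split; last first.
  case=> ->; first by left; case: (other1_0 m).
  by right; case: (other2_D m).
case: j jD ext => [|j] jD ext; first by left.
have [_ E _] := extremal_prev jD ext; rewrite /case_boundary E tau_nbd ?(ltnW jD) //.
case: (ltngtP j.+1 D) jD => // [jD' _|->]; last by right.
have [_ -> _] := extremal_next jD' ext; rewrite tau_nbd //; by case.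
Qed.

(** Away from the ends of the fence, the other sides are the neighbouring diagonals [tau j.-1] and
    [tau j.+1], so the bounds on [j] are one tighter than those defining an inner diagonal. *)
Lemma case_innerE m j : (j <= D)%N -> extremal m j ->
  case_inner i (other1 m j) (other2 m j) <-> (1 < j)%N /\ (j.+1 < D)%N.
Proof.
move=> jD ext; rewrite /case_inner.
case: j jD ext => [|j] jD ext.
  split=> [[[j' [_ _ E]] _]|[]] //.
  by have [/boundary_not_crossed/(_ E)] := other1_0 m.
have [_ -> _] := extremal_prev jD ext; rewrite inner_tau ?(ltnW jD) //.
case: (ltngtP j.+1 D) jD => // [jD' _|E _].
  have [_ -> _] := extremal_next jD' ext; rewrite inner_tau //.
  by split=> [[[h1 h2] [h3 h4]]|[h1 h2]]; split => //; split => //; apply: ltnW.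
split=> [[_ [j' [_ _ E']]]|[_]]; last by rewrite E ltnNge leqnSn.
by rewrite E in E'; have [/boundary_not_crossed/(_ E')] := other2_D m.
Qed.

Lemma outer1E m j : (j < D)%N -> extremal m j.+1 ->
  outer_crossed i (other1 m j.+1) <-> j = 0%N.
Proof.
move=> jD ext; have [_ -> _] := extremal_prev jD ext; rewrite outer_tau ?(ltnW jD) //.
by split=> [[//|E]|->]; [move: jD; rewrite E ltnn | left].
Qed.

Lemma outer2E m j : (j < D)%N -> extremal m j ->
  outer_crossed i (other2 m j) <-> j.+1 = D.
Proof.
move=> jD ext; have [_ -> _] := extremal_next jD ext; rewrite outer_tau //.
by split=> [[//|E]|->]; [ | right].
Qed.

Lemma exactly_one_case m j : (j <= D)%N -> extremal m j ->
  exactly_one (case_inner i (other1 m j) (other2 m j))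
    (case_boundary T g (other1 m j) (other2 m j))
    (case_outer T g i (other1 m j) (other2 m j)).
Proof.
move=> jD ext; have hb := case_boundaryE jD ext; have hi := case_innerE jD ext.
have [h|h] : (j = 0%N \/ j = D) \/ (0 < j < D)%N by lia.
  apply: Or32; split; [ | exact/hb | by case=> _ []; apply/hb].
  by rewrite hi; lia.
have nb : ~ case_boundary T g (other1 m j) (other2 m j) by rewrite hb; lia.
case: (boolP ((1 < j) && (j.+1 < D))%N) => [/andP/hi inn|ninn].
  by apply: Or31; split => //; case.
have ni : ~ case_inner i (other1 m j) (other2 m j) by rewrite hi => /andP; apply/negP.
apply: Or33; split => //; split => //.
case: j jD ext h ninn {hb hi nb ni} => [|j] jD ext h ninn; first by lia.
have jD' : (j.+1 < D)%N by lia.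
rewrite (outer1E jD ext) (outer2E jD' ext); lia.
Qed.

Lemma exactly_oneC e f : exactly_one (case_inner i e f) (case_boundary T g e f)
    (case_outer T g i e f) ->
  exactly_one (case_inner i f e) (case_boundary T g f e) (case_outer T g i f e).
Proof.
have E1 : case_inner i f e <-> case_inner i e f by rewrite /case_inner; tauto.
have E2 := case_boundaryC f e.
have E3 : case_outer T g i f e <-> case_outer T g i e f.
  by split=> -[h1 h2 h3]; split; rewrite ?E1 ?E2 // -?E1 -?E2 //; tauto.
by case=> -[h1 h2 h3]; [apply: Or31 | apply: Or32 | apply: Or33]; split;
  rewrite ?E1 ?E2 ?E3.
Qed.

Lemma balanced_exactly_one k k1 k2 k3 k4 : balanced_config T g k k1 k2 k3 k4 ->
  exactly_one (case_inner i k3 k4) (case_boundary T g k3 k4) (case_outer T g i k3 k4).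
Proof.
case/balanced_configP=> j [m [jD ext _ [[_ _ -> ->]|[_ _ -> ->]]]].
  exact: exactly_one_case.
exact/exactly_oneC/exactly_one_case.
Qed.

Definition extremal_ineq (m : bool) j (jD : (j <= D)%N) : fence_ineq D :=
  inr (Ordinal (jD : (j < D.+1)%N), m).

Lemma extremal_irr m j (jD : (j <= D)%N) : fence_irr s (extremal_ineq m jD) = extremal m j.
Proof. by case: m. Qed.

Lemma extremal_slack m j (jD : (j <= D)%N) z :
  fence_slack s z (extremal_ineq m jD) = bound m z j.
Proof. by case: m. Qed.

(** Several listed inequalities may define one facet: if three diagonals are crossed and the middle
    one is balanced, both outer inequalities have the slack of its bound. *)
Lemma facet_ineq_slack lhs rhs : facet_ineq T g i lhs rhs ->
  exists2 k : fence_ineq D, fence_irr s k &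
  exists2 t, 0 < t & forall z, rhs (Phi z) - lhs (Phi z) = t * fence_slack s z k.
Proof.
case=> [e eb dj|k k1 k2 k3 k4 cfg ci|k k1 k2 k3 k4 cfg cb b3|k k1 k2 k3 k4 cfg co o3].
- have [l lD ->] := boundary_disjoint triT gT st eb dj.
  exists (inl (Ordinal lD)) => //; exists 1 => // z.
  by rewrite subr0 mul1r Phi_cc.
- case/balanced_configP: cfg => j [m [jD ext -> h]].
  have hi := case_innerE jD ext; exists (extremal_ineq m jD); first by rewrite extremal_irr.
  exists 2 => // z; rewrite extremal_slack.
  have [j0 jD'] : (1 < j)%N /\ (j.+1 < D)%N.
    by apply/hi; case: h ci => -[_ _ -> ->] // []; split.
  case: j j0 jD ext h hi jD' => // j _ jD ext h _ jD'.
  rewrite -inner_slack ?(ltnW jD') //; case: h => -[-> -> _ _] //.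
  by congr (_ - _); rewrite addrAC.
- case/balanced_configP: cfg => j [m [jD ext _ h]].
  exists (extremal_ineq m jD); first by rewrite extremal_irr.
  exists 1 => // z; rewrite extremal_slack subr0 mul1r.
  case: h => -[_ _ E _]; subst k3; move: {cb} b3.
    case: j jD ext => [|j] jD ext b3; first by case: (other1_0 m).
    by move: b3; have [_ -> _] := extremal_prev jD ext; rewrite tau_nbd // ltnW.
  move: (jD); rewrite leq_eqVlt => /orP[/eqP->|jD'] b3; first by case: (other2_D m).
  by move: b3; have [_ -> _] := extremal_next jD' ext; rewrite tau_nbd.
- case/balanced_configP: cfg => j [m [jD ext _ h]].
  exists (extremal_ineq m jD); first by rewrite extremal_irr.
  exists 1 => // z; rewrite extremal_slack opprK mul1r.
  have nb : ~ (j = 0%N \/ j = D).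
    case: co => _ nb _; rewrite -(case_boundaryE jD ext).
    by case: h nb => -[_ _ -> ->] //; rewrite case_boundaryC.
  case: j jD ext h nb => [|j] jD ext h nb; first by case: nb; left.
  have jD' : (j.+1 < D)%N by lia.
  case: h => -[_ _ E _]; subst k3.
    move: (o3); rewrite outer1E // => j0; subst j.
    by have [_ -> _] := extremal_prev jD ext; rewrite (first_slack z jD ext).
  move: (o3); rewrite outer2E // => E.
  by have [_ -> _] := extremal_next jD' ext; rewrite E (last_slack z E ext).
Qed.

(** The position of an extremal element decides the rule: at an end of the fence, next to an end, or
    farther inside. *)
Lemma fence_irr_facet_ineq (k : fence_ineq D) : fence_irr s k ->
  exists lhs rhs, facet_ineq (R := R) T g i lhs rhs /\
  exists2 t, 0 < t & forall z, rhs (Phi z) - lhs (Phi z) = t * fence_slack s z k.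
Proof.
case: k => [l _|[o m] ext].
  exists (fun=> 0), (fun x => x 0 (cc l)); split.
    apply: ineq_boundary; first exact: (boundary_cc st).
    exact: (cc_disjoint st).
  by exists 1 => // z; rewrite subr0 mul1r Phi_cc.
case: o ext => j jD ext; rewrite -[inr _]/(extremal_ineq m jD) in ext *.
rewrite extremal_irr in ext.
have cfg : balanced_config T g (tau j) (side1 m j) (side2 m j) (other1 m j) (other2 m j).
  by apply/balanced_configP; exists j, m; split => //; left.
have cfg' : balanced_config T g (tau j) (side2 m j) (side1 m j) (other2 m j) (other1 m j).
  by apply/balanced_configP; exists j, m; split => //; right.
have hb := case_boundaryE jD ext; have hi := case_innerE jD ext.
have hx := exactly_one_case jD ext; have hx' := exactly_oneC hx.
have [j0|j0] := posnP j.
  subst j; have [bd sl] := other1_0 m.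
  exists (fun=> 0), (fun x => x 0 (other1 m 0)); split.
    by apply: (ineq_case_boundary _ _ cfg) => //; left.
  by exists 1 => // z; rewrite subr0 mul1r extremal_slack sl.
have [jE|jD'] := eqVneq j D.
  subst j; have [bd sl] := other2_D m.
  exists (fun=> 0), (fun x => x 0 (other2 m D)); split.
    by apply: (ineq_case_boundary _ _ cfg') => //; left.
  by exists 1 => // z; rewrite subr0 mul1r extremal_slack sl.
have {}jD' : (j < D)%N by rewrite ltn_neqAle jD'.
have nb : ~ case_boundary T g (other1 m j) (other2 m j) by rewrite hb; lia.
case: (boolP ((1 < j) && (j.+1 < D))%N) => [/andP/hi inn|ninn].
  exists (fun x => x 0 (tau j) + x 0 (side1 m j) + x 0 (side2 m j)), (fun=> 1); split.
    exact: ineq_case_inner cfg inn.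
  exists 2 => // z; rewrite extremal_slack.
  by case: j j0 jD ext jD' {cfg cfg' hb hi hx hx' nb inn} => // j _ jD ext jD'; rewrite inner_slack.
have ni : ~ case_inner i (other1 m j) (other2 m j) by rewrite hi => /andP; apply/negP.
have co : case_outer T g i (other1 m j) (other2 m j).
  by case: hx => -[h1 h2 h3]; [case: ni | case: nb | ].
have co' : case_outer T g i (other2 m j) (other1 m j).
  by case: hx' => -[h1 h2 h3]; [case: ni; case: h1 | case: nb; apply/case_boundaryC | ].
case: j jD ext j0 jD' ninn {hb hi ni nb hx hx'} cfg cfg' co co' => // j jD ext _ jD' ninn cfg cfg' co co'.
have jD0 : (j < D)%N := jD.
have [j0|j0] := posnP j.
  subst j; exists (fun=> -1), (fun x => x 0 (other1 m 1)); split.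
    exact: ineq_case_outer cfg co ((outer1E jD0 ext).2 erefl).
  exists 1 => // z; rewrite extremal_slack opprK mul1r.
  by have [_ -> _] := extremal_prev jD0 ext; rewrite (first_slack z jD0 ext).
have jE : j.+2 = D by lia.
exists (fun=> -1), (fun x => x 0 (other2 m j.+1)); split.
  exact: ineq_case_outer cfg' co' ((outer2E jD' ext).2 jE).
exists 1 => // z; rewrite extremal_slack opprK mul1r.
by have [_ -> _] := extremal_next jD' ext; rewrite jE (last_slack z jE ext).
Qed.

End StripInequalities.

(** * The Ptolemy recurrence and the conclusion *)

Lemma solve_exchange (K : fieldType) (t y u v w x : K) : t != 0 ->
  t * y = u * v + w * x -> y = x * w / t + v * u / t.
Proof. by move=> t0 E; apply: (mulfI t0); rewrite E; field. Qed.

Theorem theorem4p22 (R : realFieldType) (n : nat)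
    (T : 'I_(2 * n + 3) -> {set 'I_(n + 3)}) (p q : 'I_(n + 3))
    (d : nat) (i : 'I_d -> 'I_(2 * n + 3)) :
  let g := [set p; q] in
  let N := newton_polytope (R := R) (cluster_variable T g) in
  triangulation T ->
  diagonal g ->
  (forall k, T k <> g) ->
  crossed_in_order T p q i ->
  [/\ forall x, affine_hull N x <-> sub_equations T g x,
      forall a b c e f, balanced_config T g a b c e f ->
        exactly_one (case_inner i e f) (case_boundary T g e f)
          (case_outer T g i e f),
      forall lhs rhs, facet_ineq T g i lhs rhs ->
        (forall x, N x -> lhs x <= rhs x) /\
        facet N (fun x => N x /\ lhs x = rhs x)
    & forall F, facet N F ->
        exists lhs rhs, facet_ineq T g i lhs rhs /\
          forall x, F x <-> N x /\ lhs x = rhs x].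
Proof.
move=> g N triT dg gT ord_i.
(* By maximality a diagonal outside [T] crosses an edge of [T], so the list is nonempty; [D] is its
   last index. *)
have [D dE] : exists D, d = D.+1.
  case: d i ord_i => [|D] i ord_i; last by exists D.
  have [_ _ _ _ /(_ g dg) mx] := triT; have [|k /gT//] := mx.
  move=> k; apply/negP => h; case: ord_i => h' _.
  have : k \in crossed T g; last by case/h' => -[].
  rewrite inE; have [u [v [_ Ek]]] := label_ends triT k.
  by move: h; rewrite Ek !crossesE; cyclia.
subst d.
have [tau [cc [a [b [s [kpa [kpb [kqa [kqb [tau_i st]]]]]]]]]] := strip_exists triT ord_i.
have X0 (k : 'I_(2 * n + 3)) : tofrac ('X_k : {mpoly rat[2 * n + 3]}) != 0.
  exact: tofracX_neq0.
have [lam [lamC lamT ptolemy]] := lambda_lengths triT X0.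
have NE : N = convex_hull (fence_point (R := R) D s tau cc kpa kpb kqa kqb).
  rewrite /N /newton_polytope (cluster_variable_lambda triT lamC lamT ptolemy dg).
  congr convex_hull; apply: FunctionalExtensionality.functional_extensionality => x.
  apply: PropExtensionality.propositional_extensionality.
  apply: (@strip_expansion R _ D s tau cc kpa kpb kqa kqb
    (fun j => lam p (a j)) (fun j => lam p (b j))).
  - exact: lamT (strip_kpa st).
  - exact: lamT (strip_kpb st).
  - move=> l lD; have lD' := ltnW lD.
    have pa := a_arc st lD'; have qb := b_arc st lD'.
    have pa' := a_arc st lD; have qb' := b_arc st lD.
    rewrite -(lamT _ _ _ (tau_ends st lD)); have Et := lamT _ _ _ (tau_ends st lD').
    (* Ptolemy's relation for [p], the ends of [tau l] and the new end of [tau l.+1]: the diagonals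
       of this quadrilateral are [tau l] and the segment from [p] to the new end. *)
    case sl: (s l).
      have [Eb Ec c] := step_a st lD sl; rewrite Eb; split => //.
      apply: solve_exchange => //; rewrite -Et -(lamT _ _ _ Ec) (lamC p (a l.+1)).
      rewrite (ptolemy (a l) (a l.+1) (b l) p) ?(lamC (b l) p) //.
        by move: c pa' qb; cyclia.
      by move: pa qb; cyclia.
    have [Ea Ec c] := step_b st lD sl; rewrite Ea; split => //.
    rewrite addrC; apply: solve_exchange => //; rewrite -Et -(lamT _ _ _ Ec) (lamC p (b l.+1)).
    rewrite (ptolemy (a l) (b l.+1) (b l) p) ?(lamC p (b l)) //; last 2 first.
    + by move: c pa qb qb'; cyclia.
    + by move: pa qb; cyclia.
    by rewrite addrC (lamC (b l.+1) (b l)) (lamC (b l) p).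
  (* The last exchange takes place in the quadrilateral with diagonals [tau D] and [[p; q]]. *)
  - have pa := a_arc st (leqnn D); have qb := b_arc st (leqnn D).
    apply: solve_exchange => //.
    rewrite -(lamT _ _ _ (tau_ends st (leqnn D))) -(lamT _ _ _ (strip_kqa st)).
    rewrite -(lamT _ _ _ (strip_kqb st)) (lamC p q).
    rewrite (ptolemy (a D) q (b D) p) ?(lamC (a D) q) ?(lamC (b D) p) //.
      by move: pa qb; cyclia.
    by move: pa qb; cyclia.
have [x0 [U AU]] := sub_equations_space R triT st.
have Astrip := strip_equations (R := R) triT st.
have Ainj := @sub_equations_inj R n T p q D tau cc a b s kpa kpb kqa kqb triT gT st.
have h1 := strip_tau_inj st; have h2 := strip_cc_inj st; have h3 := strip_tau_cc st.
have h4 := strip_k_tau st; have h5 := strip_k_cc st; have h6 := strip_k_uniq st.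
rewrite NE; split.
- move=> x; exact: (affine_hull_fence h2 h3 h4 h5 h6 AU Astrip Ainj).
- by move=> k k1 k2 k3 k4; apply: balanced_exactly_one triT st tau_i _ _ _ _ _.
- move=> lhs rhs /(facet_ineq_slack triT gT st tau_i)[k irr [t t0 hE]].
  exact: (fence_facet h2 h3 h4 h5 h6 AU Astrip Ainj irr t0 hE).
- move=> F /(facet_fence h2 h3 h4 h5 h6 AU Astrip Ainj)[k irr FE].
  have [lhs [rhs [fi [t t0 hE]]]] := fence_irr_facet_ineq R triT st tau_i irr.
  by exists lhs, rhs; split => // x; apply: FE t0 hE x.
Qed.
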